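(* Let $r,s:\mathbb{Z}\to\mathbb{R}$ be correlation functions with $r(0)=s(0)=1$ and $s\in\ell^2(\mathbb{Z})$. Let $\{X_{ij}:i,j\ge1\}$ be jointly Gaussian centered random variables with $\mathbb{E}[X_{ij}X_{i'j'}]=r(i-i')s(j-j')$. For $n,d\ge1$ let $\widetilde{\mathcal{W}}_{n,d}=(\widetilde W_{ij})_{1\le i,j\le n}$ with $$\widetilde W_{ij}=\frac1{\sqrt d}\sum_{k=1}^d\big(X_{ik}X_{jk}-r(i-j)\big),$$ and let $\mathcal{G}^{(r,s)}_{n,d}=(G_{ij})_{1\le i,j\le n}$ be a symmetric random matrix whose entries form a centered Gaussian vector of $\mathbb{R}^{n^2}$ with the same covariance matrix as the vector of entries of $\widetilde{\mathcal{W}}_{n,d}$. Then: (1) we have $$d_2\big((\widetilde{\mathcal{W}}_{n,d})^{\rm half},(\mathcal{G}_{n,d}^{(r,s)})^{\rm half}\big)=O\Big\{\frac{n^4}{\sqrt d}\Big(\sum_{|k|\le d}|s(k)|^{4/3}\Big)^{3/2}\Big\},\qquad \widetilde{d_2}\big((\widetilde{\mathcal{W}}_{n,d})^{\rm half},(\mathcal{G}_{n,d}^{(r,s)})^{\rm half}\big)=O\Big\{\frac{n^3}{\sqrt d}\Big(\sum_{|k|\le d}|s(k)|^{4/3}\Big)^{3/2}\Big\};$$ (2) if in addition $r\in\ell^2(\mathbb{Z})$, $$d_2\big((\widetilde{\mathcal{W}}_{n,d})^{\rm half},(\mathcal{G}_{n,d}^{(r,s)})^{\rm half}\big)=O\Big\{\frac{n^{7/2}}{\sqrt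 d}\Big(\sum_{|k|\le d}|s(k)|^{4/3}\Big)^{3/2}\Big\},\qquad \widetilde{d_2}\big((\widetilde{\mathcal{W}}_{n,d})^{\rm half},(\mathcal{G}_{n,d}^{(r,s)})^{\rm half}\big)=O\Big\{\frac{n^{5/2}}{\sqrt d}\Big(\sum_{|k|\le d}|s(k)|^{4/3}\Big)^{3/2}\Big\};$$ (3) if in addition $r\in\ell^1(\mathbb{Z})$, $$d_2\big((\widetilde{\mathcal{W}}_{n,d})^{\rm half},(\mathcal{G}_{n,d}^{(r,s)})^{\rm half}\big)=O\Big\{\frac{n^{3}}{\sqrt d}\Big(\sum_{|k|\le d}|s(k)|^{4/3}\Big)^{3/2}\Big\},\qquad \widetilde{d_2}\big((\widetilde{\mathcal{W}}_{n,d})^{\rm half},(\mathcal{G}_{n,d}^{(r,s)})^{\rm half}\big)=O\Big\{\frac{n^{5/2}}{\sqrt d}\Big(\sum_{|k|\le d}|s(k)|^{4/3}\Big)^{3/2}\Big\}.$$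
   Context: The $O\{\cdot\}$ bounds hold for $n,d\ge1$ with constants not depending on $n$ and $d$. The array may be realized as $X_{ij}=X(e_{ij})$, where $X$ is an isonormal Gaussian process over a real separable Hilbert space $\mathfrak{H}$ and $\{e_{ij}\}\subset\mathfrak{H}$ satisfies $\langle e_{ij},e_{i'j'}\rangle_{\mathfrak{H}}=r(i-i')s(j-j')$. For a symmetric $n\times n$ matrix $\mathcal{Z}=(Z_{ij})$, $\mathcal{Z}^{\rm half}=(Z_{11},Z_{12},\ldots,Z_{1n},Z_{22},Z_{23},\ldots,Z_{2n},\ldots,Z_{nn})^T\in\mathbb{R}^{n(n+1)/2}$ is the vector of its upper-triangular entries. For $m$-dimensional random vectors $X,Y$ with square-integrable components, $$d_2(X,Y)=\sup_{\|h''\|_\infty\le1}|\mathbb{E}[h(X)]-\mathbb{E}[h(Y)]|,\qquad\widetilde{d_2}(X,Y)=\sup_{M_2(h)\le1}|\mathbb{E}[h(X)]-\mathbb{E}[h(Y)]|,$$ the suprema being over $h\in C^2(\mathbb{R}^m)$, where $\|h''\|_\infty=\sup\{|\frac{\partial^2h}{\partial x_i\partial x_j}(x)|:x\in\mathbb{R}^m,1\le i,j\le m\}$ and $M_2(h)=\sup\{\|D^2h(x)\|_{\rm op}:x\in\mathbb{R}^m\}$ with $D^2h$ the Hessian and $\|\cdot\|_{\rm op}$ the operator norm. *)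

(* Defs.v *)
From HB Require Import structures.
From mathcomp Require Import all_boot all_order all_algebra.
From mathcomp Require Import all_classical all_reals all_analysis.
Import Order.TTheory GRing.Theory Num.Theory.
Import numFieldNormedType.Exports.

Set Implicit Arguments.
Unset Strict Implicit.
Unset Printing Implicit Defensive.

Local Open Scope classical_set_scope.
Local Open Scope ring_scope.

Definition correlation_function (R : realType) (r : int -> R) : Prop :=
  (forall k : int, r (- k) = r k) /\
  (forall (n : nat) (k : 'I_n -> int) (c : 'I_n -> R),
     0 <= \sum_(a < n) \sum_(b < n) c a * c b * r (k a - k b)).

Definition ell (R : realType) (p : R) (r : int -> R) : Prop :=
  summable [set: int] (fun k => (`|r k| `^ p)%:E).

(* The sum of |s k|^p over the integers k with -d <= k <= d. *)
Definition window_sum (R : realType) (p : R) (s : int -> R) (d : nat) : R :=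
  \sum_(k < d.*2.+1) `|s ((k : nat)%:Z - d%:Z)| `^ p.

(* [normal_prob m 0] is the uniform law on [0, 1], so the degenerate Gaussian
   law has to be singled out. *)
Definition gaussian_law (R : realType) (m sigma : R) : set R -> \bar R :=
  if sigma == 0 then \d_m else normal_prob m sigma.

Definition gaussian (dT : measure_display) (T : measurableType dT)
    (R : realType) (P : probability T R) (Z : T -> R) : Prop :=
  measurable_fun [set: T] Z /\
  exists m sigma : R, forall A : set R, measurable A ->
    P (Z @^-1` A) = gaussian_law m sigma A.

Definition jointly_gaussian (dT : measure_display) (T : measurableType dT)
    (R : realType) (P : probability T R) (I : Type) (Z : I -> T -> R) : Prop :=
  forall (l : seq I) (c : I -> R), gaussian P (fun w => \sum_(i <- l) c i * Z i w).

Definition centered_gaussian (dT : measure_display) (T : measurableType dT)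
    (R : realType) (P : probability T R) (I : Type) (Z : I -> T -> R) : Prop :=
  jointly_gaussian P Z /\ (forall i : I, 'E_P[Z i] = 0)%E.

Section test_functions.
Variables (R : realType) (m : nat).
Implicit Types (h : 'rV[R]_m -> R) (x : 'rV[R]_m) (i j : 'I_m).

Definition basis_vec i : 'rV[R]_m := delta_mx 0 i.

Definition partial1 h i : 'rV[R]_m -> R := fun x => 'D_(basis_vec i) h x.

Definition partial2 h i j : 'rV[R]_m -> R := partial1 (partial1 h j) i.

Definition C2 h : Prop :=
  [/\ continuous h,
      forall i, (forall x, derivable h x (basis_vec i)) /\
                continuous (partial1 h i) &
      forall i j, (forall x, derivable (partial1 h j) x (basis_vec i)) /\
                  continuous (partial2 h i j)].

Definition hessian h x : 'M[R]_m := \matrix_(i, j) partial2 h i j x.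

(* The library norm on matrices is the sup norm; the operator norm is taken
   with respect to the Euclidean norm. *)
Definition euclidean_norm (v : 'cV[R]_m) : R := Num.sqrt (\sum_i v i 0 ^+ 2).

Definition op_norm (A : 'M[R]_m) : \bar R :=
  ereal_sup [set (euclidean_norm (A *m v))%:E
            | v in [set v : 'cV[R]_m | euclidean_norm v <= 1]].

Definition hess_sup h : \bar R :=
  ereal_sup [set (`|partial2 h p.1.1 p.1.2 p.2|)%:E
            | p in [set: 'I_m * 'I_m * 'rV[R]_m]].

Definition M2 h : \bar R := ereal_sup [set op_norm (hessian h x) | x in setT].

End test_functions.

Section distances.
Variables (R : realType) (m : nat).
Variables (d1 : measure_display) (T1 : measurableType d1) (P1 : probability T1 R).
Variables (d2 : measure_display) (T2 : measurableType d2) (P2 : probability T2 R).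
Variables (X : T1 -> 'rV[R]_m) (Y : T2 -> 'rV[R]_m).

Definition expectation_gap (h : 'rV[R]_m -> R) : \bar R :=
  (`|'E_P1[fun w => h (X w)] - 'E_P2[fun w => h (Y w)]|)%E.

Definition dist2 : \bar R :=
  ereal_sup [set expectation_gap h | h in [set h | C2 h /\ (hess_sup h <= 1)%E]].

Definition dist2_tilde : \bar R :=
  ereal_sup [set expectation_gap h | h in [set h | C2 h /\ (M2 h <= 1)%E]].

End distances.

Definition upper_pairs (n : nat) : {set 'I_n * 'I_n} :=
  [set p : 'I_n * 'I_n | (p.1 <= p.2)%N].

Lemma card_upper_pairs n : #|upper_pairs n| = (n * n.+1)./2.
Proof.
rewrite /upper_pairs -sum1dep_card.
rewrite -(pair_big_dep xpredT (fun i j : 'I_n => (i <= j)%N) (fun _ _ => 1%N)) /=.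
rewrite (exchange_big_dep xpredT) //=.
have cardle (j : 'I_n) : (\sum_(i < n | i <= j) 1 = j.+1)%N.
  rewrite -(big_ord_widen n (fun=> 1%N) (ltn_ord j)).
  by rewrite sum1_card card_ord.
under eq_bigr do rewrite cardle.
by rewrite mulnC -(bin2 n.+1) -bin2_sum big_mkord big_ord_recl add0n.
Qed.

(* Products of finite types are enumerated with the first component outermost,
   so [enum_val] runs through (1,1), (1,2), ..., (1,n), (2,2), ..., (n,n). *)
Definition upper_pair (n : nat) (k : 'I_((n * n.+1)./2)) : 'I_n * 'I_n :=
  enum_val (cast_ord (esym (card_upper_pairs n)) k).

Definition half_vec (R : realType) (n : nat) (Z : 'M[R]_n) :
    'rV[R]_((n * n.+1)./2) :=
  \row_k Z (upper_pair k).1 (upper_pair k).2.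

(* The array is indexed from 0: [X i k] stands for X_{i+1,k+1}; only differences
   of indices enter the covariance. *)
Definition wishart (T : Type) (R : realType) (r : int -> R)
    (X : nat -> nat -> T -> R) (n d : nat) (w : T) : 'M[R]_n :=
  \matrix_(i, j) ((Num.sqrt d%:R)^-1 *
    \sum_(k < d) (X i k w * X j k w - r ((i : nat)%:Z - (j : nat)%:Z))).

Definition gaussian_counterpart (R : realType) (n : nat)
    (dT : measure_display) (T : measurableType dT) (P : probability T R)
    (W : T -> 'M[R]_n)
    (dG : measure_display) (TG : measurableType dG) (PG : probability TG R)
    (G : TG -> 'M[R]_n) : Prop :=
  [/\ forall w, (G w)^T = G w,
      centered_gaussian PG (fun (p : 'I_n * 'I_n) w => G w p.1 p.2) &
      forall i j i' j' : 'I_n,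
        covariance PG (fun w => G w i j) (fun w => G w i' j') =
        covariance P (fun w => W w i j) (fun w => W w i' j')].

(* Main.v *)
Require Import Defs.
From HB Require Import structures.
From mathcomp Require Import all_boot all_order all_algebra.
From mathcomp Require Import all_classical all_reals all_analysis.
From mathcomp Require Import measurable_realfun zify ring lra.
Import Order.TTheory GRing.Theory Num.Theory.
Import numFieldNormedType.Exports.

Set Implicit Arguments.
Unset Strict Implicit.
Unset Printing Implicit Defensive.

Local Open Scope classical_set_scope.
Local Open Scope ring_scope.

(* The vector W of entries of the Wishart matrix is a vector of quadratic forms
   in Gaussian variables, so Gaussian integration by parts gives
     E[W_p f(W)] = sum_q E[K_pq d_q f(W)],   K_pq quadratic in X,
   while its Gaussian counterpart V satisfies the same identity with the constant
   kernel E[K_pq].  For V independent of W, differentiating E[h(sin t W + cos t V)]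
   in t leaves
     sin t cos t E[sum_pq (K_pq - E K_pq) d_pq h(sin t W + cos t V)],
   so the distances are controlled by the fluctuations of K.  Here
     K_pq = r(i - i') B_jj' + r(i - j') B_ji',  p = (i, j), q = (i', j'),
     B_jj' = (1/d) sum_kl s(k - l) X_jk X_j'l,
   and by Wick's formula and Young's inequality |s * s|_2 <= |s|_{4/3}^2 the variance
   of B_jj' is at most (2/d) (sum_{|k| <= d} |s k|^{4/3})^3.

   Integration by parts for a jointly Gaussian vector Z, given only through its
   one-dimensional projections, comes from an independent copy Z': Z + tZ' and
   Z'_a - tZ_a are uncorrelated, hence E[(Z'_a - tZ_a) g(Z + tZ')] = 0 (checked on
   trigonometric g, then extended by coordinatewise Bernstein approximation), and
   one differentiates at t = 0. *)

(** * Shifts of Gaussian laws *)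

(** The powers of n come from how the Hessian is measured. Under an entrywise bound, sum_pq E|K_pq -
    E K_pq| is at most a constant times n^2 sum_ij |r(i - j)| times the mean deviation of B, the
    factor n^2 counting two free indices. Under an operator norm bound every column of the Hessian
    has Euclidean norm at most 1, so its squared entries add up to at most n^2, and a Cauchy-Schwarz
    type estimate leaves n^2 (sum_ij r(i - j)^2)^(1/2). Since |r| <= 1 both double sums are O(n^2);
    for r in l^2 the squared one is O(n) and the absolute one O(n^(3/2)); for r in l^1 both are
    O(n). Covariances may be degenerate, so there is no joint density to integrate against, and a
    test function with bounded second derivatives may itself be unbounded. Hence the work with
    one-dimensional projections and with functions of polynomial growth. *)

Section normal_shift.
Context {R : realType}.
Local Notation mu := (@lebesgue_measure R).

Lemma ge0_integral_normal_prob (m s : R) (f : R -> \bar R) :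
  measurable_fun [set: R] f -> (forall x, (0 <= f x)%E) ->
  (\int[normal_prob m s]_x f x = \int[mu]_x (f x * (normal_pdf m s x)%:E))%E.
Proof.
move=> mf f0.
have dom := normal_prob_dominates m s.
rewrite -(Radon_Nikodym_SigmaFinite.change_of_variables dom)//.
have intg := Radon_Nikodym_SigmaFinite.f_integrable dom.
apply: ae_eq_integral => //.
- by apply: emeasurable_funM => //; exact: measurable_int intg.
- apply: emeasurable_funM => //; apply/measurableT_comp => //.
  exact: measurable_normal_pdf.
- apply: ae_eqe_mul2l; apply: integral_ae_eq => //.
  + by apply/measurableT_comp => //; exact: measurable_normal_pdf.
  + by move=> E _ mE; rewrite -Radon_Nikodym_SigmaFinite.f_integral.
Qed.

(** Completing the square: tilting the density by exp(c(x - m)) translates it by c s^2, up to the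
    constant exp(c^2 s^2 / 2). This is the one-dimensional Cameron-Martin formula. *)
Lemma normal_prob_shift (m s c : R) (f : R -> R) : s != 0 ->
  continuous f -> (forall x, 0 <= f x) ->
  (\int[normal_prob m s]_x (f x * expR (c * (x - m)))%:E =
   (expR (c ^+ 2 * s ^+ 2 / 2))%:E *
     \int[normal_prob m s]_x (f (x + c * s ^+ 2))%:E)%E.
Proof.
move=> s0 cf f0.
have mf : measurable_fun setT f by exact: continuous_measurable_fun.
have cexp (a b : R) : continuous (fun x : R => expR (a * (x - b))).
  move=> x; apply: (@continuous_comp _ _ _ (fun x => a * (x - b)) expR).
    apply: cvgM; first exact: cvg_cst.
    by apply: cvgB; [exact: cvg_id|exact: cvg_cst].
  exact: continuous_expR.
have cshift (a : R) : continuous (fun x : R => x + a).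
  by move=> x; apply: cvgD; [exact: cvg_id|exact: cvg_cst].
have mfs : measurable_fun setT (fun x : R => f (x + c * s ^+ 2)).
  by apply: measurableT_comp => //; apply: continuous_measurable_fun; exact: cshift.
have mfe : measurable_fun setT (fun x : R => f x * expR (c * (x - m))).
  by apply: measurable_funM => //; apply: continuous_measurable_fun; exact: cexp.
rewrite ge0_integral_normal_prob; [|exact/measurable_EFinP|]; last first.
  by move=> x; rewrite lee_fin mulr_ge0 ?expR_ge0.
rewrite ge0_integral_normal_prob; [|exact/measurable_EFinP|]; last first.
  by move=> x; rewrite lee_fin.
rewrite -ge0_integralZl//; last first.
- by move=> x _; rewrite -EFinM lee_fin mulr_ge0 ?normal_pdf_ge0.
- apply: emeasurable_funM; apply/measurableT_comp => //.
  exact: measurable_normal_pdf.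
pose G x := f x * expR (c * (x - m)) * normal_pdf m s x.
transitivity (\int[mu]_x (G x)%:E)%E; first by [].
have dF x : is_derive x (1 : R) (fun x : R => x + c * s ^+ 2) 1.
  by apply: is_derive_eq; rewrite addr0.
have F'E : (fun x : R => x + c * s ^+ 2)^`()%classic = cst 1.
  by apply/funext => x; rewrite derive1E; exact: derive_val.
rewrite (@increasing_ge0_integration_by_substitutionT R (fun x => x + c * s ^+ 2) G).
- apply: eq_integral => x _; rewrite F'E /= fctE mulr1 -!EFinM; congr EFin.
  rewrite /G !normal_pdfE// /= /normal_fun /=.
  rewrite [RHS]mulrCA -!mulrA; congr (_ * _).
  rewrite mulrCA [RHS]mulrCA; congr (_ * _).
  rewrite -!expRD; congr expR; rewrite -mulr_natr; field.
  by rewrite s0 /=.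
- by move=> x y xy; rewrite ltrD2r.
- by rewrite F'E => x; exact: cvg_cst.
- by rewrite F'E; exact: is_cvg_cst.
- by rewrite F'E; exact: is_cvg_cst.
- by move=> x; exact: ex_derive.
- exact: cvg_addrr_Ny.
- exact: cvg_addrr.
- move=> x; apply: cvgM; last exact: continuous_normal_pdf.
  by apply: cvgM; [exact: cf|exact: cexp].
- by move=> x; rewrite !mulr_ge0 ?expR_ge0 ?normal_pdf_ge0.
Qed.

End normal_shift.

Section gaussian_shift.
Context d (T : measurableType d) (R : realType) (P : probability T R).

Lemma integral_law d' (Y : measurableType d') (L : T -> Y)
    (nu : {measure set Y -> \bar R}) (f : Y -> R) :
  measurable_fun setT L -> (forall A, measurable A -> P (L @^-1` A) = nu A) ->
  measurable_fun setT f -> (forall x, 0 <= f x) ->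
  (\int[P]_w (f (L w))%:E = \int[nu]_x (f x)%:E)%E.
Proof.
move=> mL lawL mf f0.
have mef : measurable_fun setT (EFin \o f) by exact/measurable_EFinP.
transitivity (\int[pushforward P L]_x (f x)%:E)%E.
  by rewrite (ge0_integral_pushforward mL P measurableT mef)// => x _; rewrite lee_fin.
apply: eq_measure_integral => A mA _; exact: lawL.
Qed.

(** Besides measurability, the only fact about a Gaussian law used later. In the degenerate case the
    law is a Dirac mass and both sides equal f(m). For nonnegative f no integrability has to be
    known beforehand. *)
Lemma gaussian_shift (L : T -> R) : gaussian P L ->
  exists m s : R, forall (f : R -> R) (c : R), continuous f -> (forall x, 0 <= f x) ->
  (\int[P]_w (f (L w) * expR (c * (L w - m)))%:E =
   (expR (c ^+ 2 * s ^+ 2 / 2))%:E * \int[P]_w (f (L w + c * s ^+ 2))%:E)%E.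
Proof.
move=> [mL [m [s lawL]]]; exists m, s => f c cf f0.
have mf : measurable_fun setT f by exact: continuous_measurable_fun.
have mshift : measurable_fun setT (fun x : R => f (x + c * s ^+ 2)).
  apply: measurableT_comp => //; apply: continuous_measurable_fun => x.
  by apply: cvgD; [exact: cvg_id|exact: cvg_cst].
have mexp : measurable_fun setT (fun x : R => f x * expR (c * (x - m))).
  apply: measurable_funM => //; apply: measurableT_comp => //.
  by apply: measurable_funM => //; exact: measurable_funB.
have fe0 x : 0 <= f x * expR (c * (x - m)) by rewrite mulr_ge0 ?expR_ge0.
move: lawL; rewrite /gaussian_law; case: eqVneq => [->|s0] lawL.
  rewrite (integral_law (Y := R) (f := fun x => f x * expR (c * (x - m))) mL lawL)//.
  rewrite (integral_law (Y := R) (f := fun x => f (x + c * 0 ^+ 2)) mL lawL)//; last first.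
    by under eq_fun do rewrite expr0n /= mulr0 addr0.
  rewrite !integral_dirac//; last 2 first.
    by apply/measurable_EFinP; under eq_fun do rewrite expr0n /= mulr0 addr0.
    exact/measurable_EFinP.
  by rewrite !diracT !mul1e subrr mulr0 expR0 mulr1 expr0n /= !mulr0 mul0r addr0
    expR0 mul1e.
rewrite (integral_law (Y := measurableTypeR R) (nu := normal_prob m s)
  (f := fun x => f x * expR (c * (x - m))) mL lawL)//.
by rewrite (integral_law (Y := measurableTypeR R) (nu := normal_prob m s)
  (f := fun x => f (x + c * s ^+ 2)) mL lawL)// normal_prob_shift.
Qed.

End gaussian_shift.

(** * Real-valued means *)

Section mean.
Context d (T : measurableType d) (R : realType) (P : probability T R).
Implicit Types f g : T -> R.

Definition itg f : Prop := P.-integrable [set: T] (EFin \o f).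

Definition mean f : R := \int[P]_w f w.

Lemma itg_measurable f : itg f -> measurable_fun [set: T] f.
Proof. by move=> /(measurable_int P) /measurable_EFinP. Qed.

Lemma itg_le f g : measurable_fun [set: T] f -> itg g ->
  (forall w, `|f w| <= g w) -> itg f.
Proof.
move=> mf ig fg; apply: le_integrable ig => //.
- exact/measurable_EFinP.
- by move=> w _ /=; rewrite lee_fin (le_trans (fg w))// ler_norm.
Qed.

Lemma itg_cst c : itg (fun=> c).
Proof. exact: finite_measure_integrable_cst. Qed.

Lemma itgD f g : itg f -> itg g -> itg (fun w => f w + g w).
Proof. by move=> f1 g1; have := integrableD measurableT f1 g1; apply: eq_integrable. Qed.

Lemma itgB f g : itg f -> itg g -> itg (fun w => f w - g w).
Proof. by move=> f1 g1; have := integrableB measurableT f1 g1; apply: eq_integrable. Qed.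

Lemma itgZ c f : itg f -> itg (fun w => c * f w).
Proof. by move=> f1; have := integrableZl measurableT c f1; apply: eq_integrable. Qed.

Lemma itg_norm f : itg f -> itg (fun w => `|f w|).
Proof. by move=> /integrable_norm. Qed.

Lemma itg_sum (I : Type) (l : seq I) (F : I -> T -> R) :
  (forall i, itg (F i)) -> itg (fun w => \sum_(i <- l) F i w).
Proof.
move=> iF; elim: l => [|i l IH].
  by under eq_fun do rewrite big_nil; exact: itg_cst.
by under eq_fun do rewrite big_cons; exact: itgD.
Qed.

Lemma mean_cst c : mean (fun=> c) = c.
Proof. by rewrite /mean Rintegral_cst//= probability_setT mulr1. Qed.

Lemma meanD f g : itg f -> itg g -> mean (fun w => f w + g w) = mean f + mean g.
Proof. by move=> ? ?; rewrite /mean RintegralD. Qed.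

Lemma meanB f g : itg f -> itg g -> mean (fun w => f w - g w) = mean f - mean g.
Proof. by move=> ? ?; rewrite /mean RintegralB. Qed.

Lemma meanZ c f : itg f -> mean (fun w => c * f w) = c * mean f.
Proof. by move=> ?; rewrite /mean RintegralZl. Qed.

Lemma mean_sum (I : Type) (l : seq I) (F : I -> T -> R) :
  (forall i, itg (F i)) -> mean (fun w => \sum_(i <- l) F i w) = \sum_(i <- l) mean (F i).
Proof.
move=> iF; elim: l => [|i l IH].
  by under eq_fun do rewrite big_nil; rewrite mean_cst big_nil.
under eq_fun do rewrite big_cons; rewrite big_cons meanD ?IH//; exact: itg_sum.
Qed.

Lemma le_mean f g : itg f -> itg g -> (forall w, f w <= g w) -> mean f <= mean g.
Proof. by move=> ? ? fg; apply: le_Rintegral => // w _; exact: fg. Qed.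

Lemma norm_mean_le f g : itg f -> itg g -> (forall w, `|f w| <= g w) ->
  `|mean f| <= mean g.
Proof.
move=> f1 g1 fg; apply: (le_trans (le_normr_Rintegral measurableT f1)).
by apply: le_mean => //; exact: itg_norm.
Qed.

Lemma EFin_mean f : itg f -> (mean f)%:E = (\int[P]_w (f w)%:E)%E.
Proof. by move=> f1; rewrite /mean /Rintegral fineK//; exact: integrable_fin_num. Qed.

Lemma mean_cvg (F : nat -> T -> R) f g : itg g ->
  (forall n, measurable_fun [set: T] (F n)) ->
  (forall n w, `|F n w| <= g w) ->
  (forall w, F n w @[n --> \oo] --> f w) ->
  itg f /\ (mean (F n) @[n --> \oo] --> mean f).
Proof.
move=> ig mF Fg Ff.
have mf : measurable_fun [set: T] f by apply: (@measurable_fun_cvg _ _ _ _ F) => // x _; exact: Ff.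
have [] := @dominated_convergence _ T R P setT measurableT
  (fun n w => (F n w)%:E) (EFin \o f) (EFin \o g).
- by move=> n; exact/measurable_EFinP.
- exact/measurable_EFinP.
- by apply: aeW => w _; apply: cvg_EFin; [exact: nearW|exact: Ff].
- exact: ig.
- by apply: aeW => w n _; rewrite lee_fin.
move=> i1 _ c; split => //.
have c' : (\int[P]_w (F n w)%:E)%E @[n --> \oo] --> (mean f)%:E by rewrite EFin_mean.
exact: (fine_cvg c').
Qed.

(** Domination is asked only on a unit window around [a]: bounds such as those on exp(tL) are
    uniform only for bounded t. *)
Lemma is_derive_mean (K dK : R -> T -> R) g (a : R) : itg g ->
  (forall t, a - 1 < t < a + 1 -> itg (K t)) ->
  (forall t w, a - 1 < t < a + 1 -> is_derive t 1 (K^~ w) (dK t w)) ->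
  (forall t w, a - 1 < t < a + 1 -> `|dK t w| <= g w) ->
  is_derive a 1 (fun t => mean (K t)) (mean (dK a)).
Proof.
move=> ig iK dKP dKg.
have aa : `]a - 1, a + 1[%classic a by rewrite /= in_itv/= ltrBlDr ltrDl ltr01.
have dE t w : a - 1 < t < a + 1 -> partial1of2 K t w = dK t w.
  by move=> /(dKP _ w) ?; rewrite partial1of2E; exact: derive_val.
have iK' x : `]a - 1, a + 1[%classic x -> P.-integrable setT (EFin \o K x).
  by rewrite /= in_itv/= => /iK.
have dK1 x y : `]a - 1, a + 1[%classic x -> setT y -> derivable (K^~ y) x 1.
  by rewrite /= in_itv/= => /(dKP _ y) ? _; exact: ex_derive.
have dK2 x y : `]a - 1, a + 1[%classic x -> setT y -> `|partial1of2 K x y| <= g y.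
  by rewrite /= in_itv/= => xa _; rewrite dE//; exact: dKg.
have g0 y : 0 <= g y by apply: le_trans (dK2 a y aa Logic.I).
apply: DeriveDef.
- exact: (derivable_under_integral measurableT aa iK' dK1 g0 ig dK2).
- rewrite -derive1E (differentiation_under_integral measurableT aa iK' dK1 g0 ig dK2).
  by rewrite /mean; apply: eq_Rintegral => w _; rewrite -dE.
Qed.

(** Unlike integrability, this is stable under products, so integrability of every polynomial
    expression reduces to that of its generators; the tactic [moments] relies on this. *)
Definition all_moments f : Prop :=
  measurable_fun [set: T] f /\ forall k, itg (fun w => `|f w| ^+ k).

Lemma all_moments_le f g : measurable_fun [set: T] f -> all_moments g ->
  (forall w, `|f w| <= `|g w|) -> all_moments f.
Proof.
move=> mf [_ ig] fg; split => // k; apply: itg_le (ig k) _.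
  by apply: measurable_funX; apply: measurableT_comp.
by move=> w; rewrite ger0_norm ?exprn_ge0// lerXn2r ?nnegrE.
Qed.

Lemma all_moments_itg f : all_moments f -> itg f.
Proof.
by move=> [mf /(_ 1%N) i1]; apply: itg_le i1 _.
Qed.

Lemma all_moments_cst c : all_moments (fun=> c).
Proof. by split => // k; exact: itg_cst. Qed.

Lemma all_moments_norm f : all_moments f -> all_moments (fun w => `|f w|).
Proof.
by move=> fm; apply: (all_moments_le _ fm) => [|w];
  [apply: measurableT_comp => //; exact: fm.1|rewrite normr_id].
Qed.

Lemma all_momentsX f n : all_moments f -> all_moments (fun w => f w ^+ n).
Proof.
move=> [mf i1]; split; first exact: measurable_funX.
by move=> k; under eq_fun do rewrite normrX -exprM; exact: i1.
Qed.

Lemma all_momentsM f g : all_moments f -> all_moments g ->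
  all_moments (fun w => f w * g w).
Proof.
move=> [mf i1] [mg i2]; split; first exact: measurable_funM.
move=> k; apply: (@itg_le _ (fun w => `|f w| ^+ (k * 2) + `|g w| ^+ (k * 2))).
- apply: measurable_funX; apply: measurableT_comp => //; exact: measurable_funM.
- exact: itgD.
move=> w; rewrite ger0_norm ?exprn_ge0// normrM exprMn !exprM.
have := sqr_ge0 (`|f w| ^+ k - `|g w| ^+ k).
have := sqr_ge0 (`|f w| ^+ k + `|g w| ^+ k).
move: (`|f w| ^+ k) (`|g w| ^+ k) => a b; nra.
Qed.

Lemma all_momentsZ c f : all_moments f -> all_moments (fun w => c * f w).
Proof. by move=> fm; apply: all_momentsM => //; exact: all_moments_cst. Qed.

Lemma all_momentsD f g : all_moments f -> all_moments g ->
  all_moments (fun w => f w + g w).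
Proof.
move=> fm gm; have [[mf i1] [mg i2]] := (fm, gm).
split; first exact: measurable_funD.
move=> k; apply: (@itg_le _ (fun w => 2 ^+ k * (`|f w| ^+ k + `|g w| ^+ k))).
- apply: measurable_funX; apply: measurableT_comp => //; exact: measurable_funD.
- by apply: itgZ; exact: itgD.
move=> w; rewrite ger0_norm ?exprn_ge0//.
have le2 (a b : R) : 0 <= a -> 0 <= b -> a <= b -> (a + b) ^+ k <= 2 ^+ k * (a ^+ k + b ^+ k).
  move=> a0 b0 ab; apply: (@le_trans _ _ ((2 * b) ^+ k)).
    by apply: lerXn2r; rewrite ?nnegrE; lra.
  by rewrite exprMn ler_wpM2l ?lerDr ?exprn_ge0.
apply: (@le_trans _ _ ((`|f w| + `|g w|) ^+ k)).
  by apply: lerXn2r; rewrite ?nnegrE ?addr_ge0 ?normr_ge0// ler_normD.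
have [fg|/ltW gf] := leP `|f w| `|g w|; first exact: le2.
by rewrite addrC [X in _ * X]addrC; exact: le2.
Qed.

Lemma all_momentsN f : all_moments f -> all_moments (fun w => - f w).
Proof. by move=> /(all_momentsZ (-1)); under eq_fun do rewrite mulN1r. Qed.

Lemma all_momentsB f g : all_moments f -> all_moments g ->
  all_moments (fun w => f w - g w).
Proof. by move=> fm gm; apply: all_momentsD => //; exact: all_momentsN. Qed.

Lemma all_moments_sum (I : Type) (l : seq I) (F : I -> T -> R) :
  (forall i, all_moments (F i)) -> all_moments (fun w => \sum_(i <- l) F i w).
Proof.
move=> iF; elim: l => [|i l IH].
  by under eq_fun do rewrite big_nil; exact: all_moments_cst.
by under eq_fun do rewrite big_cons; exact: all_momentsD.
Qed.

End mean.

Ltac moments := try apply: all_moments_itg;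
  repeat first [ by [] | exact: all_moments_cst | apply: all_momentsD | apply: all_momentsN
    | apply: all_momentsM | apply: all_momentsX | apply: all_moments_norm
    | apply: all_moments_sum => ? ].

(** * Moments and integration by parts for one real Gaussian variable *)

Section gaussian_real.
Context d (T : measurableType d) (R : realType) (P : probability T R).
Variable L : T -> R.
Hypothesis gL : gaussian P L.

Let mL : measurable_fun [set: T] L. Proof. exact: gL.1. Qed.

Lemma gaussian_expR_itg (c : R) : itg P (fun w => expR (c * L w)).
Proof.
have [m [s shift]] := gaussian_shift gL.
(* With f = 1 the shift formula evaluates the exponential moment, so it is finite. *)
have /= := shift (cst 1) c (@cst_continuous _ _ _) (fun=> ler01).
under eq_integral do rewrite mul1r.
rewrite -(EFin_mean (itg_cst P 1)) mean_cst mule1 => h.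
have mexp a : measurable_fun [set: T] (fun w => expR (c * (L w - a))).
  by apply: measurableT_comp => //; apply: measurable_funM => //; exact: measurable_funB.
have i1 : itg P (fun w => expR (c * (L w - m))).
  apply/integrableP; split; first exact/measurable_EFinP.
  by under eq_integral do rewrite /= ger0_norm ?expR_ge0//; rewrite h ltry.
have := itgZ (expR (c * m)) i1; rewrite /itg; apply: eq_integrable => // w _ /=.
by rewrite -expRD; congr (expR _)%:E; ring.
Qed.

Lemma gaussian_expR_moments (c : R) : all_moments P (fun w => expR (c * L w)).
Proof.
split; first by apply: measurableT_comp => //; exact: measurable_funM.
move=> k; have := gaussian_expR_itg (k%:R * c); rewrite /itg; apply: eq_integrable => // w _ /=.
by rewrite ger0_norm ?expR_ge0// -mulrA -expRM_natl.
Qed.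

(** |x| <= exp(x) + exp(-x), and powers of these exponentials are again exponentials of multiples of
    L. *)
Lemma gaussian_moments : all_moments P L.
Proof.
apply: (@all_moments_le _ _ _ _ _ (fun w => expR (1 * L w) + expR (-1 * L w))) => //.
  by apply: all_momentsD; exact: gaussian_expR_moments.
move=> w; rewrite [leRHS]ger0_norm ?addr_ge0 ?expR_ge0//.
have /= h1 := expR_ge1Dx (1 * L w).
have /= h2 := expR_ge1Dx (-1 * L w).
have /= h3 := expR_ge0 (1 * L w).
have /= h4 := expR_ge0 (-1 * L w).
by have [L0|L0] := ger0P (L w); lra.
Qed.

(** Both sides of E[f(L) exp(c(L - m))] = exp(c^2 s^2 / 2) E[f(L + c s^2)] are differentiated at c =
    0. *)
Lemma gaussian_ibp1 : exists m s : R, forall (f df : R -> R) (K : R),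
  (forall x : R, is_derive x (1 : R) f (df x)) -> continuous df ->
  (forall x, `|f x| <= K * (1 + `|x|)) -> (forall x, `|df x| <= K) ->
  mean P (fun w => f (L w) * (L w - m)) = s ^+ 2 * mean P (fun w => df (L w)).
Proof.
have [m [s shift]] := gaussian_shift gL; exists m, s => f df K fdf cdf fK dfK.
have K0 : 0 <= K by apply: le_trans (dfK 0).
have cf : continuous f.
  by move=> x; apply: differentiable_continuous; apply/derivable1_diffP; exact: ex_derive.
(* The shift formula is available for nonnegative functions only; g dominates |f|, so f + g and g
   are both admissible. *)
pose g x : R := K * (expR x + expR (- x)).
have cg : continuous g.
  move=> x; apply: cvgM; first exact: cvg_cst.
  apply: cvgD; first exact: continuous_expR.
  by apply: (@continuous_comp _ _ _ -%R expR); [exact: cvgN|exact: continuous_expR].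
have fg x : `|f x| <= g x.
  apply: (le_trans (fK x)); rewrite ler_wpM2l//.
  have := expR_ge1Dx x; have := expR_ge1Dx (- x).
  have := expR_ge0 x; have := expR_ge0 (- x).
  by have [L0|L0] := ger0P x; lra.
have mexpm c : all_moments P (fun w => expR (c * (L w - m))).
  rewrite (_ : (fun w => _) = (fun w => expR (- (c * m)) * expR (c * L w))).
    exact/all_momentsZ/gaussian_expR_moments.
  by apply/funext => w; rewrite -expRD; congr expR; ring.
have mg a : all_moments P (fun w => g (L w + a)).
  rewrite /g; apply: all_momentsZ; apply: all_momentsD.
    rewrite (_ : (fun w => _) = (fun w => expR a * expR (1 * L w))).
      exact/all_momentsZ/gaussian_expR_moments.
    by apply/funext => w; rewrite -expRD; congr expR; ring.
  rewrite (_ : (fun w => _) = (fun w => expR (- a) * expR (-1 * L w))).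
    exact/all_momentsZ/gaussian_expR_moments.
  by apply/funext => w; rewrite -expRD; congr expR; ring.
have mh (h : R -> R) a : continuous h -> (forall x, `|h x| <= `|2 * g x|) ->
    all_moments P (fun w => h (L w + a)).
  move=> ch hg; apply: all_moments_le (all_momentsZ 2 (mg a)) _ => [|w]; last exact: hg.
  apply: measurableT_comp; first exact: continuous_measurable_fun.
  exact: measurable_funD.
have shiftR (h : R -> R) c : continuous h -> (forall x, 0 <= h x) -> (forall x, `|h x| <= `|2 * g x|) ->
   mean P (fun w => h (L w) * expR (c * (L w - m))) =
   expR (c ^+ 2 * s ^+ 2 / 2) * mean P (fun w => h (L w + c * s ^+ 2)).
  move=> ch h0 hg; apply: EFin_inj; rewrite EFinM !EFin_mean ?shift//.
    exact/all_moments_itg/mh.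
  apply: all_moments_itg; apply: all_momentsM => //.
  by have := mh h 0 ch hg; under eq_fun do rewrite addr0.
have g0 x : 0 <= g x by apply: le_trans (fg x).
have fg0 x : 0 <= f x + g x.
  by have := fg x; rewrite ler_norml => /andP[]; lra.
have fg2 x : `|f x + g x| <= `|2 * g x|.
  rewrite (ger0_norm (fg0 x)) ger0_norm ?mulr_ge0//.
  by have := fg x; rewrite ler_norml => /andP[]; lra.
have gg2 x : `|g x| <= `|2 * g x|.
  by rewrite (ger0_norm (g0 x)) ger0_norm ?mulr_ge0//; have := g0 x; lra.
have ff2 x : `|f x| <= `|2 * g x|.
  by apply: (le_trans (fg x)); rewrite ger0_norm ?mulr_ge0//; have := g0 x; lra.
have cfg : continuous (fun x => f x + g x) by move=> x; apply: cvgD; [exact: cf|exact: cg].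
have mh0 (h : R -> R) : continuous h -> (forall x, `|h x| <= `|2 * g x|) -> all_moments P (fun w => h (L w)).
  by move=> ch hg; have := mh h 0 ch hg; under eq_fun do rewrite addr0.
(* The formula for f + g minus the formula for g. *)
have key c : mean P (fun w => f (L w) * expR (c * (L w - m))) =
    expR (c ^+ 2 * s ^+ 2 / 2) * mean P (fun w => f (L w + c * s ^+ 2)).
  have e1 := shiftR _ c cfg fg0 fg2; have e2 := shiftR _ c cg g0 gg2.
  have : mean P (fun w => (f (L w) + g (L w)) * expR (c * (L w - m))) =
     mean P (fun w => f (L w) * expR (c * (L w - m))) +
     mean P (fun w => g (L w) * expR (c * (L w - m))).
    under [X in mean P X = _]eq_fun do rewrite mulrDl.
    by rewrite meanD//; apply: all_moments_itg; apply: all_momentsM => //; exact: mh0.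
  have : mean P (fun w => f (L w + c * s ^+ 2) + g (L w + c * s ^+ 2)) =
     mean P (fun w => f (L w + c * s ^+ 2)) + mean P (fun w => g (L w + c * s ^+ 2)).
    by rewrite meanD//; apply: all_moments_itg; exact: mh.
  move: e1 e2 => /= -> -> ->; lra.
have mLm : all_moments P (fun w => L w - m).
  by apply: all_momentsB; [exact: gaussian_moments|exact: all_moments_cst].
(* For |c| <= 1, exp(cy) <= exp(y) + exp(-y) gives a dominating function independent of c. *)
have d1 : is_derive (0:R) (1:R) (fun c => mean P (fun w => f (L w) * expR (c * (L w - m))))
    (mean P (fun w => f (L w) * (L w - m) * expR (0 * (L w - m)))).
  apply: (@is_derive_mean _ _ _ _ (fun c w => f (L w) * expR (c * (L w - m)))
    (fun c w => f (L w) * (L w - m) * expR (c * (L w - m)))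
    (fun w => `|f (L w) * (L w - m)| * (expR (1 * (L w - m)) + expR (-1 * (L w - m))))).
  - apply: all_moments_itg; apply: all_momentsM.
      by apply: all_moments_norm; apply: all_momentsM => //; exact: mh0.
    by apply: all_momentsD; exact: mexpm.
  - by move=> t _; apply: all_moments_itg; apply: all_momentsM => //; exact: mh0.
  - move=> t w _; apply: is_derive_eq; rewrite /GRing.scale /=; ring.
  - move=> t w /andP[t1 t2]; rewrite normrM ler_wpM2l// ger0_norm ?expR_ge0//.
    have [w0|w0] := leP 0 (L w - m).
      rewrite -[leLHS]addr0 lerD ?expR_ge0// ler_expR ler_wpM2r//; lra.
    rewrite -[leLHS]add0r lerD ?expR_ge0// ler_expR ler_wnM2r ?ltW//; lra.
have d2 : is_derive (0:R) (1:R) (fun c => mean P (fun w => f (L w + c * s ^+ 2)))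
    (mean P (fun w => df (L w + 0 * s ^+ 2) * s ^+ 2)).
  apply: (@is_derive_mean _ _ _ _ (fun c w => f (L w + c * s ^+ 2))
    (fun c w => df (L w + c * s ^+ 2) * s ^+ 2) (fun=> K * s ^+ 2)).
  - exact: itg_cst.
  - by move=> t _; apply: all_moments_itg; exact: mh.
  - move=> t w _.
    have -> : (fun c : R => f (L w + c * s ^+ 2)) = f \o (fun c => L w + c * s ^+ 2) by [].
    apply: is_derive_eq; rewrite /GRing.scale /=; ring.
  - by move=> t w _; rewrite normrM ler_pM// ger0_norm ?sqr_ge0.
have d3 : is_derive (0:R) (1:R) (fun c => expR (c ^+ 2 * s ^+ 2 / 2) *
     mean P (fun w => f (L w + c * s ^+ 2))) (mean P (fun w => df (L w + 0 * s ^+ 2) * s ^+ 2)).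
  apply: is_derive_eq.
  by rewrite /GRing.scale /= !(expr0n, mulr0, mul0r, expR0, mul1r, addr0, add0r, mulr1).
have := @derive_val _ _ _ _ _ _ _ d1; under eq_fun do rewrite key.
rewrite derive_val.
rewrite (_ : (fun w => df _ * _) = (fun w => s ^+ 2 * df (L w))); last first.
  by apply/funext => w; rewrite mul0r addr0 mulrC.
rewrite (_ : (fun w => _ * expR (0 * _)) = (fun w => f (L w) * (L w - m))); last first.
  by apply/funext => w; rewrite mul0r expR0 mulr1.
move=> <-; apply: meanZ.
apply: (itg_le _ (itg_cst P K)) => //.
by apply: measurableT_comp => //; exact: continuous_measurable_fun.
Qed.

End gaussian_real.

(** * Characteristic function of a centered real Gaussian *)

Section gaussian_characteristic.
Context d (T : measurableType d) (R : realType) (P : probability T R).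
Variable L : T -> R.
Hypotheses (gL : gaussian P L) (L0 : mean P L = 0).

Let mL : measurable_fun [set: T] L. Proof. exact: gL.1. Qed.

Let Lm := gaussian_moments gL.

Let trigm (f : R -> R) u : continuous f -> (forall x, `|f x| <= 1) ->
  all_moments P (fun w => f (u * L w)).
Proof.
move=> cf f1; apply: all_moments_le (all_moments_cst P 1) _ => [|w].
  apply: measurableT_comp; first exact: continuous_measurable_fun.
  exact: measurable_funM.
by rewrite normr1.
Qed.

Let trig_derive (f df : R -> R) (u : R) : (forall x : R, is_derive x (1:R) f (df x)) ->
  (forall x, `|f x| <= 1) -> (forall x, `|df x| <= 1) ->
  is_derive u (1:R) (fun u => mean P (fun w => f (u * L w)))
    (mean P (fun w => df (u * L w) * L w)).
Proof.
move=> fdf f1 df1.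
have cf : continuous f.
  by move=> x; apply: differentiable_continuous; apply/derivable1_diffP; exact: ex_derive.
apply: (@is_derive_mean _ _ _ _ (fun u w => f (u * L w)) (fun u w => df (u * L w) * L w)
   (fun w => `|L w|)).
- exact/all_moments_itg/all_moments_norm.
- by move=> t _; exact/all_moments_itg/trigm.
- move=> t w _; rewrite (_ : (fun u => f (u * L w)) = f \o (fun u => u * L w))//.
  by apply: is_derive_eq; rewrite /GRing.scale /=; ring.
- by move=> t w _; rewrite normrM ler_piMl.
Qed.

(** Integration by parts turns the derivative of u -> E cos(uL) and of u -> E sin(uL) into the
    linear equation g' = - s^2 u g, with initial values 1 and 0. *)
Lemma gaussian_char :
  mean P (fun w => cos (L w)) = expR (- mean P (fun w => L w ^+ 2) / 2) /\
  mean P (fun w => sin (L w)) = 0.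
Proof.
have [m [s ibp]] := gaussian_ibp1 gL.
have cos1 (x : R) : `|cos x| <= 1 by rewrite ler_norml cos_geN1 cos_le1.
have sin1 (x : R) : `|sin x| <= 1 by rewrite ler_norml sin_geN1 sin_le1.
have dcos (x : R) : is_derive x (1:R) cos (- sin x) by exact: is_derive_cos.
have dsin (x : R) : is_derive x (1:R) sin (cos x) by exact: is_derive_sin.
(* Integration by parts with f = 1 identifies m as the mean, and below with f = id it identifies s^2
   as the second moment. *)
have m0 : m = 0.
  have : mean P (fun w => 1 * (L w - m)) = s ^+ 2 * mean P (fun=> 0).
    apply: (ibp (fun=> 1) (fun=> 0) 1) => [|x|x].
    - exact: cst_continuous.
    - by rewrite normr1 mul1r lerDl.
    - by rewrite normr0.
  rewrite mean_cst mulr0 meanZ ?mul1r ?meanB ?mean_cst ?L0.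
  - by rewrite sub0r => /eqP; rewrite oppr_eq0 => /eqP.
  - exact: all_moments_itg.
  - exact: itg_cst.
  - by apply: itgB; [exact: all_moments_itg|exact: itg_cst].
have s2 : mean P (fun w => L w ^+ 2) = s ^+ 2.
  rewrite -[RHS]mulr1 -(mean_cst P 1) -(ibp id (fun=> 1) 1).
  - by congr (mean P _); apply/funext => w; rewrite m0 subr0 expr2.
  - exact: cst_continuous.
  - by move=> x; rewrite mul1r lerDr.
  - by move=> x; rewrite normr1.
(* Integrating factor: g(u) exp(s^2 u^2 / 2) has derivative zero. *)
have Dcst (g dg : R -> R) : (forall u : R, is_derive u (1:R) g (dg u)) ->
   (forall u, dg u = - s ^+ 2 * u * g u) -> g 1 = g 0 * expR (- s ^+ 2 / 2).
  move=> Dg gE.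
  have /is_derive_0_is_cst : forall u : R, is_derive u (1:R)
      (fun u => g u * expR (s ^+ 2 * u ^+ 2 / 2)) 0.
    move=> u; have h := Dg u; apply: is_derive_eq.
    rewrite /GRing.scale /= gE; by field.
  move=> /(_ 1 0); rewrite expr1n expr0n /= !mulr1 mulr0 mul0r expR0 mulr1 => <-.
  by rewrite -mulrA -expRD mulNr subrr expR0 mulr1.
have ibpt (f df : R -> R) u : (forall x : R, is_derive x (1:R) f (df x)) -> continuous df ->
    (forall x, `|f x| <= 1) -> (forall x, `|df x| <= 1) ->
    mean P (fun w => f (u * L w) * L w) = s ^+ 2 * u * mean P (fun w => df (u * L w)).
  move=> fdf cdf f1 df1.
  rewrite -mulrA -meanZ; last exact/all_moments_itg/trigm.
  have fud (x : R) : is_derive x (1:R) (fun x => f (u * x)) (u * df (u * x)).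
    rewrite (_ : (fun x => f (u * x)) = f \o (fun x => u * x))//.
    by apply: is_derive_eq; rewrite /GRing.scale /=; ring.
  rewrite -(ibp (fun x => f (u * x)) (fun x => u * df (u * x)) (1 + `|u|)).
  - by congr (mean P _); apply/funext => w; rewrite m0 subr0.
  - move=> x; apply: cvgM; first exact: cvg_cst.
    apply: (@continuous_comp _ _ _ (fun x => u * x) df); last exact: cdf.
    by apply: cvgM; [exact: cvg_cst|exact: cvg_id].
  - move=> x; apply: (le_trans (f1 _)).
    have := normr_ge0 u; have := normr_ge0 x; nra.
  - move=> x; rewrite normrM; have := df1 (u * x); have := normr_ge0 u.
    have := normr_ge0 (df (u * x)); nra.
have cont1 g : continuous g -> continuous (fun x : R => - g x : R).
  by move=> cg x; apply: cvgN; exact: cg.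
split.
  have := Dcst (fun u => mean P (fun w => cos (u * L w))) _ (fun u => trig_derive u dcos cos1 _).
  under eq_fun do rewrite mul1r; move=> -> //.
  - under eq_fun do rewrite mul0r cos0.
    by rewrite mean_cst mul1r s2.
  - by move=> x; rewrite normrN.
  - move=> u; rewrite (_ : (fun w => _) = (fun w => -1 * (sin (u * L w) * L w))); last first.
      by apply/funext => w; ring.
    rewrite meanZ; last first.
      by apply/all_moments_itg/all_momentsM => //; apply: trigm => //; exact: continuous_sin.
    rewrite (ibpt sin cos)//; last exact: continuous_cos.
    ring.
have := Dcst (fun u => mean P (fun w => sin (u * L w))) _ (fun u => trig_derive u dsin sin1 _).
under eq_fun do rewrite mul1r; move=> -> //.
- under eq_fun do rewrite mul0r sin0.
  by rewrite mean_cst mul0r.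
- move=> u; rewrite (ibpt cos (fun x => - sin x))//; last 2 first.
  + exact/cont1/continuous_sin.
  + by move=> x; rewrite normrN.
  rewrite (_ : (fun w => _) = (fun w => -1 * sin (u * L w))); last first.
    by apply/funext => w; ring.
  rewrite meanZ; first ring.
  by apply/all_moments_itg; apply: trigm => //; exact: continuous_sin.
Qed.

End gaussian_characteristic.

(** * Gaussian vectors *)

Section gaussian_vector.
Context d (T : measurableType d) (R : realType) (P : probability T R) (I : finType).

Definition gaussian_vector (Z : I -> T -> R) : Prop :=
  (forall u : I -> R, gaussian P (fun w => \sum_i u i * Z i w)) /\
  (forall i, mean P (Z i) = 0).

Variable Z : I -> T -> R.
Hypothesis gZ : gaussian_vector Z.
Local Notation dot u w := (\sum_i u i * Z i w).

Lemma gaussian_vector_coord a : gaussian P (Z a).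
Proof.
have := gZ.1 (fun i => (i == a)%:R); congr gaussian; apply/funext => w.
rewrite (bigD1 a)//= eqxx mul1r big1 ?addr0// => i /negbTE ->.
by rewrite mul0r.
Qed.

Lemma gaussian_vector_moments a : all_moments P (Z a).
Proof. exact/gaussian_moments/gaussian_vector_coord. Qed.

Lemma gaussian_dot_moments (u : I -> R) : all_moments P (fun w => dot u w).
Proof. exact/gaussian_moments/gZ.1. Qed.

Lemma gaussian_dot_mean (u : I -> R) : mean P (fun w => dot u w) = 0.
Proof.
have Zm i := gaussian_vector_moments i.
rewrite mean_sum; last by move=> i; exact/itgZ/all_moments_itg.
rewrite big1// => i _; rewrite meanZ ?gZ.2 ?mulr0//; exact: all_moments_itg.
Qed.

Lemma gaussian_trig_moments (f : R -> R) (u : I -> R) : continuous f ->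
  (forall x, `|f x| <= 1) -> all_moments P (fun w => f (dot u w)).
Proof.
move=> cf f1; apply: all_moments_le (all_moments_cst P 1) _ => [|w].
  apply: measurableT_comp; first exact: continuous_measurable_fun.
  exact: (gaussian_dot_moments u).1.
by rewrite normr1.
Qed.

Let cos1 (x : R) : `|cos x| <= 1. Proof. by rewrite ler_norml cos_geN1 cos_le1. Qed.
Let sin1 (x : R) : `|sin x| <= 1. Proof. by rewrite ler_norml sin_geN1 sin_le1. Qed.

Let trig_derive (f df : R -> R) (u : I -> R) a :
  (forall x : R, is_derive x (1:R) f (df x)) ->
  (forall x, `|f x| <= 1) -> (forall x, `|df x| <= 1) ->
  is_derive (0:R) (1:R) (fun t => mean P (fun w => f (dot u w + t * Z a w)))
    (mean P (fun w => df (dot u w + 0 * Z a w) * Z a w)).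
Proof.
move=> fdf f1 df1.
have cf : continuous f.
  by move=> x; apply: differentiable_continuous; apply/derivable1_diffP; exact: ex_derive.
apply: (@is_derive_mean _ _ _ _ (fun t w => f (dot u w + t * Z a w))
   (fun t w => df (dot u w + t * Z a w) * Z a w) (fun w => `|Z a w|)).
- exact/all_moments_itg/all_moments_norm/gaussian_vector_moments.
- move=> t _; apply: itg_le (itg_cst P 1) _ => //.
  apply: measurableT_comp; first exact: continuous_measurable_fun.
  apply: (all_momentsD (gaussian_dot_moments u) _).1.
  exact/all_momentsZ/gaussian_vector_moments.
- move=> t w _; rewrite (_ : (fun t => f _) = f \o (fun t => dot u w + t * Z a w))//.
  by apply: is_derive_eq; rewrite /GRing.scale /=; ring.
- by move=> t w _; rewrite normrM ler_piMl.
Qed.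

Let dotD (u : I -> R) a t w : dot u w + t * Z a w = dot (fun i => u i + t * (i == a)%:R) w.
Proof.
under [RHS]eq_bigr do rewrite mulrDl.
rewrite big_split/=; congr (_ + _).
rewrite (bigD1 a)//= eqxx mulr1 big1 ?addr0// => i /negbTE ->.
by rewrite mulr0 mul0r.
Qed.

(** Moving the frequency u by t in direction a keeps a Gaussian projection, so E cos(u.Z + t Z_a) is
    the exponential of a quadratic polynomial in t; its derivative at t = 0 gives the identity. *)
Lemma gaussian_vector_sin (u : I -> R) a :
  mean P (fun w => Z a w * sin (dot u w)) =
  (\sum_b u b * mean P (fun w => Z a w * Z b w)) * mean P (fun w => cos (dot u w)).
Proof.
have Zm i := gaussian_vector_moments i.
have dm := gaussian_dot_moments u.
have charE (t : R) : mean P (fun w => cos (dot u w + t * Z a w)) =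
  expR (- (mean P (fun w => dot u w ^+ 2) + 2 * t * mean P (fun w => Z a w * dot u w) +
          t ^+ 2 * mean P (fun w => Z a w ^+ 2)) / 2).
  under eq_fun do rewrite dotD.
  have [-> _] := gaussian_char (gZ.1 _) (gaussian_dot_mean (fun i => u i + t * (i == a)%:R)).
  congr (expR (- _ / 2)).
  under eq_fun do rewrite -dotD.
  rewrite -!meanZ -?meanD.
  - by congr (mean P _); apply/funext => w; ring.
  - by moments.
  - by moments.
  - by moments.
  - by moments.
  - by moments.
  - by moments.
have nsin1 x : `|- sin x| <= 1 :> R by rewrite normrN.
have D := trig_derive u a (fun x => is_derive_cos x) cos1 nsin1.
have := @derive_val _ _ _ _ _ _ _ D; under eq_fun do rewrite charE.
set A := mean P (fun w => dot u w ^+ 2).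
set B := mean P (fun w => Z a w * dot u w).
set C := mean P (fun w => Z a w ^+ 2).
have D2 : is_derive (0:R) (1:R) 
    (fun t : R => expR (- (A + 2 * t * B + t ^+ 2 * C) / 2)) (- B * expR (- A / 2)).
  apply: is_derive_eq; rewrite /GRing.scale /= expr0n /= !(mul0r, mulr0, addr0, add0r).
  by field.
rewrite derive_val => h.
have -> : \sum_b u b * mean P (fun w => Z a w * Z b w) = B.
  rewrite /B (_ : (fun w => _) = (fun w => \sum_b u b * (Z a w * Z b w))); last first.
    by apply/funext => w; rewrite mulr_sumr; apply: eq_bigr => b _; ring.
  rewrite mean_sum; last by move=> i; exact/all_moments_itg/all_momentsZ/all_momentsM.
  by apply: eq_bigr => b _; rewrite meanZ//; exact/all_moments_itg/all_momentsM.
have [-> _] := gaussian_char (gZ.1 u) (gaussian_dot_mean u).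
rewrite -/A; apply: oppr_inj; rewrite -mulNr h -[LHS]mulN1r -meanZ.
  by congr (mean P _); apply/funext => w; rewrite mul0r addr0; ring.
apply/all_moments_itg/all_momentsM => //; apply: gaussian_trig_moments => //.
exact: continuous_sin.
Qed.

(** Same frequency perturbation, applied to E sin(u.Z + t Z_a), which vanishes for every t. *)
Lemma gaussian_vector_cos (u : I -> R) a : mean P (fun w => Z a w * cos (dot u w)) = 0.
Proof.
have D := trig_derive u a (fun x => is_derive_sin x) sin1 cos1.
have := @derive_val _ _ _ _ _ _ _ D.
rewrite (_ : (fun t => _) = cst 0); last first.
  apply/funext => t; under eq_fun do rewrite dotD.
  by have [_ ->] := gaussian_char (gZ.1 _) (gaussian_dot_mean (fun i => u i + t * (i == a)%:R)).
rewrite derive_cst => h; rewrite [RHS]h.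
by congr (mean P _); apply/funext => w; rewrite mul0r addr0 mulrC.
Qed.

Lemma gaussian_vector_sin0 (u : I -> R) : mean P (fun w => sin (dot u w)) = 0.
Proof. exact: (gaussian_char (gZ.1 u) (gaussian_dot_mean u)).2. Qed.

End gaussian_vector.

(** * Bernstein approximation in a trigonometric variable *)

Section sin_scaling.
Context {R : realType}.

(** Two mean value estimates; the quadratic order already makes q sin(t / q) converge to t at rate
    1/q. *)
Lemma norm_sin_sub_le (t : R) : `|sin t - t| <= t ^+ 2.
Proof.
wlog t0 : t / 0 <= t.
  move=> H; have [|/ltW t0] := leP 0 t; first exact: H.
  have := H (- t); rewrite oppr_ge0 sinN sqrrN -opprD normrN; exact.
have cos_lip (x : R) : 0 <= x -> `|cos x - 1| <= x.
  move=> x0; rewrite -{1}(@cos0 R).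
  have [|c _ ->] := @MVT_segment R cos (fun x => - sin x) 0 x x0.
    exact/continuous_subspaceT/continuous_cos.
  rewrite subr0 normrM normrN (ger0_norm x0) ler_piMl//.
  by rewrite ler_norml sin_geN1 sin_le1.
have [|c c0t] := @MVT_segment R (fun x => sin x - x) (fun x => cos x - 1) 0 t t0.
  apply/continuous_subspaceT => x; apply: cvgB; last exact: cvg_id.
  exact: continuous_sin.
rewrite sin0 !subr0 => ->; rewrite normrM expr2 (ger0_norm t0).
move: c0t; rewrite in_itv/= => /andP[c0 ct].
by rewrite ler_wpM2r// (le_trans (cos_lip c c0)).
Qed.

Lemma norm_scaled_sin_sub_le (q t : R) : 0 < q -> `|q * sin (t / q) - t| <= t ^+ 2 / q.
Proof.
move=> q0; have -> : q * sin (t / q) - t = q * (sin (t / q) - t / q).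
  by field; rewrite gt_eqF.
rewrite normrM (gtr0_norm q0) (_ : t ^+ 2 / q = q * (t / q) ^+ 2); last first.
  by field; rewrite gt_eqF.
by rewrite ler_pM2l// norm_sin_sub_le.
Qed.

(** The truncation t -> q sin(t / q) is bounded, and by this inequality it is dominated by what it
    truncates. *)
Lemma scaled_sin_le (q t : R) : 0 < q -> `|q * sin (t / q)| <= `|t|.
Proof.
move=> q0; rewrite normrM (gtr0_norm q0).
suff sin_le (x : R) : `|sin x| <= `|x|.
  apply: le_trans (_ : q * `|t / q| <= _); first by rewrite ler_pM2l.
  by rewrite normrM normfV (gtr0_norm q0) mulrCA divff ?mulr1// gt_eqF.
wlog x0 : x / 0 <= x.
  move=> H; have [|/ltW x0] := leP 0 x; first exact: H.
  by have := H (- x); rewrite oppr_ge0 sinN !normrN; exact.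
rewrite -[X in `|X|](subr0 (sin x)) -(@sin0 R).
have [|c _ ->] := @MVT_segment R sin cos 0 x x0.
  exact/continuous_subspaceT/continuous_sin.
rewrite subr0 normrM ler_piMl//.
by rewrite ler_norml cos_geN1 cos_le1.
Qed.

Lemma scaled_sin_cvg (t : R) : (n.+1%:R * sin (t / n.+1%:R) : R) @[n --> \oo] --> t.
Proof.
apply/cvgrPdist_le => e e0; near=> n.
rewrite distrC; apply: (le_trans (norm_scaled_sin_sub_le t (ltr0Sn _ n))).
rewrite ler_pdivrMr ?ltr0Sn// mulrC -ler_pdivrMr//.
by apply: (@le_trans _ _ n%:R); [near: n; exact: nbhs_infty_ger|rewrite ler_nat].
Unshelve. all: by end_near. Qed.

End sin_scaling.

Section bernstein.
Context {R : realType}.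
Implicit Types (y : R) (F G : nat -> R).

(* The mean of [F] under the binomial law with parameters [M] and [y], by
   conditioning on the first trial. *)
Fixpoint bernstein y (M : nat) F : R :=
  if M is M'.+1 then y * bernstein y M' (F \o succn) + (1 - y) * bernstein y M' F
  else F 0%N.

Lemma le_bernstein y M F G : 0 <= y <= 1 -> (forall k, F k <= G k) ->
  bernstein y M F <= bernstein y M G.
Proof.
move=> /andP[y0 y1]; elim: M F G => [|M IH] F G FG //=.
by rewrite lerD// ler_wpM2l ?subr_ge0//; apply: IH => k; exact: FG.
Qed.

Lemma bernstein_linear y M a b F G :
  bernstein y M (fun k => a * F k + b * G k) = a * bernstein y M F + b * bernstein y M G.
Proof.
elim: M F G => [//|M IH] F G /=.
by rewrite IH (IH (F \o succn) (G \o succn)); ring.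
Qed.

Lemma bernstein_cst y M c : bernstein y M (fun=> c) = c.
Proof. by elim: M => [//|M IH] /=; rewrite [X in y * X]IH IH; ring. Qed.

(** Squared bias plus variance of a binomial variable about c. Quantifying over c makes the
    induction work: a success in the first trial replaces c by c - 1. *)
Lemma bernstein_sqr y M c :
  bernstein y M (fun k => (k%:R - c) ^+ 2) = (M%:R * y - c) ^+ 2 + M%:R * y * (1 - y).
Proof.
elim: M c => [|M IH] c /=; first by rewrite !mul0r addr0 //.
rewrite IH (_ : _ \o _ = fun k : nat => (k%:R - (c - 1)) ^+ 2); last first.
  by apply/funext => k /=; rewrite -natr1; ring.
rewrite IH -natr1; ring.
Qed.

Lemma norm_bernstein_le y M F G : 0 <= y <= 1 -> (forall k, `|F k| <= G k) ->
  `|bernstein y M F| <= bernstein y M G.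
Proof.
move=> y01 FG; rewrite ler_norml; apply/andP; split.
  have -> : - bernstein y M G = bernstein y M (fun k => -1 * G k + 0 * G k).
    by rewrite bernstein_linear; ring.
  by apply: le_bernstein => // k; have := FG k; rewrite ler_norml => /andP[]; lra.
by apply: le_bernstein => // k; exact: le_trans (ler_norm _) (FG k).
Qed.

Arguments bernstein : simpl never.

(* [y] and the nodes are scaled so that the mean node is [q sin (x / q)] and the
   variance of the nodes is at most [1 / q]. *)
Lemma bernstein_sin_cvg (g : R -> R) (K x : R) : continuous g -> (forall t, `|g t| <= K) ->
  bernstein ((1 + sin (x / n.+1%:R)) / 2) (n.+1 ^ 3)
    (fun k => g (n.+1%:R * (2 * k%:R / n.+1%:R ^+ 3 - 1))) @[n --> \oo] --> g x.
Proof.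
move=> cg gK; have K0 : 0 <= K by apply: le_trans (gK 0).
(* With S = sin(x / q) the squared bias is (qS - x)^2 <= x^4 / q^2 and the variance is 4 q^(-4) q^3
   (1 - S^2) / 4 <= 1 / q. *)
have sqdist n : bernstein ((1 + sin (x / n.+1%:R)) / 2) (n.+1 ^ 3)
    (fun k => (n.+1%:R * (2 * k%:R / n.+1%:R ^+ 3 - 1) - x) ^+ 2) <= (x ^+ 4 + 1) / n.+1%:R.
  set q : R := n.+1%:R; have q0 : 0 < q by rewrite /q ltr0Sn.
  have q1 : 1 <= q by rewrite /q ler1n.
  have qn0 : q != 0 by rewrite gt_eqF.
  set S := sin (x / q); set c := (x + q) * q ^+ 2 / 2.
  rewrite (_ : (fun k : nat => _) =
    (fun k : nat => 4 / q ^+ 4 * (k%:R - c) ^+ 2 + 0 * 0)); last first.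
    by apply/funext => k; rewrite /c; field.
  rewrite (bernstein_linear _ _ _ _ _ (fun=> 0)) mul0r addr0 bernstein_sqr natrX -/q.
  have -> : 4 / q ^+ 4 * ((q ^+ 3 * ((1 + S) / 2) - c) ^+ 2 +
      q ^+ 3 * ((1 + S) / 2) * (1 - (1 + S) / 2)) = (q * S - x) ^+ 2 + (1 - S ^+ 2) / q.
    by rewrite /c; field.
  have h1 : (q * S - x) ^+ 2 <= x ^+ 4 / q.
    have := norm_scaled_sin_sub_le x q0; rewrite -/S => h.
    rewrite -[leLHS]real_normK ?num_real//; apply: (@le_trans _ _ ((x ^+ 2 / q) ^+ 2)).
      by apply: lerXn2r; rewrite ?nnegrE// divr_ge0 ?sqr_ge0// ltW.
    rewrite exprMn -exprM ler_wpM2l ?exprn_even_ge0// exprVn lef_pV2 ?posrE ?exprn_gt0//.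
    by rewrite expr2 ler_peMl// ltW.
  have h2 : (1 - S ^+ 2) / q <= 1 / q.
    by rewrite ler_pM2r ?invr_gt0// lerBlDr lerDl sqr_ge0.
  by rewrite [leRHS]mulrDl lerD.
apply/cvgrPdist_le => e e0.
have /cvgrPdist_le/(_ _ (_ : 0 < e / 2)) := cg x; rewrite divr_gt0// => /(_ isT).
move=> /nbhs_ballP[dl /= dl0 gd].
have C0 : 0 <= 2 * K / dl ^+ 2.
  by rewrite mulr_ge0 ?invr_ge0 ?exprn_even_ge0// mulr_ge0.
(* Chebyshev's device: continuity controls the nodes within [dl] of x, and beyond that (t - x)^2 /
   dl^2 >= 1 multiplies the trivial bound 2K. *)
have dist_le t : `|g t - g x| <= e / 2 + 2 * K / dl ^+ 2 * (t - x) ^+ 2.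
  have [td|td] := ltP `|x - t| dl.
    rewrite distrC (le_trans (gd t td))// lerDl.
    by apply: mulr_ge0 => //; exact: sqr_ge0.
  apply: (@le_trans _ _ (2 * K)).
    by rewrite (le_trans (ler_normB _ _))// mulr_natl mulr2n lerD.
  rewrite -[leLHS]add0r lerD ?divr_ge0 ?(ltW e0)// -mulrA ler_peMr ?mulr_ge0//.
  rewrite mulrC ler_pdivlMr ?exprn_gt0// mul1r -[X in _ <= X]real_normK ?num_real//.
  by apply: lerXn2r; rewrite ?nnegrE ?(ltW dl0)// distrC.
near=> n.
have q0 : 0 < n.+1%:R :> R by rewrite ltr0Sn.
have y01 : 0 <= (1 + sin (x / n.+1%:R)) / 2 <= 1.
  have := sin_geN1 (x / n.+1%:R); have := sin_le1 (x / n.+1%:R); lra.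
set y := (_ / 2) in y01 *; set M := (_ ^ 3)%N.
pose node (k : nat) : R := n.+1%:R * (2 * k%:R / n.+1%:R ^+ 3 - 1).
rewrite distrC.
suff : `|bernstein y M (fun k => g (node k)) - g x| <= e by [].
rewrite -[X in `|_ - X|](bernstein_cst y M).
have -> : bernstein y M (fun k => g (node k)) - bernstein y M (fun=> g x) =
    bernstein y M (fun k => 1 * g (node k) + (-1) * g x).
  by rewrite bernstein_linear mul1r mulN1r.
have ub k : `|1 * g (node k) + (-1) * g x| <=
    1 * (e / 2) + 2 * K / dl ^+ 2 * (node k - x) ^+ 2.
  by rewrite !mul1r mulN1r; exact: dist_le.
have ->: e = e / 2 + e / 2 by lra.
apply: (@le_trans _ _ (bernstein y M
    (fun k => 1 * (e / 2) + 2 * K / dl ^+ 2 * (node k - x) ^+ 2))).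
  exact: norm_bernstein_le.
rewrite bernstein_linear bernstein_cst mul1r lerD2l.
apply: (le_trans (ler_wpM2l _ (sqdist n))) => //.
rewrite mulrA ler_pdivrMr// [leRHS]mulrC -ler_pdivrMr ?divr_gt0//.
by apply: (@le_trans _ _ n%:R); [near: n; exact: nbhs_infty_ger|rewrite ler_nat].
Unshelve. all: by end_near. Qed.

End bernstein.

Section separately_continuous.
Context {R : realType} {I : finType}.
Implicit Types (x : I -> R) (f : (I -> R) -> R).

Definition upd x i (v : R) : I -> R := fun j => if j == i then v else x j.

(** Continuity in each variable separately is what a coordinate-by-coordinate approximation
    consumes, since every step is a one-variable limit. *)
Definition scont f : Prop := forall x i, continuous (fun t : R => f (upd x i t)).

Lemma upd_id x i : upd x i (x i) = x.
Proof. by apply/funext => j; rewrite /upd; case: eqP => [->|]. Qed.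

Lemma upd_upd x i v v' : upd (upd x i v) i v' = upd x i v'.
Proof. by apply/funext => j; rewrite /upd; case: eqP. Qed.

Lemma updC x i j v v' : i != j -> upd (upd x i v) j v' = upd (upd x j v') i v.
Proof.
move=> ij; apply/funext => k; rewrite /upd; case: (eqVneq k j) => // ->.
by rewrite eq_sym (negbTE ij).
Qed.

Lemma scont_upd f i v : scont f -> scont (fun x => f (upd x i v)).
Proof.
move=> cf x j; have [->|ij] := eqVneq i j.
  by under eq_fun do rewrite upd_upd; exact: cst_continuous.
by under eq_fun do rewrite updC 1?eq_sym//; exact: cf.
Qed.

Lemma scontD f g : scont f -> scont g -> scont (fun x => f x + g x).
Proof. by move=> cf cg x i t; apply: cvgD; [exact: cf|exact: cg]. Qed.

Lemma scontM f g : scont f -> scont g -> scont (fun x => f x * g x).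
Proof. by move=> cf cg x i t; apply: cvgM; [exact: cf|exact: cg]. Qed.

Lemma scont_comp f (g : R -> R) : continuous g -> scont f -> scont (g \o f).
Proof.
move=> cg cf x i t.
apply: (@continuous_comp _ _ _ (fun t => f (upd x i t)) g); [exact: cf|exact: cg].
Qed.

End separately_continuous.

(** * From orthogonality to trigonometric functions to orthogonality to separately continuous
    ones *)

Section trigonometric_density.
Context d (T : measurableType d) (R : realType) (P : probability T R) (I : finType).
Variable Z : I -> T -> R.
Hypothesis mZ : forall i, measurable_fun [set: T] (Z i).
Local Notation dot u w := (\sum_i u i * Z i w).
Local Notation vec w := (Z^~ w).

Let mdot (u : I -> R) : measurable_fun [set: T] (fun w => dot u w).
Proof. by apply: measurable_sum => i; exact: measurable_funM. Qed.

Let mtrig (f : R -> R) u : continuous f -> measurable_fun [set: T] (fun w => f (dot u w)).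
Proof. by move=> cf; apply: measurableT_comp => //; exact: continuous_measurable_fun. Qed.

Section orthogonal_weight.
Variable Y : T -> R.
Hypothesis iY : itg P Y.
Hypothesis Ycos : forall u : I -> R, mean P (fun w => Y w * cos (dot u w)) = 0.
Hypothesis Ysin : forall u : I -> R, mean P (fun w => Y w * sin (dot u w)) = 0.

(** Orthogonality is demanded of F times every trigonometric function, not of F alone: this makes
    the class stable under multiplication by sin(e x_i), hence under Bernstein operators, besides
    bounded pointwise limits. *)
Let trig_orth (F : (I -> R) -> R) : Prop :=
  [/\ measurable_fun [set: T] (fun w => F (vec w)),
      exists K, forall x, `|F x| <= K,
      forall u, mean P (fun w => Y w * (F (vec w) * cos (dot u w))) = 0 &
      forall u, mean P (fun w => Y w * (F (vec w) * sin (dot u w))) = 0].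

Let itgY (h : T -> R) K : measurable_fun [set: T] h -> (forall w, `|h w| <= K) ->
  itg P (fun w => Y w * h w).
Proof.
move=> mh hK; apply: itg_le (itgZ K (itg_norm iY)) _ => [|w].
  by apply: measurable_funM => //; exact: itg_measurable iY.
by rewrite normrM mulrC ler_wpM2r.
Qed.

Let itg_trig F (f : R -> R) u : trig_orth F -> continuous f -> (forall x, `|f x| <= 1) ->
  itg P (fun w => Y w * (F (vec w) * f (dot u w))).
Proof.
move=> [mF [K FK] _ _] cf f1; apply: (@itgY _ K).
  by apply: measurable_funM => //; exact: mtrig.
by move=> w; rewrite normrM -[leRHS]mulr1 ler_pM.
Qed.

Let cos1 (x : R) : `|cos x| <= 1. Proof. by rewrite ler_norml cos_geN1 cos_le1. Qed.
Let sin1 (x : R) : `|sin x| <= 1. Proof. by rewrite ler_norml sin_geN1 sin_le1. Qed.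

Let itg_cos F u : trig_orth F -> itg P (fun w => Y w * (F (vec w) * cos (dot u w))).
Proof. by move=> gF; apply: itg_trig => //; exact: continuous_cos. Qed.

Let itg_sin F u : trig_orth F -> itg P (fun w => Y w * (F (vec w) * sin (dot u w))).
Proof. by move=> gF; apply: itg_trig => //; exact: continuous_sin. Qed.

Let trig_orth_lin a b F G : trig_orth F -> trig_orth G -> trig_orth (fun x => a * F x + b * G x).
Proof.
move=> gF gG; have [mF [K FK] Fc Fs] := gF; have [mG [K' GK] Gc Gs] := gG.
split.
- by apply: measurable_funD; exact: measurable_funM.
- exists (`|a| * K + `|b| * K') => x.
  by rewrite (le_trans (ler_normD _ _))// !normrM lerD// ler_wpM2l.
- move=> u; rewrite (_ : (fun w => _) = (fun w => a * (Y w * (F (vec w) * cos (dot u w))) +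
    b * (Y w * (G (vec w) * cos (dot u w))))); last by apply/funext => w; ring.
  rewrite meanD; [|exact/itgZ/itg_cos..].
  by rewrite !meanZ; [rewrite Fc Gc; ring|exact: itg_cos..].
- move=> u; rewrite (_ : (fun w => _) = (fun w => a * (Y w * (F (vec w) * sin (dot u w))) +
    b * (Y w * (G (vec w) * sin (dot u w))))); last by apply/funext => w; ring.
  rewrite meanD; [|exact/itgZ/itg_sin..].
  by rewrite !meanZ; [rewrite Fs Gs; ring|exact: itg_sin..].
Qed.

Let dot_shift u e i w : dot u w + e * Z i w = dot (fun j => u j + e * (j == i)%:R) w.
Proof.
under [RHS]eq_bigr do rewrite mulrDl.
rewrite big_split/=; congr (_ + _).
rewrite (bigD1 i)//= eqxx mulr1 big1 ?addr0// => j /negbTE ->.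
by rewrite mulr0 mul0r.
Qed.

(** Product-to-sum formulas: the extra sine shifts the frequency u by e and by -e in coordinate i,
    and the class allows all frequencies. *)
Let trig_orth_sin e i F : trig_orth F -> trig_orth (fun x => sin (e * x i) * F x).
Proof.
move=> gF; have [mF [K FK] Fc Fs] := gF; split.
- apply: measurable_funM => //; apply: measurableT_comp.
    by apply: continuous_measurable_fun; exact: continuous_sin.
  exact: measurable_funM.
- by exists K => x; rewrite normrM -[leRHS]mul1r ler_pM.
- move=> u; rewrite (_ : (fun w => _) = (fun w =>
     2^-1 * (Y w * (F (vec w) * sin (dot (fun j => u j + e * (j == i)%:R) w))) +
     - 2^-1 * (Y w * (F (vec w) * sin (dot (fun j => u j + (- e) * (j == i)%:R) w))))); last first.
    by apply/funext => w; rewrite -!dot_shift (mulNr e) sinB sinD; field.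
  rewrite meanD; [|exact/itgZ/itg_sin..].
  by rewrite !meanZ; [rewrite !Fs; ring|exact: itg_sin..].
- move=> u; rewrite (_ : (fun w => _) = (fun w =>
     2^-1 * (Y w * (F (vec w) * cos (dot (fun j => u j + (- e) * (j == i)%:R) w))) +
     - 2^-1 * (Y w * (F (vec w) * cos (dot (fun j => u j + e * (j == i)%:R) w))))); last first.
    by apply/funext => w; rewrite -!dot_shift (mulNr e) cosB cosD; field.
  rewrite meanD; [|exact/itgZ/itg_cos..].
  by rewrite !meanZ; [rewrite !Fc; ring|exact: itg_cos..].
Qed.

(** With y = (1 + sin) / 2, the recursion y B1 + (1 - y) B2 equals (B1 + B2) / 2 + sin (B1 - B2) /
    2. *)
Let trig_orth_bernstein e i M (F : nat -> (I -> R) -> R) : (forall k, trig_orth (F k)) ->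
  trig_orth (fun x => bernstein ((1 + sin (e * x i)) / 2) M (F^~ x)).
Proof.
elim: M F => [|M IH] F gF; first exact: gF.
have gB1 := IH _ (fun k => gF k.+1); have gB2 := IH _ gF.
have := trig_orth_lin 1 1 (trig_orth_lin (1/2) (1/2) gB1 gB2)
  (trig_orth_lin (1/2) (-1/2) (trig_orth_sin e i gB1) (trig_orth_sin e i gB2)).
congr trig_orth; apply/funext => x; rewrite [RHS]/bernstein -/bernstein.
by rewrite (_ : _ \o _ = (fun k => F k.+1 x))//; field.
Qed.

Let trig_orth_lim (F : nat -> (I -> R) -> R) K f :
  (forall n, trig_orth (F n)) -> (forall n x, `|F n x| <= K) ->
  (forall x, F n x @[n --> \oo] --> f x) -> trig_orth f.
Proof.
move=> gF FK Ff.
have mf : measurable_fun [set: T] (fun w => f (vec w)).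
  apply: (@measurable_fun_cvg _ _ _ _ (fun n w => F n (vec w))) => [n|w _]; last exact: Ff.
  by case: (gF n).
have lim (t : R -> R) u : continuous t -> (forall x, `|t x| <= 1) ->
    (forall n, mean P (fun w => Y w * (F n (vec w) * t (dot u w))) = 0) ->
    mean P (fun w => Y w * (f (vec w) * t (dot u w))) = 0.
  move=> ct t1 F0.
  have [] := @mean_cvg _ _ _ P (fun n w => Y w * (F n (vec w) * t (dot u w)))
    (fun w => Y w * (f (vec w) * t (dot u w))) (fun w => `|Y w| * K).
  - by under eq_fun do rewrite mulrC; exact/itgZ/itg_norm.
  - by move=> n; apply: itg_measurable (itg_trig _ (gF n) ct t1).
  - move=> n w; rewrite normrM ler_wpM2l// normrM -[leRHS]mulr1 ler_pM//.
  - move=> w; apply: cvgM; first exact: cvg_cst.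
    by apply: cvgM; [exact: Ff|exact: cvg_cst].
  move=> _; under eq_fun do rewrite F0.
  by move=> h; apply/esym; apply: (cvg_unique _ _ h) => //; exact: cvg_cst.
split => //.
- exists K => x; have h : `|F n x| @[n --> \oo] --> `|f x| by apply: cvg_norm (Ff x).
  rewrite -(cvg_lim _ h)//; apply: limr_le; first exact: cvgP h.
  by apply: nearW => n.
- by move=> u; apply: lim => // [|n]; [exact: continuous_cos|case: (gF n)].
- by move=> u; apply: lim => // [|n]; [exact: continuous_sin|case: (gF n)].
Qed.

(** Induction on the coordinates that f depends on. Bernstein approximation in the head coordinate
    samples f at fixed nodes, which leaves functions of the tail only; with no coordinate left f is
    constant and the hypotheses on Y apply. *)
Let trig_orth_bounded_on (l : seq I) f K : scont f -> (forall x, `|f x| <= K) ->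
  (forall x y, {in l, x =1 y} -> f x = f y) -> trig_orth f.
Proof.
elim: l f => [|i l IH] f cf fK fl.
  have -> : f = fun=> f (fun=> 0) by apply/funext => x; exact: fl.
  split=> //; first by exists K.
  - move=> u; rewrite (_ : (fun w => _) = (fun w => f (fun=> 0) * (Y w * cos (dot u w)))); last first.
      by apply/funext => w; ring.
    rewrite meanZ ?Ycos ?mulr0//.
    by apply: (@itgY _ 1) => //; apply: mtrig; exact: continuous_cos.
  - move=> u; rewrite (_ : (fun w => _) = (fun w => f (fun=> 0) * (Y w * sin (dot u w)))); last first.
      by apply/funext => w; ring.
    rewrite meanZ ?Ysin ?mulr0//.
    by apply: (@itgY _ 1) => //; apply: mtrig; exact: continuous_sin.
have y01 (t : R) : 0 <= (1 + sin t) / 2 <= 1.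
  by have := sin_geN1 t; have := sin_le1 t; lra.
apply: (@trig_orth_lim (fun n x => bernstein ((1 + sin (n.+1%:R^-1 * x i)) / 2) (n.+1 ^ 3)
  (fun k => f (upd x i (n.+1%:R * (2 * k%:R / n.+1%:R ^+ 3 - 1))))) K).
- move=> n; apply: (trig_orth_bernstein _ _ _
    (F := fun k x => f (upd x i (n.+1%:R * (2 * k%:R / n.+1%:R ^+ 3 - 1))))) => k.
  apply: IH => [|x|x y xy]; [exact: scont_upd|exact: fK|].
  apply: fl => j; rewrite inE /upd; case: eqVneq => //= _; exact: xy.
- move=> n x; rewrite -[X in _ <= X](bernstein_cst ((1 + sin (n.+1%:R^-1 * x i)) / 2) (n.+1 ^ 3)).
  by apply: norm_bernstein_le.
- move=> x; rewrite -[X in _ --> f X](upd_id x i).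
  under eq_fun do rewrite (mulrC _ (x i)).
  exact: (bernstein_sin_cvg (g := fun t => f (upd x i t)) (K := K)).
Qed.

Let trig_orth_bounded f K : scont f -> (forall x, `|f x| <= K) -> trig_orth f.
Proof.
move=> cf fK; apply: (@trig_orth_bounded_on (enum I) _ K) => // x y xy.
by congr f; apply/funext => i; apply: xy; rewrite mem_enum.
Qed.

Let sin_trunc (n : nat) f (x : I -> R) : R := n.+1%:R * sin (f x / n.+1%:R).

Let trig_orth_trunc n f : scont f -> trig_orth (sin_trunc n f).
Proof.
move=> cf; apply: (@trig_orth_bounded _ n.+1%:R) => [|x].
  apply: (@scont_comp _ _ _ (fun t : R => n.+1%:R * sin (t / n.+1%:R))) => // t.
  apply: cvgM; first exact: cvg_cst.
  apply: (@continuous_comp _ _ _ (fun t : R => t / n.+1%:R) sin); last exact: continuous_sin.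
  by apply: cvgM; [exact: cvg_id|exact: cvg_cst].
by rewrite normrM ger0_norm// -[leRHS]mulr1 ler_wpM2l.
Qed.

(** The bounded case is applied to the truncations q sin(f / q), which converge to f and are
    dominated by |f|. *)
Lemma mean_orth_scont f : scont f -> measurable_fun [set: T] (fun w => f (vec w)) /\
  (itg P (fun w => Y w * f (vec w)) -> mean P (fun w => Y w * f (vec w)) = 0).
Proof.
move=> cf.
have Mcvg w : sin_trunc n f (vec w) @[n --> \oo] --> f (vec w) by exact: scaled_sin_cvg.
have mtr n : measurable_fun [set: T] (fun w => sin_trunc n f (vec w)).
  by case: (trig_orth_trunc n cf).
split; first by apply: (@measurable_fun_cvg _ _ _ _ (fun n w => sin_trunc n f (vec w))).
move=> iYf.
have [] := @mean_cvg _ _ _ P (fun n w => Y w * sin_trunc n f (vec w))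
    (fun w => Y w * f (vec w)) (fun w => `|Y w * f (vec w)|).
- exact: itg_norm.
- by move=> n; apply: measurable_funM => //; exact: itg_measurable iY.
- by move=> n w; rewrite [leLHS]normrM [leRHS]normrM ler_wpM2l//; exact: scaled_sin_le.
- by move=> w; apply: cvgM; [exact: cvg_cst|exact: Mcvg].
move=> _ h; apply/esym; apply: (cvg_unique _ _ h) => //.
rewrite (_ : (fun n => _) = cst 0); first exact: cvg_cst.
(* Frequency zero: the cosine becomes the constant 1. *)
apply/funext => n; have [_ _ /(_ (fun=> 0)) e _] := trig_orth_trunc n cf.
rewrite -[RHS]e; congr (mean P _); apply/funext => w.
by rewrite big1 ?cos0 ?mulr1// => i _; rewrite mul0r.
Qed.

End orthogonal_weight.

(** The zero weight Y satisfies every orthogonality condition, so only the measurability obtained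
    through the approximation remains. *)
Lemma scont_measurable f : scont f -> measurable_fun [set: T] (fun w => f (vec w)).
Proof.
move=> cf; apply: (mean_orth_scont (Y := fun=> 0) _ _ _ cf).1.
- exact: itg_cst.
- by move=> u; under eq_fun do rewrite mul0r; rewrite mean_cst.
- by move=> u; under eq_fun do rewrite mul0r; rewrite mean_cst.
Qed.

End trigonometric_density.

(** * Product spaces and calculus along curves *)

Section product_mean.
Context d1 (T1 : measurableType d1) d2 (T2 : measurableType d2) (R : realType).
Variables (P1 : probability T1 R) (P2 : probability T2 R).
Local Notation Q := (P1 \x P2)%E.

Lemma measurable_comp_fst (f : T1 -> R) : measurable_fun [set: T1] f ->
  measurable_fun [set: T1 * T2] (fun p => f p.1).
Proof. by move=> mf; apply: measurableT_comp mf _; exact: measurable_fst. Qed.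

Lemma measurable_comp_snd (f : T2 -> R) : measurable_fun [set: T2] f ->
  measurable_fun [set: T1 * T2] (fun p => f p.2).
Proof. by move=> mf; apply: measurableT_comp mf _; exact: measurable_snd. Qed.

Lemma itg_prodM (f : T1 -> R) (h : T2 -> R) : itg P1 f -> itg P2 h ->
  itg Q (fun p => f p.1 * h p.2).
Proof.
move=> i1 i2.
have mM : measurable_fun [set: T1 * T2] (EFin \o (fun p => f p.1 * h p.2)).
  apply/measurable_EFinP; apply: measurable_funM.
    by apply: measurable_comp_fst; exact: itg_measurable i1.
  by apply: measurable_comp_snd; exact: itg_measurable i2.
apply/(integrable12ltyP P1 P2 mM) => /=.
rewrite (eq_integral (fun x => (mean P2 (fun y => `|h y|) * `|f x|)%:E)).
  by rewrite -EFin_mean ?ltry//; exact/itgZ/itg_norm.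
move=> x _; rewrite mulrC -meanZ ?EFin_mean; [|exact/itgZ/itg_norm|exact: itg_norm].
by apply: eq_integral => y _; rewrite /= normrM.
Qed.

Lemma mean_fubini (k : T1 * T2 -> R) : itg Q k -> (forall x, itg P2 (fun y => k (x, y))) ->
  mean Q k = mean P1 (fun x => mean P2 (fun y => k (x, y))).
Proof.
move=> ik ikx; rewrite /mean /Rintegral; congr fine.
rewrite -(integral12_prod_meas1 ik); apply: eq_integral => x _.
exact: esym (EFin_mean (ikx x)).
Qed.

Lemma mean_fubini21 (k : T1 * T2 -> R) : itg Q k -> (forall y, itg P1 (fun x => k (x, y))) ->
  mean Q k = mean P2 (fun y => mean P1 (fun x => k (x, y))).
Proof.
move=> ik iky; rewrite /mean /Rintegral; congr fine.
rewrite -(integral21_prod_meas1 ik); apply: eq_integral => y _.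
exact: esym (EFin_mean (iky y)).
Qed.

Lemma mean_prodM (f : T1 -> R) (h : T2 -> R) : itg P1 f -> itg P2 h ->
  mean Q (fun p => f p.1 * h p.2) = mean P1 f * mean P2 h.
Proof.
move=> i1 i2; rewrite mean_fubini /=; [|exact: itg_prodM|by move=> x; exact: itgZ].
under eq_fun do rewrite meanZ// mulrC.
by rewrite meanZ// mulrC.
Qed.

Lemma itg_fst (f : T1 -> R) : itg P1 f -> itg Q (fun p => f p.1).
Proof.
by move=> i1; have := itg_prodM i1 (itg_cst P2 1); under eq_fun do rewrite mulr1.
Qed.

Lemma itg_snd (f : T2 -> R) : itg P2 f -> itg Q (fun p => f p.2).
Proof.
by move=> i2; have := itg_prodM (itg_cst P1 1) i2; under eq_fun do rewrite mul1r.
Qed.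

Lemma mean_fst (f : T1 -> R) : itg P1 f -> mean Q (fun p => f p.1) = mean P1 f.
Proof.
move=> i1; have := mean_prodM i1 (itg_cst P2 1); rewrite mean_cst mulr1 => <-.
by congr (mean Q _); apply/funext => p; rewrite mulr1.
Qed.

Lemma mean_snd (f : T2 -> R) : itg P2 f -> mean Q (fun p => f p.2) = mean P2 f.
Proof.
move=> i2; have := mean_prodM (itg_cst P1 1) i2; rewrite mean_cst mul1r => <-.
by congr (mean Q _); apply/funext => p; rewrite mul1r.
Qed.

Lemma all_moments_fst (f : T1 -> R) : all_moments P1 f -> all_moments Q (fun p => f p.1).
Proof. by move=> [mf fk]; split => [|k]; [exact: measurable_comp_fst|exact: itg_fst (fk k)]. Qed.

Lemma all_moments_snd (f : T2 -> R) : all_moments P2 f -> all_moments Q (fun p => f p.2).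
Proof. by move=> [mf fk]; split => [|k]; [exact: measurable_comp_snd|exact: itg_snd (fk k)]. Qed.

End product_mean.

Section curve_calculus.
Context {R : realType}.

(* Fréchet differentiability, stated as the chain rule along curves. *)
Definition diffble (I : finType) (g : (I -> R) -> R) (dg : I -> (I -> R) -> R) : Prop :=
  forall (c : R -> I -> R) (c' : I -> R) (t : R),
    (forall i, is_derive t (1 : R) (c^~ i) (c' i)) ->
    is_derive t (1 : R) (fun s => g (c s)) (\sum_i dg i (c t) * c' i).

(** Stronger than [scont], and stable under composition with maps that move several coordinates at
    once. *)
Definition curve_continuous (I : finType) (g : (I -> R) -> R) : Prop :=
  forall (c : R -> I -> R) (t : R), (forall i, {for t, continuous (c^~ i)}) ->
    {for t, continuous (fun s => g (c s))}.

Definition polynomial_growth (I : finType) (g : (I -> R) -> R) : Prop :=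
  exists C k, 0 <= C /\ forall x, `|g x| <= C * (1 + \sum_i `|x i|) ^+ k.

Lemma is_derive_continuous (f : R -> R) (t df : R) : is_derive t (1 : R) f df ->
  {for t, continuous f}.
Proof.
by move=> h; apply: differentiable_continuous; apply/derivable1_diffP; exact: ex_derive.
Qed.

Section one_domain.
Context (I : finType).
Implicit Types (g h : (I -> R) -> R) (dg dh : I -> (I -> R) -> R).

Lemma diffble_scont g dg : diffble g dg -> scont g.
Proof.
move=> gP x i t; have := gP (upd x i) (fun j => (j == i)%:R) t; move=> H.
apply: is_derive_continuous; apply: H => j; rewrite /upd.
by case: eqP => _; [exact: is_derive_id|exact: is_derive_cst].
Qed.

Lemma diffble_ext g dg dg' : diffble g dg -> (forall i x, dg i x = dg' i x) -> diffble g dg'.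
Proof.
by move=> gP e c c' t ct; have := gP c c' t ct; under eq_bigr do rewrite e.
Qed.

Lemma diffble_cst a : diffble (I := I) (fun=> a) (fun _ _ => 0).
Proof.
move=> c c' t _; rewrite big1; first exact: is_derive_cst.
by move=> i _; rewrite mul0r.
Qed.

Lemma diffble_coord j : diffble (fun x : I -> R => x j) (fun i _ => (i == j)%:R).
Proof.
move=> c c' t ct; rewrite (bigD1 j)//= eqxx mul1r big1 ?addr0//.
by move=> i /negbTE ->; rewrite mul0r.
Qed.

Lemma diffbleD g dg h dh : diffble g dg -> diffble h dh ->
  diffble (fun x => g x + h x) (fun i x => dg i x + dh i x).
Proof.
move=> gP hP c c' t ct; have g1 := gP c c' t ct; have h1 := hP c c' t ct.
under eq_bigr do rewrite mulrDl.
by rewrite big_split; exact: is_deriveD.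
Qed.

Lemma diffbleM g dg h dh : diffble g dg -> diffble h dh ->
  diffble (fun x => g x * h x) (fun i x => dg i x * h x + g x * dh i x).
Proof.
move=> gP hP c c' t ct; have g1 := gP c c' t ct; have h1 := hP c c' t ct.
apply: is_derive_eq; rewrite /GRing.scale /= !mulr_sumr -big_split /=.
by apply: eq_bigr => i _; ring.
Qed.

Lemma diffbleZ a g dg : diffble g dg -> diffble (fun x => a * g x) (fun i x => a * dg i x).
Proof.
move=> /(diffbleM (diffble_cst a)) /diffble_ext; apply => i x.
by rewrite mul0r add0r.
Qed.

Lemma diffble_sum (J : Type) (l : seq J) (g : J -> (I -> R) -> R)
    (dg : J -> I -> (I -> R) -> R) :
  (forall j, diffble (g j) (dg j)) ->
  diffble (fun x => \sum_(j <- l) g j x) (fun i x => \sum_(j <- l) dg j i x).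
Proof.
move=> gP c c' t ct; under eq_bigr do rewrite mulr_suml.
rewrite exchange_big /=; elim: l => [|j l IH].
  by under eq_fun do rewrite big_nil; rewrite big_nil; exact: is_derive_cst.
have gj := gP j c c' t ct.
by under eq_fun do rewrite big_cons; rewrite big_cons; exact: is_deriveD.
Qed.

Lemma diffble_comp (K : finType) (g : (K -> R) -> R) (dg : K -> (K -> R) -> R)
    (F : K -> (I -> R) -> R) (dF : K -> I -> (I -> R) -> R) :
  diffble g dg -> (forall k, diffble (F k) (dF k)) ->
  diffble (fun x => g (F^~ x)) (fun i x => \sum_k dg k (F^~ x) * dF k i x).
Proof.
move=> gP FP c c' t ct.
have := gP (fun s => F^~ (c s)) (fun k => \sum_i dF k i (c t) * c' i) t (fun k => FP k c c' t ct).
congr is_derive; under [RHS]eq_bigr do rewrite mulr_suml.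
rewrite [RHS]exchange_big /=; apply: eq_bigr => k _.
by rewrite mulr_sumr; apply: eq_bigr => i _; ring.
Qed.

Lemma curve_continuous_scont g : curve_continuous g -> scont g.
Proof.
move=> gP x i t; apply: (gP (upd x i)) => j; rewrite /upd.
by case: eqP => _; [exact: cvg_id|exact: cvg_cst].
Qed.

Lemma curve_continuous_cst a : curve_continuous (I := I) (fun=> a : R).
Proof. by move=> c t _; exact: cvg_cst. Qed.

Lemma curve_continuous_coord j : curve_continuous (fun x : I -> R => x j).
Proof. by move=> c t; exact. Qed.

Lemma curve_continuousD g h : curve_continuous g -> curve_continuous h ->
  curve_continuous (fun x => g x + h x).
Proof. by move=> gP hP c t ct; apply: cvgD; [exact: gP|exact: hP]. Qed.

Lemma curve_continuousM g h : curve_continuous g -> curve_continuous h ->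
  curve_continuous (fun x => g x * h x).
Proof. by move=> gP hP c t ct; apply: cvgM; [exact: gP|exact: hP]. Qed.

Lemma curve_continuous_sum (J : Type) (l : seq J) (g : J -> (I -> R) -> R) :
  (forall j, curve_continuous (g j)) -> curve_continuous (fun x => \sum_(j <- l) g j x).
Proof.
move=> gP; elim: l => [|j l IH].
  by under eq_fun do rewrite big_nil; exact: curve_continuous_cst.
by under eq_fun do rewrite big_cons; exact: (curve_continuousD (gP j) IH).
Qed.

Lemma curve_continuous_comp (K : finType) (g : (K -> R) -> R) (F : K -> (I -> R) -> R) :
  curve_continuous g -> (forall k, curve_continuous (F k)) ->
  curve_continuous (fun x => g (F^~ x)).
Proof.
by move=> gP FP c t ct; apply: (gP (fun s => F^~ (c s))) => k; exact: FP.
Qed.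

Let env_ge1 (x : I -> R) : 1 <= 1 + \sum_i `|x i|.
Proof. by rewrite lerDl sumr_ge0. Qed.

Lemma polynomial_growth_cst a : polynomial_growth (I := I) (fun=> a : R).
Proof. by exists `|a|, 0%N; split => // x; rewrite expr0 mulr1. Qed.

Lemma polynomial_growth_coord j : polynomial_growth (fun x : I -> R => x j).
Proof.
exists 1, 1%N; split => // x; rewrite mul1r expr1 (bigD1 j)//=.
by rewrite addrCA lerDl addr_ge0// sumr_ge0.
Qed.

Lemma polynomial_growth_le g h : polynomial_growth h -> (forall x, `|g x| <= `|h x|) ->
  polynomial_growth g.
Proof.
by move=> [C [k [C0 hC]]] gh; exists C, k; split => // x; exact: le_trans (gh x) (hC x).
Qed.

Lemma polynomial_growthD g h : polynomial_growth g -> polynomial_growth h ->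
  polynomial_growth (fun x => g x + h x).
Proof.
move=> [C [k [C0 gC]]] [D [l [D0 hD]]]; exists (C + D), (k + l)%N; split; first exact: addr_ge0.
move=> x; rewrite (le_trans (ler_normD _ _))// mulrDl lerD//.
  by rewrite (le_trans (gC x))// ler_wpM2l// ler_weXn2l ?leq_addr.
by rewrite (le_trans (hD x))// ler_wpM2l// ler_weXn2l ?leq_addl.
Qed.

Lemma polynomial_growthM g h : polynomial_growth g -> polynomial_growth h ->
  polynomial_growth (fun x => g x * h x).
Proof.
move=> [C [k [C0 gC]]] [D [l [D0 hD]]]; exists (C * D), (k + l)%N; split; first exact: mulr_ge0.
by move=> x; rewrite normrM exprD mulrACA ler_pM.
Qed.

Lemma polynomial_growth_sum (J : Type) (l : seq J) (g : J -> (I -> R) -> R) :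
  (forall j, polynomial_growth (g j)) -> polynomial_growth (fun x => \sum_(j <- l) g j x).
Proof.
move=> gP; elim: l => [|j l IH].
  by under eq_fun do rewrite big_nil; exact: polynomial_growth_cst.
by under eq_fun do rewrite big_cons; exact: polynomial_growthD.
Qed.

Lemma polynomial_growth_norm g : polynomial_growth g -> polynomial_growth (fun x => `|g x|).
Proof. by move=> /polynomial_growth_le; apply => x; rewrite normr_id. Qed.

Lemma polynomial_growthX g n : polynomial_growth g -> polynomial_growth (fun x => g x ^+ n).
Proof.
move=> gP; elim: n => [|n IH]; first by under eq_fun do rewrite expr0; exact: polynomial_growth_cst.
by under eq_fun do rewrite exprS; exact: polynomial_growthM.
Qed.

Lemma polynomial_growth_comp (K : finType) (g : (K -> R) -> R) (F : K -> (I -> R) -> R) :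
  polynomial_growth g -> (forall k, polynomial_growth (F k)) ->
  polynomial_growth (fun x => g (F^~ x)).
Proof.
move=> [C [k [C0 gC]]] FP.
apply: (@polynomial_growth_le _ (fun x => C * (1 + \sum_j `|F j x|) ^+ k)).
  apply: polynomial_growthM; first exact: polynomial_growth_cst.
  apply: polynomial_growthX; apply: polynomial_growthD; first exact: polynomial_growth_cst.
  by apply: polynomial_growth_sum => j; exact: polynomial_growth_norm.
by move=> x; rewrite (le_trans (gC _))// ler_norm.
Qed.

End one_domain.
End curve_calculus.

(** * Gaussian integration by parts *)

Lemma polynomial_growth_moments d (T : measurableType d) (R : realType)
    (P : probability T R) (I : finType) (Z : I -> T -> R) (g : (I -> R) -> R) :
  (forall i, all_moments P (Z i)) -> scont g -> polynomial_growth g ->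
  all_moments P (fun w => g (Z^~ w)).
Proof.
move=> Zm cg [C [k [C0 gC]]].
apply: (@all_moments_le _ _ _ _ _ (fun w => C * (1 + \sum_i `|Z i w|) ^+ k)).
- by apply: scont_measurable => // i; case: (Zm i).
- by moments.
- by move=> w; rewrite (le_trans (gC _))// ler_norm.
Qed.

Section gaussian_integration_by_parts.
Context d (T : measurableType d) (R : realType) (P : probability T R) (I : finType).
Variable Z : I -> T -> R.
Hypothesis gZ : gaussian_vector P Z.
Local Notation dot u w := (\sum_i u i * Z i w).
Local Notation Q := (P \x P)%E.

Let Zm i : all_moments P (Z i). Proof. exact: gaussian_vector_moments gZ i. Qed.
Let cos_m u : all_moments P (fun w => cos (dot u w)).
Proof.
apply: (gaussian_trig_moments gZ) => [|x]; first exact: continuous_cos.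
by rewrite ler_norml cos_geN1 cos_le1.
Qed.
Let sin_m u : all_moments P (fun w => sin (dot u w)).
Proof.
apply: (gaussian_trig_moments gZ) => [|x]; first exact: continuous_sin.
by rewrite ler_norml sin_geN1 sin_le1.
Qed.

Let mean4 (f1 h1 f2 h2 f3 h3 f4 h4 : T -> R) a1 a2 a3 a4 :
  all_moments P f1 -> all_moments P h1 -> all_moments P f2 -> all_moments P h2 ->
  all_moments P f3 -> all_moments P h3 -> all_moments P f4 -> all_moments P h4 ->
  mean Q (fun p => a1 * (f1 p.1 * h1 p.2) + a2 * (f2 p.1 * h2 p.2) +
                   a3 * (f3 p.1 * h3 p.2) + a4 * (f4 p.1 * h4 p.2)) =
  a1 * (mean P f1 * mean P h1) + a2 * (mean P f2 * mean P h2) +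
  a3 * (mean P f3 * mean P h3) + a4 * (mean P f4 * mean P h4).
Proof.
move=> /all_moments_itg m1 /all_moments_itg n1 /all_moments_itg m2 /all_moments_itg n2.
move=> /all_moments_itg m3 /all_moments_itg n3 /all_moments_itg m4 /all_moments_itg n4.
have i1 := itg_prodM m1 n1; have i2 := itg_prodM m2 n2.
have i3 := itg_prodM m3 n3; have i4 := itg_prodM m4 n4.
rewrite !meanD ?meanZ ?mean_prodM//; repeat first [exact: itgZ | apply: itgD].
Qed.

Variable a : I.
Let rot (t : R) i (p : T * T) := Z i p.1 + t * Z i p.2.
Let wgt (t : R) (p : T * T) := Z a p.2 - t * Z a p.1.

Let Zm1 i : all_moments Q (fun p => Z i p.1). Proof. exact: all_moments_fst. Qed.
Let Zm2 i : all_moments Q (fun p => Z i p.2). Proof. exact: all_moments_snd. Qed.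

Let rot_m t i : all_moments Q (rot t i).
Proof. by rewrite /rot; moments. Qed.

Let wgt_m t : all_moments Q (wgt t).
Proof. by rewrite /wgt; moments. Qed.

Let dot_rot t u p : \sum_i u i * rot t i p = dot u p.1 + dot (fun i => t * u i) p.2.
Proof. by rewrite -big_split /=; apply: eq_bigr => i _; rewrite /rot; ring. Qed.

(* The rotated vector [Z + tZ'] and [Z'_a - tZ_a] are uncorrelated Gaussians. *)
Let wgt_cos t u : mean Q (fun p => wgt t p * cos (\sum_i u i * rot t i p)) = 0.
Proof.
rewrite (_ : (fun p => _) = (fun p : T * T =>
   1 * (cos (dot u p.1) * (Z a p.2 * cos (dot (fun i => t * u i) p.2))) +
   (-1) * (sin (dot u p.1) * (Z a p.2 * sin (dot (fun i => t * u i) p.2))) +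
   (- t) * ((Z a p.1 * cos (dot u p.1)) * cos (dot (fun i => t * u i) p.2)) +
   t * ((Z a p.1 * sin (dot u p.1)) * sin (dot (fun i => t * u i) p.2)))); last first.
  by apply/funext => p; rewrite dot_rot cosD /wgt; ring.
rewrite (mean4 (f1 := fun w => cos (dot u w))
  (h1 := fun w => Z a w * cos (dot (fun i => t * u i) w))
  (f2 := fun w => sin (dot u w)) (h2 := fun w => Z a w * sin (dot (fun i => t * u i) w))
  (f3 := fun w => Z a w * cos (dot u w)) (h3 := fun w => cos (dot (fun i => t * u i) w))
  (f4 := fun w => Z a w * sin (dot u w)) (h4 := fun w => sin (dot (fun i => t * u i) w)));
  try by moments.
by rewrite !(gaussian_vector_cos gZ, gaussian_vector_sin0 gZ); ring.
Qed.

Let wgt_sin t u : mean Q (fun p => wgt t p * sin (\sum_i u i * rot t i p)) = 0.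
Proof.
rewrite (_ : (fun p => _) = (fun p : T * T =>
   1 * (sin (dot u p.1) * (Z a p.2 * cos (dot (fun i => t * u i) p.2))) +
   1 * (cos (dot u p.1) * (Z a p.2 * sin (dot (fun i => t * u i) p.2))) +
   (- t) * ((Z a p.1 * sin (dot u p.1)) * cos (dot (fun i => t * u i) p.2)) +
   (- t) * ((Z a p.1 * cos (dot u p.1)) * sin (dot (fun i => t * u i) p.2)))); last first.
  by apply/funext => p; rewrite dot_rot sinD /wgt; ring.
rewrite (mean4 (f1 := fun w => sin (dot u w))
  (h1 := fun w => Z a w * cos (dot (fun i => t * u i) w))
  (f2 := fun w => cos (dot u w)) (h2 := fun w => Z a w * sin (dot (fun i => t * u i) w))
  (f3 := fun w => Z a w * sin (dot u w)) (h3 := fun w => cos (dot (fun i => t * u i) w))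
  (f4 := fun w => Z a w * cos (dot u w)) (h4 := fun w => sin (dot (fun i => t * u i) w)));
  try by moments.
(* The two surviving terms are t (sum_b u_b C_ab) E cos(u.Z) E cos(tu.Z), C being the covariance of
   Z, with opposite signs. *)
rewrite !(gaussian_vector_cos gZ, gaussian_vector_sin0 gZ, gaussian_vector_sin gZ).
under [X in _ * (_ * (X * _))]eq_bigr do rewrite -mulrA.
by rewrite -mulr_sumr; ring.
Qed.

Theorem gaussian_ibp (g : (I -> R) -> R) (dg : I -> (I -> R) -> R) :
  diffble g dg -> polynomial_growth g ->
  (forall b, scont (dg b)) -> (forall b, polynomial_growth (dg b)) ->
  mean P (fun w => Z a w * g (Z^~ w)) =
  \sum_b mean P (fun w => Z a w * Z b w) * mean P (fun w => dg b (Z^~ w)).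
Proof.
move=> gP gG dgC dgG.
have gC := diffble_scont gP.
have gm t : all_moments Q (fun p => g ((rot t)^~ p)) by exact: polynomial_growth_moments.
have zero t : mean Q (fun p => wgt t p * g ((rot t)^~ p)) = 0.
  apply: (mean_orth_scont _ _ _ _ gC).2 => //.
  - by move=> i; case: (rot_m t i).
  - by moments.
  - by moments.
(* Dominates 1 + sum_i |Z_i + t Z'_i| for all |t| < 1, so its powers bound functions of polynomial
   growth uniformly in t. *)
pose env (p : T * T) := 1 + \sum_i (`|Z i p.1| + `|Z i p.2|).
have envm : all_moments Q env by rewrite /env; moments.
have le_env (h : (I -> R) -> R) C k : 0 <= C -> (forall x, `|h x| <= C * (1 + \sum_i `|x i|) ^+ k) ->
    forall t p, -1 < t < 1 -> `|h ((rot t)^~ p)| <= C * env p ^+ k.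
  move=> C0 hC t p t1; apply: (le_trans (hC _)); rewrite ler_wpM2l// lerXn2r//.
  - by rewrite nnegrE addr_ge0// sumr_ge0.
  - by rewrite nnegrE addr_ge0// sumr_ge0// => i _; rewrite addr_ge0.
  rewrite lerD2l ler_sum// => i _; rewrite (le_trans (ler_normD _ _))// lerD2l normrM.
  by rewrite ler_piMl// ler_norml; move: t1 => /andP[/ltW -> /ltW ->].
have [C [k [C0 gCk]]] := gG.
have gle := le_env _ _ _ C0 gCk.
have dgle b : exists h : T * T -> R, all_moments Q h /\
    forall t p, -1 < t < 1 -> `|dg b ((rot t)^~ p)| <= h p.
  have [D [l [D0 dgD]]] := dgG b; exists (fun p => D * env p ^+ l); split; first by moments.
  exact: le_env.
have [H HP] := choice dgle.
have D := @is_derive_mean _ _ _ Q (fun t p => wgt t p * g ((rot t)^~ p))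
  (fun t p => - Z a p.1 * g ((rot t)^~ p) + wgt t p * \sum_b dg b ((rot t)^~ p) * Z b p.2)
  (fun p => `|Z a p.1| * (C * env p ^+ k) + (`|Z a p.2| + `|Z a p.1|) * \sum_b H b p * `|Z b p.2|) 0.
have {}D : is_derive (0:R) (1:R) (fun t => mean Q (fun p => wgt t p * g ((rot t)^~ p)))
   (mean Q (fun p => - Z a p.1 * g ((rot 0)^~ p) + wgt 0 p * \sum_b dg b ((rot 0)^~ p) * Z b p.2)).
  apply: D.
  - have Hm b : all_moments Q (H b) by case: (HP b).
    by moments.
  - by move=> t _; moments.
  - move=> t p _.
    have h1 : is_derive t (1:R) (fun s => g ((rot s)^~ p)) (\sum_b dg b ((rot t)^~ p) * Z b p.2).
      apply: (gP (fun s => (rot s)^~ p) (fun b => Z b p.2)) => b.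
      by rewrite /rot; apply: is_derive_eq; rewrite /GRing.scale /=; ring.
    have h2 : is_derive t (1:R) (fun s => wgt s p) (- Z a p.1).
      by rewrite /wgt; apply: is_derive_eq; rewrite /GRing.scale /=; ring.
    by apply: is_derive_eq; rewrite /GRing.scale /=; ring.
  - move=> t p; rewrite sub0r add0r => t1.
    rewrite (le_trans (ler_normD _ _))// !normrM normrN lerD//.
      by rewrite ler_wpM2l// gle.
    rewrite ler_pM//.
      rewrite (le_trans (ler_normB _ _))// lerD2l normrM ler_piMl// ler_norml.
      by move: t1 => /andP[/ltW -> /ltW ->].
    rewrite (le_trans (ler_norm_sum _ _ _))// ler_sum// => b _.
    by rewrite normrM ler_wpM2r//; apply: (HP b).2.
have := @derive_val _ _ _ _ _ _ _ D.
under eq_fun do rewrite zero.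
(* At t = 0 the rotated vector is Z itself, so each term is a function of Z times a function of Z'
   and its mean factorizes. *)
rewrite derive_cst (_ : (fun p => _) = (fun p => \sum_b dg b (Z^~ p.1) * (Z a p.2 * Z b p.2) -
   Z a p.1 * g (Z^~ p.1) * 1)); last first.
  apply/funext => p; have -> : (rot 0)^~ p = Z^~ p.1.
    by apply/funext => i; rewrite /rot mul0r addr0.
  rewrite /wgt mul0r subr0 mulr_sumr addrC; congr (_ + _); last by ring.
  by apply: eq_bigr => b _; ring.
have gm0 : all_moments P (fun w => g (Z^~ w)) by exact: polynomial_growth_moments.
have dgm0 b : all_moments P (fun w => dg b (Z^~ w)) by exact: polynomial_growth_moments.
have ib b : itg Q (fun p => dg b (Z^~ p.1) * (Z a p.2 * Z b p.2)).
  by apply: (itg_prodM (f := fun w => dg b (Z^~ w)) (h := fun w => Z a w * Z b w)); moments.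
rewrite meanB; first last.
- by apply: (itg_prodM (f := fun w => Z a w * g (Z^~ w)) (h := fun=> 1)); moments.
- exact: itg_sum.
rewrite (mean_prodM (f := fun w => Z a w * g (Z^~ w)) (h := fun=> 1)); try by moments.
rewrite mean_cst mulr1 mean_sum// => /eqP; rewrite eq_sym subr_eq0 => /eqP <-.
apply: eq_bigr => b _.
rewrite (mean_prodM (f := fun w => dg b (Z^~ w)) (h := fun w => Z a w * Z b w)); try by moments.
by rewrite mulrC.
Qed.

End gaussian_integration_by_parts.

(** * Stein kernels and the smart path *)

(** One integration by parts in Z_a against the monomial x_b x_c x_e. *)
Lemma gaussian_wick4 d (T : measurableType d) (R : realType) (P : probability T R)
    (I : finType) (Z : I -> T -> R) (a b c e : I) : gaussian_vector P Z ->
  let C i j := mean P (fun w => Z i w * Z j w) in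
  mean P (fun w => Z a w * (Z b w * (Z c w * Z e w))) =
  C a b * C c e + C a c * C b e + C a e * C b c.
Proof.
move=> gZ C.
have Zm i : all_moments P (Z i) by exact: gaussian_vector_moments gZ i.
have gP : diffble (fun x : I -> R => x b * (x c * x e))
    (fun i x => (i == b)%:R * (x c * x e) + x b * ((i == c)%:R * x e + x c * (i == e)%:R)).
  by do ![apply: diffbleM | exact: diffble_coord].
have cc j : curve_continuous (fun x : I -> R => x j) by exact: curve_continuous_coord.
have pc j : polynomial_growth (fun x : I -> R => x j) by exact: polynomial_growth_coord.
rewrite (gaussian_ibp gZ a gP).
- have sumδ j K : \sum_i C a i * ((i == j)%:R * K) = C a j * K.
    rewrite (bigD1 j)//= eqxx mul1r big1 ?addr0// => i /negbTE ->.
    by rewrite mul0r mulr0.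
  rewrite -(sumδ b (C c e)) -(sumδ c (C b e)) -(sumδ e (C b c)) -!big_split /=.
  apply: eq_bigr => i _; rewrite -!mulrDr; congr (_ * _).
  rewrite -!meanZ -?meanD; try by moments.
  by congr (mean P _); apply/funext => w; ring.
- by do ![apply: polynomial_growthM].
- move=> i; apply: curve_continuous_scont.
  by do ![apply: curve_continuousD | apply: curve_continuousM | exact: curve_continuous_cst].
- by move=> i; do ![apply: polynomial_growthD | apply: polynomial_growthM | exact: polynomial_growth_cst].
Qed.

Section stein_kernel.
Context d (T : measurableType d) (R : realType) (P : probability T R) (K : finType).

(** The kernel lives on the underlying probability space and may depend on more than W, so no
    conditional expectation given W has to be taken. *)
Definition stein_kernel (W : K -> T -> R) (G : K -> K -> T -> R) : Prop :=
  forall (p : K) (f : (K -> R) -> R) (df : K -> (K -> R) -> R),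
    diffble f df -> polynomial_growth f ->
    (forall q, curve_continuous (df q)) -> (forall q, polynomial_growth (df q)) ->
    mean P (fun w => W p w * f (W^~ w)) = \sum_q mean P (fun w => G p q w * df q (W^~ w)).

Lemma gaussian_stein_kernel (Z : K -> T -> R) : gaussian_vector P Z ->
  stein_kernel Z (fun p q _ => mean P (fun w => Z p w * Z q w)).
Proof.
move=> gZ p f df fP fG dfC dfG.
have Zm i : all_moments P (Z i) by exact: gaussian_vector_moments gZ i.
have dfS q : scont (df q) by exact: curve_continuous_scont.
rewrite (gaussian_ibp gZ p fP fG dfS dfG); apply: eq_bigr => q _.
by rewrite meanZ//; apply: all_moments_itg; exact: polynomial_growth_moments.
Qed.

(** Testing against the coordinate x_q. Equal covariances therefore become equal mean kernels. *)
Lemma stein_kernel_mean (W : K -> T -> R) (G : K -> K -> T -> R) p q :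
  (forall p q, all_moments P (G p q)) -> stein_kernel W G ->
  mean P (fun w => W p w * W q w) = mean P (G p q).
Proof.
move=> Gm WG; rewrite (WG p (fun x => x q) (fun i _ => (i == q)%:R)).
- rewrite (bigD1 q)//= eqxx big1 ?addr0.
    by congr (mean P _); apply/funext => w; rewrite mulr1.
  move=> i /negbTE ->; under eq_fun do rewrite mulr0.
  exact: mean_cst.
- exact: diffble_coord.
- exact: polynomial_growth_coord.
- by move=> i; exact: curve_continuous_cst.
- by move=> i; exact: polynomial_growth_cst.
Qed.

(** On the smart path, once the other independent vector is frozen at y, the argument is affine in
    W. *)
Lemma stein_kernel_affine (W : K -> T -> R) (G : K -> K -> T -> R) p
    (f : (K -> R) -> R) (df : K -> (K -> R) -> R) (a : R) (y : K -> R) :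
  stein_kernel W G -> diffble f df -> polynomial_growth f ->
  (forall q, curve_continuous (df q)) -> (forall q, polynomial_growth (df q)) ->
  mean P (fun w => W p w * f (fun k => a * W k w + y k)) =
  \sum_q mean P (fun w => G p q w * (a * df q (fun k => a * W k w + y k))).
Proof.
move=> WG fP fG dfC dfG.
have linP k : diffble (fun x : K -> R => a * x k + y k) (fun i _ => a * (i == k)%:R).
  apply: diffble_ext (diffbleD (diffbleZ a (diffble_coord k)) (diffble_cst (y k))) _ => i x.
  by rewrite addr0.
have linG k : polynomial_growth (fun x : K -> R => a * x k + y k).
  apply: polynomial_growthD; last exact: polynomial_growth_cst.
  apply: polynomial_growthM; [exact: polynomial_growth_cst|exact: polynomial_growth_coord].
have linC k : curve_continuous (fun x : K -> R => a * x k + y k).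
  apply: curve_continuousD; last exact: curve_continuous_cst.
  apply: curve_continuousM; [exact: curve_continuous_cst|exact: curve_continuous_coord].
rewrite (WG p (fun x => f (fun k => a * x k + y k))
  (fun q x => a * df q (fun k => a * x k + y k)))//.
- apply: diffble_ext (diffble_comp fP linP) _ => i x.
  rewrite (bigD1 i)//= eqxx mulr1 big1 ?addr0 1?mulrC// => k /negbTE ki.
  by rewrite eq_sym ki !mulr0.
- exact: polynomial_growth_comp fG linG.
- move=> q; apply: curve_continuousM; first exact: curve_continuous_cst.
  exact: curve_continuous_comp (dfC q) linC.
- move=> q; apply: polynomial_growthM; first exact: polynomial_growth_cst.
  exact: polynomial_growth_comp (dfG q) linG.
Qed.

End stein_kernel.

Section smart_path.
Context d (T : measurableType d) d' (T' : measurableType d') (R : realType).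
Variables (P : probability T R) (P' : probability T' R) (K : finType).
Variables (W : K -> T -> R) (G : K -> K -> T -> R) (V : K -> T' -> R) (C : K -> K -> R).
Hypotheses (Wm : forall p, all_moments P (W p)) (Gm : forall p q, all_moments P (G p q)).
Hypothesis Vm : forall p, all_moments P' (V p).
Hypotheses (WG : stein_kernel P W G) (VC : stein_kernel P' V (fun p q _ => C p q)).
Variables (H : (K -> R) -> R) (H1 : K -> (K -> R) -> R) (H2 : K -> K -> (K -> R) -> R).
Hypotheses (HP : diffble H H1) (HG : polynomial_growth H).
Hypotheses (H1P : forall p, diffble (H1 p) (H2^~ p)) (H1G : forall p, polynomial_growth (H1 p)).
Hypotheses (H2C : forall p q, curve_continuous (H2 p q)).
Hypotheses (H2G : forall p q, polynomial_growth (H2 p q)).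
Local Notation Q := (P \x P')%E.

Let path (t : R) k (z : T * T') := sin t * W k z.1 + cos t * V k z.2.

Let W1 p : all_moments Q (fun z => W p z.1). Proof. exact: all_moments_fst. Qed.
Let V2 p : all_moments Q (fun z => V p z.2). Proof. exact: all_moments_snd. Qed.
Let G1 p q : all_moments Q (fun z => G p q z.1). Proof. exact: all_moments_fst. Qed.
Let path_m t k : all_moments Q (path t k). Proof. by rewrite /path; moments. Qed.

Let Hm t : all_moments Q (fun z => H ((path t)^~ z)).
Proof. by apply: polynomial_growth_moments => //; exact: diffble_scont HP. Qed.
Let H1m t p : all_moments Q (fun z => H1 p ((path t)^~ z)).
Proof. by apply: polynomial_growth_moments => //; exact: diffble_scont (H1P p). Qed.
Let H2m t p q : all_moments Q (fun z => H2 p q ((path t)^~ z)).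
Proof. by apply: polynomial_growth_moments => //; exact: curve_continuous_scont. Qed.

Let path_W t p : mean Q (fun z => W p z.1 * H1 p ((path t)^~ z)) =
  sin t * mean Q (fun z => \sum_q G p q z.1 * H2 q p ((path t)^~ z)).
Proof.
have lm y k : all_moments P (fun x => sin t * W k x + y k).
  by apply: all_momentsD; [exact: all_momentsZ|exact: all_moments_cst].
have h1 y : all_moments P (fun x => H1 p (fun k => sin t * W k x + y k)).
  apply: (polynomial_growth_moments (Z := fun k x => sin t * W k x + y k)) => //.
  exact: diffble_scont (H1P p).
have h2 y q : all_moments P (fun x => H2 q p (fun k => sin t * W k x + y k)).
  apply: (polynomial_growth_moments (Z := fun k x => sin t * W k x + y k)) => //.
  exact: curve_continuous_scont.
rewrite mean_fubini21; first last.
- by move=> y; have := h1 (fun k => cos t * V k y) => ?; moments.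
- by moments.
rewrite -meanZ; last by moments.
rewrite [RHS]mean_fubini21; first last.
- move=> y; have hq q := h2 (fun k => cos t * V k y) q.
  rewrite /path /=; apply: itgZ; moments.
- by moments.
congr (mean P' _); apply/funext => y /=.
have h2y q := h2 (fun k => cos t * V k y) q.
rewrite /path /= (stein_kernel_affine _ _ _ WG (H1P p))//.
rewrite meanZ; last by moments.
rewrite mean_sum; last by move=> q; moments.
rewrite mulr_sumr; apply: eq_bigr => q _; rewrite -meanZ; last by moments.
by congr (mean P _); apply/funext => x; ring.
Qed.

Let path_V t p : mean Q (fun z => V p z.2 * H1 p ((path t)^~ z)) =
  cos t * mean Q (fun z => \sum_q C p q * H2 q p ((path t)^~ z)).
Proof.
have pathE x y : (path t)^~ (x, y) = fun k => cos t * V k y + sin t * W k x.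
  by apply/funext => k; rewrite /path addrC.
have lm y k : all_moments P' (fun x => cos t * V k x + y k).
  by apply: all_momentsD; [exact: all_momentsZ|exact: all_moments_cst].
have h1 y : all_moments P' (fun x => H1 p (fun k => cos t * V k x + y k)).
  apply: (polynomial_growth_moments (Z := fun k x => cos t * V k x + y k)) => //.
  exact: diffble_scont (H1P p).
have h2 y q : all_moments P' (fun x => H2 q p (fun k => cos t * V k x + y k)).
  apply: (polynomial_growth_moments (Z := fun k x => cos t * V k x + y k)) => //.
  exact: curve_continuous_scont.
rewrite mean_fubini; first last.
- move=> x; under eq_fun do rewrite pathE /=.
  by have := h1 (fun k => sin t * W k x) => ?; moments.
- by moments.
rewrite -meanZ; last by moments.
rewrite [RHS]mean_fubini; first last.
- move=> x; have hq q := h2 (fun k => sin t * W k x) q.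
  by apply: itgZ; under eq_fun do rewrite pathE /=; moments.
- by moments.
congr (mean P _); apply/funext => x /=.
have h2y q := h2 (fun k => sin t * W k x) q.
under [X in mean _ X = _]eq_fun do rewrite pathE.
under [X in _ = mean _ X]eq_fun do rewrite pathE.
rewrite (stein_kernel_affine _ _ _ VC (H1P p))//.
rewrite meanZ; last by moments.
rewrite mean_sum; last by move=> q; moments.
rewrite mulr_sumr; apply: eq_bigr => q _; rewrite -meanZ; last by moments.
by congr (mean P' _); apply/funext => y; ring.
Qed.

(** D bounds the Hessian contraction at every point x, which separates the fluctuation of the kernel
    from the point where the Hessian is evaluated. The constant pi / 2 is the length of the path's
    parameter interval. *)
Theorem stein_kernel_comparison (D : T -> R) : itg P D ->
  (forall x w, `|\sum_p \sum_q (G p q w - C p q) * H2 q p x| <= D w) ->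
  `|mean P (fun w => H (W^~ w)) - mean P' (fun w => H (V^~ w))| <= pi / 2 * mean P D.
Proof.
move=> iD HD.
pose phi t := mean Q (fun z => H ((path t)^~ z)).
pose env (z : T * T') := 1 + \sum_k (`|W k z.1| + `|V k z.2|).
have envm : all_moments Q env by rewrite /env; moments.
have le_env (h : (K -> R) -> R) B k : 0 <= B -> (forall x, `|h x| <= B * (1 + \sum_i `|x i|) ^+ k) ->
    forall t z, `|h ((path t)^~ z)| <= B * env z ^+ k.
  move=> B0 hB t z; apply: (le_trans (hB _)); rewrite ler_wpM2l// lerXn2r//.
  - by rewrite nnegrE addr_ge0// sumr_ge0.
  - by rewrite nnegrE addr_ge0// sumr_ge0// => i _; rewrite addr_ge0.
  rewrite lerD2l ler_sum// => i _; rewrite (le_trans (ler_normD _ _))// !normrM.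
  by rewrite lerD// ler_piMl// ler_norml ?sin_geN1 ?sin_le1 ?cos_geN1 ?cos_le1.
have H1le b : exists h : T * T' -> R, all_moments Q h /\
    forall t p, `|H1 b ((path t)^~ p)| <= h p.
  have [B [l [B0 HB]]] := H1G b; exists (fun p => B * env p ^+ l); split; first by moments.
  exact: le_env.
have [E EP] := choice H1le.
have Em b : all_moments Q (E b) by case: (EP b).
pose dphi t := mean Q (fun z => \sum_p H1 p ((path t)^~ z) * (cos t * W p z.1 - sin t * V p z.2)).
have phiD (t : R) : is_derive t (1:R) phi (dphi t).
  apply: (@is_derive_mean _ _ _ Q (fun t z => H ((path t)^~ z))
    (fun t z => \sum_p H1 p ((path t)^~ z) * (cos t * W p z.1 - sin t * V p z.2))
    (fun z => \sum_p E p z * (`|W p z.1| + `|V p z.2|))).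
  - by moments.
  - by move=> u _; moments.
  - move=> u z _; apply: (HP (c := fun u => (path u)^~ z)) => k.
    by rewrite /path; apply: is_derive_eq; rewrite /GRing.scale /=; ring.
  - move=> u z _; rewrite (le_trans (ler_norm_sum _ _ _))// ler_sum// => p _.
    rewrite normrM ler_pM//; first exact: (EP p).2.
    rewrite (le_trans (ler_normB _ _))// !normrM.
    by rewrite lerD// ler_piMl// ler_norml ?sin_geN1 ?sin_le1 ?cos_geN1 ?cos_le1.
have dphiE t : dphi t = sin t * cos t *
    mean Q (fun z => \sum_p \sum_q (G p q z.1 - C p q) * H2 q p ((path t)^~ z)).
  rewrite /dphi (_ : (fun z => _) = (fun z => \sum_p (cos t * (W p z.1 * H1 p ((path t)^~ z)) -
    sin t * (V p z.2 * H1 p ((path t)^~ z))))); last first.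
    by apply/funext => z; apply: eq_bigr => p _; ring.
  rewrite !mean_sum; [|by move=> p; moments..].
  rewrite mulr_sumr; apply: eq_bigr => p _.
  rewrite meanB ?meanZ ?path_W ?path_V; [|by moments..].
  rewrite (_ : (fun z => \sum_q (G p q z.1 - C p q) * _) =
    (fun z => \sum_q G p q z.1 * H2 q p ((path t)^~ z) - \sum_q C p q * H2 q p ((path t)^~ z))); last first.
    by apply/funext => z; rewrite -sumrB; apply: eq_bigr => q _; ring.
  by rewrite meanB; [ring|moments..].
have dphi_le t : `|dphi t| <= mean P D.
  rewrite dphiE normrM -(mean_fst P' iD).
  (* The factor |sin t cos t| is simply bounded by 1, so a mean value argument replaces integration
     in t. *)
  apply: (@le_trans _ _ `|mean Q (fun z => \sum_p \sum_q (G p q z.1 - C p q) * H2 q p ((path t)^~ z))|).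
    rewrite ler_piMl// normrM.
    by rewrite mulr_ile1// ler_norml ?sin_geN1 ?sin_le1 ?cos_geN1 ?cos_le1.
  by apply: norm_mean_le; [moments|exact: itg_fst|move=> z; exact: HD].
have phi1 : phi (pi / 2) = mean P (fun w => H (W^~ w)).
  rewrite -(mean_fst P'); last first.
    by apply: all_moments_itg; apply: polynomial_growth_moments => //; exact: diffble_scont HP.
  congr (mean Q _); apply/funext => z; congr H; apply/funext => k.
  by rewrite /path sin_pihalf cos_pihalf mul1r mul0r addr0.
have phi0 : phi 0 = mean P' (fun w => H (V^~ w)).
  rewrite -(mean_snd P); last first.
    by apply: all_moments_itg; apply: polynomial_growth_moments => //; exact: diffble_scont HP.
  congr (mean Q _); apply/funext => z; congr H; apply/funext => k.
  by rewrite /path sin0 cos0 mul1r mul0r add0r.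
rewrite -phi1 -phi0.
have pi2 : 0 <= pi / 2 :> R by rewrite divr_ge0// pi_ge0.
have [c _ ->] := MVT_segment pi2 (fun x _ => phiD x)
  (continuous_subspaceT (fun x => is_derive_continuous (phiD x))).
by rewrite subr0 normrM mulrC (ger0_norm pi2) ler_wpM2l.
Qed.

End smart_path.

(** * The chain rule for C2 test functions *)

Section chain_rule.
Context {R : realType}.

(** Carathéodory's form of the derivative: the slope factor k only has to converge at t, which fits
    factors produced by mean value theorems. *)
Lemma is_derive_mul_increment (D k u : R -> R) (t k0 u' : R) :
  (forall s, D s = k s * (u s - u t)) -> k s @[s --> t] --> k0 ->
  is_derive t (1 : R) u u' -> is_derive t (1 : R) D (k0 * u').
Proof.
move=> DE kt ut.
have lim : h^-1 *: (D (h *: (1:R) + t) - D t) @[h --> (0:R)^'] --> k0 * u'.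
  rewrite (_ : (fun h => _) = (fun h => k (h *: 1 + t) * (h^-1 *: (u (h *: 1 + t) - u t)))); last first.
    by apply/funext => h; rewrite !DE subrr mulr0 subr0 /GRing.scale /=; ring.
  apply: cvgM.
    apply: (cvg_comp (fun h : R => h *: (1:R) + t) k) kt.
    rewrite (_ : (fun h : R => h *: (1:R) + t) = (fun h => h + t)); last first.
      by apply/funext => h; rewrite /GRing.scale /= mulr1.
    have c0 : (h : R) + t @[h --> (0:R)] --> 0 + t by apply: cvgD; [exact: cvg_id|exact: cvg_cst].
    by rewrite add0r in c0; apply: cvg_trans c0; apply: cvg_app; exact: cvg_within.
  have [du <-] := ut; exact: du.
apply: DeriveDef; first exact: cvgP lim.
exact: cvg_lim lim.
Qed.

Lemma MVT_between (f df : R -> R) (a b : R) : (forall x : R, is_derive x (1:R) f (df x)) ->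
  exists c, `|c - a| <= `|b - a| /\ f b - f a = df c * (b - a).
Proof.
move=> fd; have cf A : {within A, continuous f}.
  by apply: continuous_subspaceT => x; exact: is_derive_continuous (fd x).
have [ab|/ltW ba] := leP a b.
  have [c] := MVT_segment ab (fun x _ => fd x) (cf _).
  rewrite in_itv /= => /andP[ac cb] fE; exists c; split => //.
  by rewrite !ger0_norm ?subr_ge0//; lra.
have [c] := MVT_segment ba (fun x _ => fd x) (cf _).
rewrite in_itv /= => /andP[ac cb] fE; exists c; split.
  by rewrite !ler0_norm ?subr_le0//; lra.
lra.
Qed.

Variable I : finType.

Definition jointly_continuous (g : (I -> R) -> R) : Prop :=
  forall x (e : R), 0 < e -> exists2 dl : R, 0 < dl &
    forall y, (forall i, `|y i - x i| < dl) -> `|g y - g x| < e.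

Lemma jointly_curve_continuous (g : (I -> R) -> R) : jointly_continuous g -> curve_continuous g.
Proof.
move=> gC c t ct; apply/cvgrPdist_lt => e e0.
have [dl dl0 gd] := gC (c t) e e0.
have : \forall s \near t, forall i, `|c s i - c t i| < dl.
  apply: (@filter_forall R I (fun i s => `|c s i - c t i| < dl) (nbhs t) _) => i.
  have /cvgrPdist_lt/(_ _ dl0) := ct i.
  by apply: filterS => s; rewrite distrC.
by apply: filterS => s /gd; rewrite distrC.
Qed.

(* Coordinates are switched on one at a time; each switch costs a mean value. *)
Lemma diffble_of_partials (g : (I -> R) -> R) (dg : I -> (I -> R) -> R) :
  (forall x i (t : R), is_derive t (1:R) (fun s => g (upd x i s)) (dg i (upd x i t))) ->
  (forall i, jointly_continuous (dg i)) -> diffble g dg.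
Proof.
move=> gP dgC c c' t ct.
have cc i : {for t, continuous (c^~ i)} by exact: is_derive_continuous (ct i).
pose cl (l : seq I) (s : R) : I -> R := fun i => if i \in l then c s i else c t i.
have clt l : cl l t = c t by apply/funext => i; rewrite /cl if_same.
have main l : uniq l ->
    is_derive t (1:R) (fun s => g (cl l s)) (\sum_(i <- l) dg i (c t) * c' i).
  elim: l => [_|i l IH /andP[il ul]].
    by rewrite big_nil (_ : (fun s => _) = cst (g (c t))); [exact: is_derive_cst|apply/funext => s].
  have mvt s : exists xi, `|xi - c t i| <= `|c s i - c t i| /\
     g (cl (i :: l) s) - g (cl l s) = dg i (upd (cl l s) i xi) * (c s i - c t i).
    have [xi [xi1 xi2]] := MVT_between (c t i) (c s i) (gP (cl l s) i).
    exists xi; split => //; rewrite -xi2; congr (g _ - g _); apply/funext => j.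
      by rewrite /upd /cl inE; case: eqP => [->|].
    by rewrite /upd /cl; case: eqP => [->|//]; rewrite (negbTE il).
  have [xi xiP] := choice mvt.
  have IHl := IH ul.
  have Dd : is_derive t (1:R) (fun s => g (cl (i :: l) s) - g (cl l s)) (dg i (c t) * c' i).
    apply: (@is_derive_mul_increment _ (fun s => dg i (upd (cl l s) i (xi s))) (c^~ i)) => //.
      by move=> s; exact: (xiP s).2.
    apply/cvgrPdist_lt => e e0; have [dl dl0 gd] := dgC i (c t) e e0.
    have : \forall s \near t, forall j, `|c s j - c t j| < dl.
      apply: (@filter_forall R I (fun j s => `|c s j - c t j| < dl) (nbhs t) _) => j.
      have /cvgrPdist_lt/(_ _ dl0) := cc j.
      by apply: filterS => s; rewrite distrC.
    apply: filterS => s sd; rewrite distrC; apply: gd => j; rewrite /upd /cl.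
    case: eqP => [->|_]; first exact: le_lt_trans (xiP s).1 (sd i).
    by case: ifP => // _; rewrite subrr normr0.
  rewrite big_cons (_ : (fun s => _) =
    (fun s => (g (cl (i :: l) s) - g (cl l s)) + g (cl l s))); first exact: is_deriveD.
  by apply/funext => s; rewrite subrK.
have := main (enum I) (enum_uniq I); rewrite big_enum /=; congr is_derive.
by apply/funext => s; congr g; apply/funext => i; rewrite /cl mem_enum.
Qed.

(** Mean value theorem along the ray from the origin to x. Applied twice, it makes bounds on second
    derivatives control the gradient and the function. *)
Lemma diffble_polynomial_growth (g : (I -> R) -> R) (dg : I -> (I -> R) -> R) :
  diffble g dg -> (forall i, polynomial_growth (dg i)) -> polynomial_growth g.
Proof.
move=> gP dgG.
have [C /choice[k CP]] := choice dgG.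
apply: (@polynomial_growth_le _ _ _ (fun x => `|g (fun=> 0)| +
  \sum_i C i * (1 + \sum_j `|x j|) ^+ k i * `|x i|)).
  have cG i : polynomial_growth (fun x : I -> R => `|x i|).
    exact/polynomial_growth_norm/polynomial_growth_coord.
  apply: polynomial_growthD; first exact: polynomial_growth_cst.
  apply: polynomial_growth_sum => i; apply: polynomial_growthM => //.
  apply: polynomial_growthM; first exact: polynomial_growth_cst.
  apply: polynomial_growthX; apply: polynomial_growthD; first exact: polynomial_growth_cst.
  exact: polynomial_growth_sum.
move=> x; rewrite [leRHS]ger0_norm; last first.
  apply: addr_ge0 => //; apply: sumr_ge0 => i _; apply: mulr_ge0 => //.
  apply: mulr_ge0; first by case: (CP i).
  by apply: exprn_ge0; apply: addr_ge0 => //; exact: sumr_ge0.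
have ray (t : R) : is_derive t (1:R) (fun s => g (fun i => s * x i))
    (\sum_i dg i (fun j => t * x j) * x i).
  apply: (gP (fun s i => s * x i)) => i.
  by apply: is_derive_eq; rewrite /GRing.scale /=; ring.
have [c [c1 gE]] := MVT_between 0 1 ray.
have {}c1 : `|c| <= 1 by move: c1; rewrite !subr0 normr1.
have -> : g x = (g (fun i => 1 * x i) - g (fun i => 0 * x i)) + g (fun=> 0).
  rewrite (_ : (fun i => 1 * x i) = x); last by apply/funext => i; rewrite mul1r.
  by rewrite (_ : (fun i => 0 * x i) = (fun=> 0)) ?subrK//; apply/funext => i; rewrite mul0r.
rewrite gE subr0 mulr1 addrC (le_trans (ler_normD _ _))// lerD2l.
rewrite (le_trans (ler_norm_sum _ _ _))// ler_sum// => i _; rewrite normrM ler_wpM2r//.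
have [C0 dgC] := CP i; rewrite (le_trans (dgC _))// ler_wpM2l// lerXn2r//.
- by rewrite nnegrE addr_ge0// sumr_ge0.
- by rewrite nnegrE addr_ge0// sumr_ge0.
- by rewrite lerD2l ler_sum// => j _; rewrite normrM ler_piMl.
Qed.

End chain_rule.

Section row_functions.
Context {R : realType} {m : nat}.
Implicit Types (h : 'rV[R]_m -> R) (x : 'I_m -> R).

Definition on_coords h x : R := h (\row_p x p).

Lemma jointly_continuous_on_coords h : continuous h -> jointly_continuous (on_coords h).
Proof.
move=> ch x e e0.
have /cvgrPdist_lt/(_ _ e0)/nbhs_ballP[dl /= dl0 hd] := ch (\row_p x p).
exists dl => // y yx; rewrite distrC; apply: hd; split => // i j.
by rewrite !mxE /ball /= distrC.
Qed.

Lemma is_derive_on_coords h x (i : 'I_m) (t : R) :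
  (forall y, derivable h y (basis_vec R i)) ->
  is_derive t (1:R) (fun s => on_coords h (upd x i s)) (on_coords (partial1 h i) (upd x i t)).
Proof.
move=> dh.
have E (k : R) : \row_p upd x i (k *: (1:R) + t) p =
    k *: basis_vec R i + \row_p upd x i t p.
  apply/rowP => p; rewrite !mxE eqxx /= /upd /GRing.scale /= mulr1.
  by case: eqP => _ /=; rewrite ?mulr1 // mulr0 add0r.
have E' : (fun k : R => k^-1 *: (on_coords h (upd x i (k *: (1:R) + t)) - on_coords h (upd x i t))) =
   (fun k : R => k^-1 *: (h (k *: basis_vec R i + \row_p upd x i t p) - h (\row_p upd x i t p))).
  by apply/funext => k; rewrite /on_coords E.
apply: DeriveDef.
- by rewrite /derivable E'; exact: dh.
- by rewrite /derive E'.
Qed.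

Lemma diffble_on_coords h : (forall i y, derivable h y (basis_vec R i)) ->
  (forall i, continuous (partial1 h i)) ->
  diffble (on_coords h) (fun i => on_coords (partial1 h i)).
Proof.
move=> dh ch; apply: diffble_of_partials => [x i t|i].
- exact: is_derive_on_coords.
- exact: jointly_continuous_on_coords.
Qed.

Lemma hess_sup_le1 h : (hess_sup h <= 1)%E -> forall i j (y : 'rV[R]_m), `|partial2 h i j y| <= 1.
Proof.
move=> h1 i j y; rewrite -lee_fin; apply: le_trans h1; apply: ereal_sup_ubound.
by exists (i, j, y).
Qed.

(** Column j of the Hessian is its image of the j-th unit vector. *)
Lemma M2_le1 h : (M2 h <= 1)%E -> forall j (x : 'rV[R]_m), \sum_i partial2 h i j x ^+ 2 <= 1.
Proof.
move=> h1 j x.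
have A1 : (op_norm (hessian h x) <= 1)%E.
  by apply: le_trans h1; apply: ereal_sup_ubound; exists x.
have : ((euclidean_norm (hessian h x *m delta_mx j 0))%:E <= 1)%E.
  apply: le_trans A1; apply: ereal_sup_ubound; exists (delta_mx j 0) => //=.
  rewrite /euclidean_norm (bigD1 j)//= mxE !eqxx expr1n big1 ?addr0 ?sqrtr1//.
  by move=> i /negbTE ij; rewrite mxE ij expr0n.
rewrite lee_fin /euclidean_norm -{1}sqrtr1 ler_sqrt//.
by under eq_bigr do rewrite -colE !mxE.
Qed.

End row_functions.

(** * The kernel of the Wishart matrix *)

(** Common to both distances, which differ only in the choice of D: the entrywise bound serves to
    give h and its derivatives polynomial growth. *)
Lemma expectation_gap_le d (T : measurableType d) d' (T' : measurableType d') (R : realType)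
    (P : probability T R) (P' : probability T' R) m (X : T -> 'rV[R]_m) (Y : T' -> 'rV[R]_m)
    (G : 'I_m -> 'I_m -> T -> R) (C : 'I_m -> 'I_m -> R) (h : 'rV[R]_m -> R) (D : T -> R) :
  (forall p, all_moments P (fun w => X w 0 p)) -> (forall p q, all_moments P (G p q)) ->
  (forall p, all_moments P' (fun w => Y w 0 p)) ->
  stein_kernel P (fun p w => X w 0 p) G ->
  stein_kernel P' (fun p w => Y w 0 p) (fun p q _ => C p q) ->
  C2 h -> (forall i j (y : 'rV[R]_m), `|partial2 h i j y| <= 1) -> itg P D ->
  (forall y w, `|\sum_p \sum_q (G p q w - C p q) * partial2 h q p y| <= D w) ->
  (expectation_gap P P' X Y h <= (pi / 2 * mean P D)%:E)%E.
Proof.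
move=> Xm Gm Ym XG YC [ch dh d2h] h1 iD HD.
pose H := on_coords h; pose H1 p := on_coords (partial1 h p).
pose H2 q p := on_coords (partial2 h q p).
have HP : diffble H H1 by apply: diffble_on_coords => i; case: (dh i).
have H1P p : diffble (H1 p) (H2^~ p) by apply: diffble_on_coords => i; case: (d2h i p).
have H2C q p : curve_continuous (H2 q p).
  by apply: jointly_curve_continuous; apply: jointly_continuous_on_coords; case: (d2h q p).
have H2G q p : polynomial_growth (H2 q p).
  apply: (polynomial_growth_le (h := fun=> 1)) => [|x]; first exact: polynomial_growth_cst.
  by rewrite normr1; exact: h1.
have H1G p : polynomial_growth (H1 p) by apply: diffble_polynomial_growth (H1P p) _ => q.
have HG : polynomial_growth H by apply: diffble_polynomial_growth HP _.
have Hm : all_moments P (fun w => h (X w)).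
  rewrite (_ : (fun w => _) = (fun w => H (fun p => X w 0 p))).
    apply: (polynomial_growth_moments (Z := fun p w => X w 0 p)) => //.
    exact: diffble_scont HP.
  by apply/funext => w; congr h; apply/rowP => p; rewrite mxE.
have Hm' : all_moments P' (fun w => h (Y w)).
  rewrite (_ : (fun w => _) = (fun w => H (fun p => Y w 0 p))).
    apply: (polynomial_growth_moments (Z := fun p w => Y w 0 p)) => //.
    exact: diffble_scont HP.
  by apply/funext => w; congr h; apply/rowP => p; rewrite mxE.
rewrite /expectation_gap !unlock -!EFin_mean; [|exact: all_moments_itg..].
rewrite -EFinB /= lee_fin.
have := stein_kernel_comparison Xm Gm Ym XG YC HP HG H1P H1G H2C H2G iD.
have -> : (fun w => H (fun p => X w 0 p)) = (fun w => h (X w)).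
  by apply/funext => w; congr h; apply/rowP => p; rewrite mxE.
have -> : (fun w => H (fun p => Y w 0 p)) = (fun w => h (Y w)).
  by apply/funext => w; congr h; apply/rowP => p; rewrite mxE.
by apply => x w; exact: HD.
Qed.

Lemma gaussian_vector_comp d (T : measurableType d) (R : realType) (P : probability T R)
    (I : eqType) (Z : I -> T -> R) (J : finType) (e : J -> I) : injective e ->
  centered_gaussian P Z -> gaussian_vector P (fun j => Z (e j)).
Proof.
move=> ei [gZ Z0]; split=> [u|j].
  (* Coefficients in [jointly_gaussian] are attached to the original index, so u is carried along
     the injection e and extended by 0. *)
  pose c i := if [pick j | e j == i] is Some j then u j else 0.
  have ce j : c (e j) = u j.
    rewrite /c; case: pickP => [k /eqP/ei -> //|/(_ j)].
    by rewrite eqxx.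
  have := gZ (map e (enum J)) c; congr gaussian; apply/funext => w.
  by rewrite big_map big_enum /=; apply: eq_bigr => j _; rewrite ce.
have := Z0 (e j); rewrite unlock /mean /Rintegral => ->.
by [].
Qed.

Section wishart_kernel.
Context d0 (T : measurableType d0) (R : realType) (P : probability T R).
Variables (r s : int -> R) (X : nat -> nat -> T -> R) (n d : nat).
Hypothesis s0 : s 0 = 1.


Let Z (a : 'I_n * 'I_d) : T -> R := X a.1 a.2.
Hypothesis gZ : gaussian_vector P Z.
Hypothesis ZC : forall a b, mean P (fun w => Z a w * Z b w) =
  r ((a.1 : nat)%:Z - (b.1 : nat)%:Z) * s ((a.2 : nat)%:Z - (b.2 : nat)%:Z).

Let Zm a : all_moments P (Z a). Proof. exact: gaussian_vector_moments gZ a. Qed.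

Definition rho (i j : 'I_n) : R := r ((i : nat)%:Z - (j : nat)%:Z).
Definition sig (k l : 'I_d) : R := s ((k : nat)%:Z - (l : nat)%:Z).

Definition kernel_form (j j' : 'I_n) (w : T) : R :=
  d%:R^-1 * \sum_k \sum_l sig k l * (Z (j, k) w * Z (j', l) w).

Lemma kernel_form_moments j j' : all_moments P (kernel_form j j').
Proof. by rewrite /kernel_form; moments. Qed.

Lemma wishart_moments i j : all_moments P (fun w => wishart r X n d w i j).
Proof.
under eq_fun do rewrite /wishart mxE.
by move: (Zm) => Zm'; apply: all_momentsZ; apply: all_moments_sum => k;
  apply: all_momentsB; [apply: all_momentsM; [exact: (Zm' (i, k))|exact: (Zm' (j, k))]|
  exact: all_moments_cst].
Qed.

(** Integration by parts is done in the first factor of X_ik X_jk only. This explains the asymmetry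
    of the kernel: r sees the first index of p and B the second one. *)
Lemma wishart_stein_kernel (J : finType) (e : J -> 'I_n * 'I_n) :
  stein_kernel P (fun p w => wishart r X n d w (e p).1 (e p).2)
    (fun p q w => rho (e p).1 (e q).1 * kernel_form (e p).2 (e q).2 w +
                  rho (e p).1 (e q).2 * kernel_form (e p).2 (e q).1 w).
Proof.
move=> p f df fP fG dfC dfG.
pose c : R := (Num.sqrt d%:R)^-1.
pose V q (x : 'I_n * 'I_d -> R) : R :=
  c * \sum_k (x ((e q).1, k) * x ((e q).2, k) + - rho (e q).1 (e q).2).
pose dV q (a : 'I_n * 'I_d) (x : 'I_n * 'I_d -> R) : R :=
  c * \sum_k ((a == ((e q).1, k))%:R * x ((e q).2, k) + x ((e q).1, k) * (a == ((e q).2, k))%:R).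
have VE q w : wishart r X n d w (e q).1 (e q).2 = V q (Z^~ w) by rewrite mxE.
have VP q : diffble (V q) (dV q).
  apply: diffbleZ; apply: diffble_sum => k.
  apply: diffble_ext (diffbleD (diffbleM (diffble_coord _) (diffble_coord _)) (diffble_cst _)) _ => a x.
  by rewrite addr0.
have xG a : polynomial_growth (fun x : 'I_n * 'I_d -> R => x a) by exact: polynomial_growth_coord.
have xC a : curve_continuous (fun x : 'I_n * 'I_d -> R => x a) by exact: curve_continuous_coord.
have cG a : polynomial_growth (fun x : 'I_n * 'I_d -> R => a) by exact: polynomial_growth_cst.
have cC a : curve_continuous (fun x : 'I_n * 'I_d -> R => a) by exact: curve_continuous_cst.
have VG q : polynomial_growth (V q).
  apply: polynomial_growthM => //; apply: polynomial_growth_sum => k.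
  by apply: polynomial_growthD => //; exact: polynomial_growthM.
have VC q : curve_continuous (V q).
  apply: curve_continuousM => //; apply: curve_continuous_sum => k.
  by apply: curve_continuousD => //; exact: curve_continuousM.
have dVG q a : polynomial_growth (dV q a).
  apply: polynomial_growthM => //; apply: polynomial_growth_sum => k.
  by apply: polynomial_growthD => //; exact: polynomial_growthM.
have dVC q a : curve_continuous (dV q a).
  apply: curve_continuousM => //; apply: curve_continuous_sum => k.
  by apply: curve_continuousD => //; exact: curve_continuousM.
pose F x := f (V^~ x); pose dF a x := \sum_q df q (V^~ x) * dV q a x.
have FP : diffble F dF by exact: diffble_comp.
have FG : polynomial_growth F by exact: polynomial_growth_comp fG VG.
have dfVG q : polynomial_growth (fun x => df q (V^~ x)) by exact: polynomial_growth_comp (dfG q) VG.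
have dfVC q : curve_continuous (fun x => df q (V^~ x)) by exact: curve_continuous_comp (dfC q) VC.
have dFG a : polynomial_growth (dF a).
  by apply: polynomial_growth_sum => q; exact: polynomial_growthM.
have dFC a : curve_continuous (dF a).
  by apply: curve_continuous_sum => q; exact: curve_continuousM.
have FS : scont F by exact: diffble_scont FP.
have Fm : all_moments P (fun w => F (Z^~ w)) by exact: polynomial_growth_moments.
have dFm a : all_moments P (fun w => dF a (Z^~ w)).
  by apply: polynomial_growth_moments => //; exact: curve_continuous_scont.
have dfm q : all_moments P (fun w => df q (V^~ (Z^~ w))).
  apply: (polynomial_growth_moments (Z := Z) (g := fun x => df q (V^~ x))) => //.
  exact: curve_continuous_scont.
have dVm q a : all_moments P (fun w => dV q a (Z^~ w)).
  by apply: polynomial_growth_moments => //; exact: curve_continuous_scont.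
set i := (e p).1; set j := (e p).2.
(* The term where the derivative hits X_jk is r(i - j) s(0) E[F], exactly the centering of the
   Wishart entries. *)
have ibp k : mean P (fun w => Z (i, k) w * (Z (j, k) w * F (Z^~ w))) =
    rho i j * mean P (fun w => F (Z^~ w)) +
    \sum_a rho i a.1 * sig k a.2 * mean P (fun w => Z (j, k) w * dF a (Z^~ w)).
  rewrite (gaussian_ibp gZ (i, k) (diffbleM (diffble_coord (j, k)) FP)).
  - have -> : rho i j * mean P (fun w => F (Z^~ w)) =
        \sum_a rho i a.1 * sig k a.2 * mean P (fun w => (a == (j, k))%:R * F (Z^~ w)).
      rewrite (bigD1 (j, k))//= eqxx big1 ?addr0.
        rewrite /sig subrr s0 mulr1; congr (_ * mean P _).
        by apply/funext => w; rewrite mul1r.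
      move=> a /negbTE ->; under eq_fun do rewrite mul0r.
      by rewrite mean_cst mulr0.
    rewrite -big_split /=; apply: eq_bigr => a _; rewrite -mulrDr ZC; congr (_ * _).
    by rewrite -meanD//; moments.
  - exact: polynomial_growthM.
  - move=> a; apply: scontD.
      by apply: scontM => //; exact: curve_continuous_scont.
    by apply: scontM; exact: curve_continuous_scont.
  - by move=> a; apply: polynomial_growthD; exact: polynomial_growthM.
have -> : mean P (fun w => wishart r X n d w i j * f (fun q => wishart r X n d w (e q).1 (e q).2)) =
    c * \sum_k \sum_a rho i a.1 * sig k a.2 * mean P (fun w => Z (j, k) w * dF a (Z^~ w)).
  rewrite (_ : (fun w => _) = (fun w => \sum_k c * (Z (i, k) w * (Z (j, k) w * F (Z^~ w)) -
      rho i j * F (Z^~ w)))); last first.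
    apply/funext => w; rewrite VE -mulr_sumr /V -/i -/j -mulrA mulr_suml.
    congr (_ * _); apply: eq_bigr => k _.
    by rewrite /F (_ : (fun q => _) = V^~ (Z^~ w)); [ring|apply/funext => q; rewrite VE].
  rewrite mean_sum; last by move=> k; moments.
  rewrite mulr_sumr; apply: eq_bigr => k _; rewrite meanZ; last by moments.
  by rewrite meanB ?ibp ?meanZ; [rewrite addrC addKr|moments..].
transitivity (mean P (fun w => \sum_k \sum_a (c * (rho i a.1 * sig k a.2)) *
    (Z (j, k) w * dF a (Z^~ w)))).
  rewrite mean_sum; last by move=> k; moments.
  rewrite mulr_sumr; apply: eq_bigr => k _.
  rewrite mean_sum; last by move=> a; moments.
  by rewrite mulr_sumr; apply: eq_bigr => a _; rewrite meanZ ?mulrA//; moments.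
rewrite -mean_sum; last first.
  move=> q; apply: all_moments_itg; apply: all_momentsM.
    by apply: all_momentsD; apply: all_momentsZ; exact: kernel_form_moments.
  by under eq_fun do under eq_fun do rewrite VE; exact: dfm.
congr (mean P _); apply/funext => w.
(* One factor 1/sqrt(d) comes from W_p and the other from the derivative of W_q. *)
have cc : c * c = d%:R^-1.
  by rewrite /c -invfM -expr2 sqr_sqrtr.
transitivity (\sum_q df q (V^~ (Z^~ w)) * (c * \sum_k Z (j, k) w *
    \sum_a rho i a.1 * sig k a.2 * dV q a (Z^~ w))).
  rewrite /dF; under eq_bigr => k _.
    under eq_bigr => a _ do rewrite mulr_sumr mulr_sumr.
    rewrite exchange_big /=; over.
  rewrite exchange_big /=; apply: eq_bigr => q _.
  rewrite mulr_sumr mulr_sumr; apply: eq_bigr => k _.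
  rewrite mulr_sumr mulr_sumr mulr_sumr; apply: eq_bigr => a _; ring.
apply: eq_bigr => q _; rewrite mulrC (_ : (fun q => _) = V^~ (Z^~ w)); last first.
  by apply/funext => k; rewrite VE.
congr (_ * _).
have sumV k : \sum_a rho i a.1 * sig k a.2 * dV q a (Z^~ w) =
   c * \sum_l (rho i (e q).1 * (sig k l * Z ((e q).2, l) w) + rho i (e q).2 * (sig k l * Z ((e q).1, l) w)).
  rewrite /dV; under eq_bigr do rewrite mulrCA mulr_sumr.
  rewrite -mulr_sumr exchange_big /=; congr (_ * _); apply: eq_bigr => l _.
  under eq_bigr do rewrite mulrDr.
  rewrite big_split /=; congr (_ + _).
    rewrite (bigD1 ((e q).1, l))//= eqxx big1 ?addr0; first by rewrite mul1r mulrA.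
    by move=> a /negbTE ->; rewrite mul0r mulr0.
  rewrite (bigD1 ((e q).2, l))//= eqxx big1 ?addr0; first by rewrite mulr1 mulrA.
  by move=> a /negbTE ->; rewrite mulr0 mulr0.
under eq_bigr do rewrite sumV mulrCA.
rewrite -mulr_sumr mulrA cc /kernel_form [X in _ = X + _]mulrCA [X in _ = _ + X]mulrCA -mulrDr.
congr (_ * _); rewrite !mulr_sumr -big_split /=; apply: eq_bigr => k _.
rewrite !mulr_sumr -big_split /=; apply: eq_bigr => l _; ring.
Qed.

End wishart_kernel.

(** * Fluctuations of the kernel *)

Section finite_sums.
Context {R : realType}.

Lemma ler_sum_inj (J L : finType) (f : J -> L) (F : L -> R) : injective f ->
  (forall l, 0 <= F l) -> \sum_j F (f j) <= \sum_l F l.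
Proof.
move=> fi F0; rewrite (bigID (mem (f @: [set: J])%SET))/=.
rewrite big_imset /=; last by move=> ? ? _ _; exact: fi.
rewrite [X in X + _](eq_bigl xpredT) => [|j]; first by rewrite lerDl sumr_ge0.
by rewrite inE.
Qed.

(** Lagrange's identity. *)
Lemma cauchy_schwarz_sum (J : finType) (u v : J -> R) :
  (\sum_j u j * v j) ^+ 2 <= (\sum_j u j ^+ 2) * (\sum_j v j ^+ 2).
Proof.
have : 0 <= \sum_i \sum_j (u i * v j - u j * v i) ^+ 2.
  by apply: sumr_ge0 => i _; apply: sumr_ge0 => j _; exact: sqr_ge0.
rewrite (_ : \sum_i _ = 2 * ((\sum_j u j ^+ 2) * (\sum_j v j ^+ 2)) - 2 * (\sum_j u j * v j) ^+ 2).
  by rewrite subr_ge0 ler_pM2l.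
transitivity (\sum_i \sum_j (u i ^+ 2 * v j ^+ 2 + v i ^+ 2 * u j ^+ 2 -
   2 * ((u i * v i) * (u j * v j)))).
  by apply: eq_bigr => i _; apply: eq_bigr => j _; ring.
under eq_bigr do rewrite sumrB big_split /= -!mulr_sumr.
rewrite sumrB big_split /= -!mulr_suml -mulr_sumr -mulr_suml; ring.
Qed.

(* Young's inequality [|a * a|_2 <= |a|_{4/3}^2] for the truncated convolution,
   with [b = a^(1/3)]. *)
Lemma young_sum (J : finType) (b : J -> J -> R) (S : R) :
  (forall k l, 0 <= b k l) -> (forall k l, b k l = b l k) ->
  (forall k, \sum_l b k l ^+ 4 <= S) ->
  \sum_k \sum_m (\sum_l b k l ^+ 3 * b l m ^+ 3) ^+ 2 <= #|J|%:R * S ^+ 3.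
Proof.
move=> b0 bC bS.
have amgm (x y : R) : x * y <= (x ^+ 2 + y ^+ 2) / 2.
  by have := sqr_ge0 (x - y); nra.
have step k m : (\sum_l b k l ^+ 3 * b l m ^+ 3) ^+ 2 <= S * \sum_l b k l ^+ 4 * b l m ^+ 4.
  (* This split makes Cauchy-Schwarz produce only fourth powers: the squared first factor is b^4
     b^4, and the squared second one is at most the average of two fourth powers, whose sum over l
     is at most S. *)
  rewrite (_ : \sum_l _ = \sum_l (b k l ^+ 2 * b l m ^+ 2) * (b k l * b l m)); last first.
    by apply: eq_bigr => l _; ring.
  apply: (le_trans (cauchy_schwarz_sum _ _)).
  rewrite mulrC (_ : \sum_l (_ * _ ^+ 2) ^+ 2 = \sum_l b k l ^+ 4 * b l m ^+ 4); last first.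
    by apply: eq_bigr => l _; ring.
  rewrite ler_wpM2r//; first by apply: sumr_ge0 => l _; apply: mulr_ge0; exact: exprn_ge0.
  apply: (@le_trans _ _ (\sum_l (b k l ^+ 4 + b m l ^+ 4) / 2)).
    apply: ler_sum => l _; rewrite (bC m l) exprMn.
    by apply: (le_trans (amgm _ _)); rewrite -!exprM.
  rewrite -mulr_suml big_split /= ler_pdivrMr//.
  by have := bS k; have := bS m; lra.
have S0 (k : J) : 0 <= S.
  by apply: le_trans (bS k); apply: sumr_ge0 => l _; exact: exprn_ge0.
apply: (@le_trans _ _ (\sum_(k : J) S ^+ 3)); last by rewrite sumr_const mulr_natl.
apply: ler_sum => k _.
apply: (@le_trans _ _ (\sum_m S * \sum_l b k l ^+ 4 * b l m ^+ 4)).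
  by apply: ler_sum => m _; exact: step.
rewrite -mulr_sumr exchange_big /= exprS ler_wpM2l ?(S0 k)//.
apply: (@le_trans _ _ (\sum_l b k l ^+ 4 * S)).
  by apply: ler_sum => l _; rewrite -mulr_sumr ler_wpM2l ?exprn_ge0.
by rewrite -mulr_suml expr2 ler_wpM2r ?(S0 k).
Qed.

Lemma window_row_sum (s : int -> R) (d : nat) (k : 'I_d) (p : R) :
  \sum_(l < d) `|s ((k : nat)%:Z - (l : nat)%:Z)| `^ p <= window_sum p s d.
Proof.
have lt_node (l : 'I_d) : (k + d - l < d.*2.+1)%N.
  rewrite ltnS -addnn (leq_trans (leq_subr _ _))// leq_add2r; exact: ltnW.
(* In the window the integer k - l sits at position k - l + d; the natural subtraction is not
   truncated because l < d. *)
pose f (l : 'I_d) : 'I_d.*2.+1 := Ordinal (lt_node l).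
have fi : injective f.
  move=> l l' [/eqP]; rewrite eqn_sub2lE ?(leq_trans (ltnW (ltn_ord _)) (leq_addl _ _))//.
  by move=> /eqP h; exact: val_inj.
have := ler_sum_inj fi (F := fun j : 'I_d.*2.+1 => `|s ((j : nat)%:Z - d%:Z)| `^ p) (fun=> powR_ge0 _ _).
apply: le_trans; rewrite le_eqVlt; apply/orP; left; apply/eqP.
apply: eq_bigr => l _; congr (`|s _| `^ p).
rewrite /= -subzn ?(leq_trans (ltnW (ltn_ord _)) (leq_addl _ _))// PoszD.
lia.
Qed.

End finite_sums.

Lemma correlation_le1 (R : realType) (r : int -> R) : correlation_function r -> r 0 = 1 ->
  forall k, `|r k| <= 1.
Proof.
move=> [rN rP] r0 k.
(* Positive semidefiniteness at the points k and 0 with weights e and 1, for e = 1 and e = -1. *)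
have h (e : R) : e ^+ 2 = 1 -> 0 <= 2 + 2 * e * r k.
  move=> e2; have := rP 2%N (fun a => if a == ord0 then k else 0) (fun a => if a == ord0 then e else 1).
  rewrite !big_ord_recl !big_ord0 /= !subrr !subr0 !sub0r rN r0.
  by rewrite !addr0 !mulr1 mul1r -expr2 e2; lra.
have := h 1 (expr1n _ _); have := h (-1) (_ : (-1) ^+ 2 = 1); rewrite sqrrN expr1n => /(_ erefl).
rewrite ler_norml; lra.
Qed.

Section kernel_variance.
Context dd (T : measurableType dd) (R : realType) (P : probability T R).
Variables (r s : int -> R) (X : nat -> nat -> T -> R) (n d : nat).
Hypothesis d0 : (0 < d)%N.
Hypothesis s0 : s 0 = 1.
Hypothesis sN : forall k, s (- k) = s k.
Hypothesis r1 : forall k, `|r k| <= 1.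
Let Z (a : 'I_n * 'I_d) : T -> R := X a.1 a.2.
Hypothesis gZ : gaussian_vector P Z.
Hypothesis ZC : forall a b, mean P (fun w => Z a w * Z b w) =
  r ((a.1 : nat)%:Z - (b.1 : nat)%:Z) * s ((a.2 : nat)%:Z - (b.2 : nat)%:Z).

Let Zm a : all_moments P (Z a). Proof. exact: gaussian_vector_moments gZ a. Qed.
Local Notation B := (@kernel_form _ T R s X n d).
Local Notation S := (window_sum (4 / 3) s d).

Let sigC (k l : 'I_d) : sig s k l = sig s l k.
Proof. by rewrite /sig -sN opprB. Qed.

Let cycle_sum_le : \sum_(k : 'I_d) \sum_(m : 'I_d) (\sum_l `|sig s k l| * `|sig s l m|) ^+ 2 <= d%:R * S ^+ 3.
Proof.
(* Cube roots turn |s| into b^3 and |s|^(4/3) into b^4. *)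
pose b (k l : 'I_d) : R := `|sig s k l| `^ (1 / 3).
have bX (m : nat) k l : b k l ^+ m = `|sig s k l| `^ (m%:R / 3).
  by rewrite -powR_mulrn ?powR_ge0// -powRrM; congr (_ `^ _); lra.
have b3 k l : b k l ^+ 3 = `|sig s k l| by rewrite bX divff// powRr1.
rewrite -[in d%:R](card_ord d); have := @young_sum R _ b S.
under eq_bigr do under eq_bigr do under eq_bigr do rewrite !b3.
apply => [k l|k l|k]; first exact: powR_ge0.
  by rewrite /b sigC.
by under eq_bigr do rewrite bX; exact: window_row_sum.
Qed.

Lemma window_sum_gt0 : 0 < S.
Proof.
apply: lt_le_trans (window_row_sum s (Ordinal d0) (4 / 3)).
rewrite (bigD1 (Ordinal d0))//= subrr s0 normr1 powR1.
by apply: ltr_wpDr => //; apply: sumr_ge0 => l _; exact: powR_ge0.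
Qed.

Lemma kernel_form_variance j j' :
  mean P (fun w => (B j j' w - mean P (B j j')) ^+ 2) <= 2 * S ^+ 3 / d%:R.
Proof.
have Bm : all_moments P (B j j') by exact: kernel_form_moments.
pose y (t : 'I_d * 'I_d) w := Z (j, t.1) w * Z (j', t.2) w.
have ym t : all_moments P (y t) by rewrite /y; moments.
pose g (t : 'I_d * 'I_d) := sig s t.1 t.2.
have BE : B j j' = fun w => d%:R^-1 * \sum_t g t * y t w.
  by apply/funext => w; rewrite /kernel_form pair_big.
have mB : mean P (B j j') = d%:R^-1 * \sum_t g t * mean P (y t).
  rewrite BE meanZ ?mean_sum; [|by move=> t; moments|by moments].
  by congr (_ * _); apply: eq_bigr => t _; rewrite meanZ//; moments.
have varE : mean P (fun w => (B j j' w - mean P (B j j')) ^+ 2) =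
   d%:R^-1 ^+ 2 * \sum_t \sum_t' g t * g t' *
     (mean P (fun w => y t w * y t' w) - mean P (y t) * mean P (y t')).
  rewrite (_ : (fun w => _) = (fun w => d%:R^-1 ^+ 2 * \sum_t \sum_t' g t * g t' *
     ((y t w - mean P (y t)) * (y t' w - mean P (y t'))))); last first.
    apply/funext => w; rewrite mB BE -mulrBr exprMn -sumrB; congr (_ * _).
    rewrite expr2 mulr_suml; apply: eq_bigr => t _; rewrite mulr_sumr.
    by apply: eq_bigr => t' _; ring.
  have ycm t : all_moments P (fun w => y t w - mean P (y t)) by moments.
  rewrite meanZ; last by moments.
  congr (_ * _); rewrite mean_sum; last by move=> t; moments.
  apply: eq_bigr => t _; rewrite mean_sum; last by move=> t'; moments.
  apply: eq_bigr => t' _; rewrite meanZ; last by moments.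
  congr (_ * _).
  rewrite (_ : (fun w => _) = (fun w => y t w * y t' w - mean P (y t') * y t w -
     (mean P (y t) * (y t' w - mean P (y t'))))); last by apply/funext => w; ring.
  rewrite meanB ?meanB ?meanZ; try by moments.
  rewrite meanB ?mean_cst; [ring|by moments|exact: itg_cst].
(* Of the three Wick pairings, the one inside t and inside t' is cancelled by the product of the
   means. *)
have wick t t' : mean P (fun w => y t w * y t' w) - mean P (y t) * mean P (y t') =
   sig s t.1 t'.1 * sig s t.2 t'.2 * (r 0) ^+ 2 +
   rho r j j' * rho r j' j * (sig s t.1 t'.2 * sig s t.2 t'.1).
  rewrite /y (_ : (fun w => _ * _ * (_ * _)) = (fun w => Z (j, t.1) w * (Z (j', t.2) w *
     (Z (j, t'.1) w * Z (j', t'.2) w)))); last by apply/funext => w; ring.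
  rewrite (gaussian_wick4 _ _ _ _ gZ) !ZC /= /rho /sig !subrr; ring.
have term_le t t' : g t * g t' *
     (mean P (fun w => y t w * y t' w) - mean P (y t) * mean P (y t')) <=
   `|g t| * `|g t'| * (`|sig s t.1 t'.1| * `|sig s t.2 t'.2|) +
   `|g t| * `|g t'| * (`|sig s t.1 t'.2| * `|sig s t.2 t'.1|).
  rewrite wick (le_trans (ler_norm _))// normrM normrM -mulrDr ler_wpM2l ?mulr_ge0//.
  rewrite (le_trans (ler_normD _ _))// lerD// !normrM.
    by rewrite ler_piMr ?mulr_ge0// mulr_ile1.
  by rewrite ler_piMl ?mulr_ge0// mulr_ile1 ?r1 //; exact: r1.
(* With t = (k, l) and t' = (k', l') the four factors form the cycle k, l, l', k'. Fixing the
   opposite vertices k and l' makes the two remaining sums equal, hence a square. *)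
have cyc1 : \sum_t \sum_t' `|g t| * `|g t'| * (`|sig s t.1 t'.1| * `|sig s t.2 t'.2|) =
   \sum_(k : 'I_d) \sum_(m : 'I_d) (\sum_l `|sig s k l| * `|sig s l m|) ^+ 2.
  under eq_bigr => t _ do rewrite -(pair_big xpredT xpredT (fun k' l' =>
     `|g t| * `|sig s k' l'| * (`|sig s t.1 k'| * `|sig s t.2 l'|))) /=.
  rewrite -(pair_big xpredT xpredT (fun k l => \sum_k' \sum_l'
     `|sig s k l| * `|sig s k' l'| * (`|sig s k k'| * `|sig s l l'|))) /=.
  apply: eq_bigr => k _.
  under eq_bigr do rewrite exchange_big /=.
  rewrite exchange_big /=; apply: eq_bigr => l' _.
  rewrite expr2 mulr_suml; apply: eq_bigr => l _; rewrite mulr_sumr.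
  by apply: eq_bigr => k' _; ring.
(* Here the cycle is k, l, k', l', and the opposite vertices are k and k'. *)
have cyc2 : \sum_t \sum_t' `|g t| * `|g t'| * (`|sig s t.1 t'.2| * `|sig s t.2 t'.1|) =
   \sum_(k : 'I_d) \sum_(m : 'I_d) (\sum_l `|sig s k l| * `|sig s l m|) ^+ 2.
  under eq_bigr => t _ do rewrite -(pair_big xpredT xpredT (fun k' l' =>
     `|g t| * `|sig s k' l'| * (`|sig s t.1 l'| * `|sig s t.2 k'|))) /=.
  rewrite -(pair_big xpredT xpredT (fun k l => \sum_k' \sum_l'
     `|sig s k l| * `|sig s k' l'| * (`|sig s k l'| * `|sig s l k'|))) /=.
  apply: eq_bigr => k _.
  rewrite exchange_big /=; apply: eq_bigr => k' _.
  rewrite expr2 mulr_suml; apply: eq_bigr => l _; rewrite mulr_sumr.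
  by apply: eq_bigr => l' _; rewrite (sigC l' k'); ring.
rewrite varE.
have dgt0 : 0 < d%:R :> R by rewrite ltr0n.
apply: (@le_trans _ _ (d%:R^-1 ^+ 2 * (2 * (d%:R * S ^+ 3)))).
  rewrite ler_wpM2l ?sqr_ge0//.
  apply: (@le_trans _ _ (\sum_t \sum_t' (`|g t| * `|g t'| * (`|sig s t.1 t'.1| * `|sig s t.2 t'.2|) +
   `|g t| * `|g t'| * (`|sig s t.1 t'.2| * `|sig s t.2 t'.1|)))).
    by apply: ler_sum => t _; apply: ler_sum => t' _; exact: term_le.
  under eq_bigr do rewrite big_split /=.
  by rewrite big_split /= cyc1 cyc2; have := cycle_sum_le; lra.
by rewrite le_eqVlt; apply/orP; left; apply/eqP; field; rewrite gt_eqF.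
Qed.

(** From second moment to first moment by |A| <= A^2 / (2v) + v / 2, which is (|A| - v)^2 >= 0. *)
Lemma kernel_form_mean_dev (v : R) j j' : 0 < v -> 2 * S ^+ 3 / d%:R <= v ^+ 2 ->
  mean P (fun w => `|B j j' w - mean P (B j j')|) <= v.
Proof.
move=> v0 Sv.
have Bm : all_moments P (B j j') by exact: kernel_form_moments.
have := kernel_form_variance j j'; move: (mean P (B j j')) => b varB.
have Ac : all_moments P (fun w => B j j' w - b) by moments.
apply: (@le_trans _ _ (mean P (fun w => (2 * v)^-1 * (B j j' w - b) ^+ 2 + v / 2))).
  apply: le_mean => [||w]; try by moments.
  set A := B j j' w - _; rewrite -[A ^+ 2]real_normK ?num_real//.
  have : 0 <= (`|A| - v) ^+ 2 / (2 * v) by rewrite divr_ge0 ?sqr_ge0// mulr_ge0// ltW.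
  have -> : (`|A| - v) ^+ 2 / (2 * v) = (2 * v)^-1 * `|A| ^+ 2 + v / 2 - `|A|.
    by field; rewrite gt_eqF.
  lra.
rewrite meanD ?meanZ ?mean_cst; try by moments.
have h : (2 * v)^-1 * mean P (fun w => (B j j' w - b) ^+ 2) <= (2 * v)^-1 * v ^+ 2.
  rewrite ler_wpM2l ?invr_ge0 ?mulr_ge0 ?(ltW v0)//.
  exact: le_trans varB Sv.
have e : (2 * v)^-1 * v ^+ 2 = v / 2 by field; rewrite gt_eqF.
by rewrite e in h; apply: le_trans (lerD h (lexx (v / 2))) _; lra.
Qed.

End kernel_variance.

(** * The distances *)

Section index_sums.
Context {R : realType}.

Lemma upper_pair_inj n : injective (@upper_pair n).
Proof. by move=> k l /enum_val_inj /cast_ord_inj. Qed.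

(** Each summand involves two of the four indices; the two free ones give the factor n^2. *)
Lemma sum_pairs n (f : 'I_n -> 'I_n -> R) :
  \sum_(t : 'I_n * 'I_n) \sum_(t' : 'I_n * 'I_n) (f t.1 t'.1 + f t.1 t'.2) =
  2 * (n%:R ^+ 2 * \sum_i \sum_j f i j).
Proof.
have e (t : 'I_n * 'I_n) : \sum_(t' : 'I_n * 'I_n) (f t.1 t'.1 + f t.1 t'.2) =
    2 * (n%:R * \sum_j f t.1 j).
  rewrite big_split /= -(pair_big xpredT xpredT (fun i' j' => f t.1 i')) /=.
  rewrite -(pair_big xpredT xpredT (fun i' j' => f t.1 j')) /=.
  under eq_bigr do rewrite sumr_const card_ord -mulr_natl.
  by rewrite -mulr_sumr sumr_const card_ord -[X in _ + X]mulr_natl; ring.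
under eq_bigr do rewrite e.
rewrite -(pair_big xpredT xpredT (fun i j => 2 * (n%:R * \sum_j f i j))) /=.
under eq_bigr do rewrite sumr_const card_ord -[_ *+ n]mulr_natl.
by rewrite -!mulr_sumr; ring.
Qed.

Lemma sum_upper_pairs_le n (f : 'I_n -> 'I_n -> R) : (forall i j, 0 <= f i j) ->
  \sum_p \sum_q (f (@upper_pair n p).1 (@upper_pair n q).1 +
                 f (@upper_pair n p).1 (@upper_pair n q).2) <=
  2 * (n%:R ^+ 2 * \sum_i \sum_j f i j).
Proof.
move=> f0; rewrite -sum_pairs.
pose F (t t' : 'I_n * 'I_n) := f t.1 t'.1 + f t.1 t'.2.
have F0 t t' : 0 <= F t t' by rewrite addr_ge0.
apply: (@le_trans _ _ (\sum_p \sum_t' F (@upper_pair n p) t')).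
  by apply: ler_sum => p _; exact: (ler_sum_inj (@upper_pair_inj n) (F0 _)).
apply: (ler_sum_inj (@upper_pair_inj n) (F := fun t => \sum_t' F t t')) => t.
by apply: sumr_ge0.
Qed.

Lemma half_size_le n : ((n * n.+1)./2)%:R <= n%:R ^+ 2 :> R.
Proof.
have := ler_sum_inj (@upper_pair_inj n) (F := fun=> 1 : R) (fun=> ler01).
rewrite !sumr_const card_ord card_prod card_ord => /le_trans; apply.
by rewrite natrM.
Qed.

End index_sums.

Lemma covariance_centered d (T : measurableType d) (R : realType) (P : probability T R)
    (X Y : T -> R) : mean P X = 0 -> mean P Y = 0 -> itg P (fun w => X w * Y w) ->
  covariance P X Y = (mean P (fun w => X w * Y w))%:E.
Proof.
move=> X0 Y0 iXY; have eX : fine ('E_P[X])%E = 0 by rewrite unlock.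
have eY : fine ('E_P[Y])%E = 0 by rewrite unlock.
rewrite unlock eX eY unlock EFin_mean//; apply: eq_integral => w _.
by rewrite /= !fctE /= !subr0.
Qed.

Section wishart_distance.
Context dd (T : measurableType dd) (R : realType) (P : probability T R).
Context dg (TG : measurableType dg) (PG : probability TG R).
Variables (r s : int -> R) (X : nat -> nat -> T -> R) (n d : nat) (G : TG -> 'M[R]_n).
Hypotheses (n0 : (0 < n)%N) (d0 : (0 < d)%N).
Hypotheses (hr : correlation_function r) (hs : correlation_function s).
Hypotheses (r0 : r 0 = 1) (s0 : s 0 = 1).
Hypothesis hX : centered_gaussian P (fun p : nat * nat => X p.1 p.2).
Hypothesis hcov : forall i j i' j' : nat,
  ('E_P[fun w => (X i j w * X i' j' w)%R])%E = (r (i%:Z - i'%:Z) * s (j%:Z - j'%:Z))%:E.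
Hypothesis hG : gaussian_counterpart P (wishart r X n d) PG G.
Local Notation S := (window_sum (4 / 3) s d).
Local Notation m := (n * n.+1)./2.
Local Notation e := (@upper_pair n).
Local Notation B := (@kernel_form _ T R s X n d).

Let Z (a : 'I_n * 'I_d) : T -> R := X a.1 a.2.

Let gZ : gaussian_vector P Z.
Proof.
apply: (gaussian_vector_comp (e := fun a : 'I_n * 'I_d => ((a.1 : nat), (a.2 : nat))) _ hX).
by move=> [i k] [i' k'] [/val_inj -> /val_inj ->].
Qed.

Let ZC a b : mean P (fun w => Z a w * Z b w) =
  r ((a.1 : nat)%:Z - (b.1 : nat)%:Z) * s ((a.2 : nat)%:Z - (b.2 : nat)%:Z).
Proof. by have := hcov a.1 a.2 b.1 b.2; rewrite unlock /mean /Rintegral => ->. Qed.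

Let r1 := correlation_le1 hr r0.

Let W (p : 'I_m) w : R := half_vec (wishart r X n d w) 0 p.
Let V (p : 'I_m) w : R := half_vec (G w) 0 p.

Let WE p : W p = fun w => wishart r X n d w (e p).1 (e p).2.
Proof. by apply/funext => w; rewrite /W /half_vec mxE. Qed.

Let VE p : V p = fun w => G w (e p).1 (e p).2.
Proof. by apply/funext => w; rewrite /V /half_vec mxE. Qed.

Let K (p q : 'I_m) w := rho r (e p).1 (e q).1 * B (e p).2 (e q).2 w +
                        rho r (e p).1 (e q).2 * B (e p).2 (e q).1 w.
Let C p q := mean P (K p q).

Let Bm j j' : all_moments P (B j j'). Proof. exact: (kernel_form_moments _ gZ). Qed.
Let Km p q : all_moments P (K p q). Proof. by rewrite /K; moments. Qed.
Let Wm p : all_moments P (W p). Proof. by rewrite WE; exact: (wishart_moments _ gZ). Qed.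

Let WK : stein_kernel P W K.
Proof.
have := wishart_stein_kernel s0 gZ ZC e.
by congr stein_kernel; apply/funext => p; rewrite WE.
Qed.

(** The Stein identity tested against the constant 1, whose gradient vanishes. *)
Let W0 p : mean P (W p) = 0.
Proof.
have := WK p (@diffble_cst R _ 1) (@polynomial_growth_cst R _ _) (fun=> @curve_continuous_cst R _ _)
  (fun=> @polynomial_growth_cst R _ _).
rewrite big1 => [<-|q _]; first by congr (mean P _); apply/funext => w; rewrite mulr1.
by under eq_fun do rewrite mulr0; rewrite mean_cst.
Qed.

Let gV : gaussian_vector PG V.
Proof.
have [_ cG _] := hG.
have := gaussian_vector_comp (@upper_pair_inj n) cG.
by congr gaussian_vector; apply/funext => p; rewrite VE.
Qed.

Let Vm p : all_moments PG (V p). Proof. exact: gaussian_vector_moments gV p. Qed.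

(** The kernel of a Gaussian vector is its covariance, which is that of W by assumption and the mean
    of K by [stein_kernel_mean]. *)
Let VC : stein_kernel PG V (fun p q _ => C p q).
Proof.
have := gaussian_stein_kernel gV; congr stein_kernel.
apply/funext => p; apply/funext => q; apply/funext => _.
apply: EFin_inj; rewrite -covariance_centered ?gV.2//; last by moments.
rewrite !VE; have [_ _ ->] := hG; rewrite -!WE covariance_centered//; last by moments.
by rewrite (stein_kernel_mean _ _ Km WK).
Qed.

Let A j j' w := B j j' w - mean P (B j j').
Let Am j j' : all_moments P (A j j'). Proof. by rewrite /A; moments. Qed.

Let KC p q w : K p q w - C p q = rho r (e p).1 (e q).1 * A (e p).2 (e q).2 w +
                                 rho r (e p).1 (e q).2 * A (e p).2 (e q).1 w.
Proof.
have CE : C p q = rho r (e p).1 (e q).1 * mean P (B (e p).2 (e q).2) +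
                  rho r (e p).1 (e q).2 * mean P (B (e p).2 (e q).1).
  by rewrite /C /K meanD; [congr (_ + _); apply: meanZ; moments|moments..].
by rewrite CE /K /A; ring.
Qed.

Let kap := S `^ (3 / 2) / Num.sqrt d%:R.
(** The variance bound is 2 kap^2; the factor 2 rounds up the square root of 2. *)
Let v := 2 * kap.

Let v0 : 0 < v.
Proof.
by rewrite mulr_gt0// divr_gt0 ?powR_gt0 ?window_sum_gt0// sqrtr_gt0 ltr0n.
Qed.

Let Sv : 2 * S ^+ 3 / d%:R <= v ^+ 2.
Proof.
rewrite /v /kap exprMn exprMn exprVn sqr_sqrtr// -[(_ `^ _) ^+ 2]powR_mulrn ?powR_ge0//.
rewrite -powRrM (_ : 3 / 2 * 2%:R = 3%:R); last by lra.
rewrite powR_mulrn ?(ltW (window_sum_gt0 d0 s0))// mulrA ler_pM2r ?invr_gt0 ?ltr0n//.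
rewrite ler_pM2r ?exprn_gt0 ?window_sum_gt0//; lra.
Qed.

Let A1 j j' : mean P (fun w => `|A j j' w|) <= v.
Proof. exact: (kernel_form_mean_dev d0 hs.1 r1 gZ ZC). Qed.

Let A2 j j' : mean P (fun w => A j j' w ^+ 2) <= v ^+ 2.
Proof. exact: le_trans (kernel_form_variance d0 hs.1 r1 gZ ZC j j') Sv. Qed.

(** Every second derivative is bounded by 1, so D is the sum of the absolute fluctuations. In 2 pi =
    (pi / 2) 2 2, one factor 2 counts the two terms of the kernel and the other is that of [v]. *)
Lemma wishart_dist2_le :
  (dist2 P PG (fun w => half_vec (wishart r X n d w)) (fun w => half_vec (G w)) <=
   (2 * pi * (n%:R ^+ 2 * (\sum_(i < n) \sum_(j < n) `|rho r i j|) * kap))%:E)%E.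
Proof.
apply: ge_ereal_sup => _ [h [h2 /hess_sup_le1 h1] <-].
pose D w := \sum_p \sum_q (`|rho r (e p).1 (e q).1| * `|A (e p).2 (e q).2 w| +
                 `|rho r (e p).1 (e q).2| * `|A (e p).2 (e q).1 w|).
have iD : itg P D by rewrite /D; moments.
apply: le_trans (expectation_gap_le Wm Km Vm WK VC h2 h1 iD _) _.
  move=> y w; rewrite (le_trans (ler_norm_sum _ _ _))// ler_sum// => p _.
  rewrite (le_trans (ler_norm_sum _ _ _))// ler_sum// => q _.
  rewrite normrM (le_trans (ler_piMr _ (h1 _ _ _)))// KC.
  by rewrite (le_trans (ler_normD _ _))// !normrM.
rewrite lee_fin (_ : 2 * pi * _ =
  pi / 2 * (2 * (n%:R ^+ 2 * \sum_(i < n) \sum_(j < n) `|rho r i j|) * v)); last first.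
  by rewrite /v; field.
rewrite ler_wpM2l ?divr_ge0 ?pi_ge0// /D mean_sum; last by move=> p; moments.
apply: le_trans (_ : \sum_p \sum_q (`|rho r (e p).1 (e q).1| + `|rho r (e p).1 (e q).2|) * v <= _).
  apply: ler_sum => p _; rewrite mean_sum; last by move=> q; moments.
  apply: ler_sum => q _; rewrite meanD ?meanZ; [|by moments..].
  by rewrite mulrDl lerD// ler_wpM2l.
under eq_bigr do rewrite -mulr_suml.
rewrite -mulr_suml ler_wpM2r ?(ltW v0)//.
exact: (sum_upper_pairs_le (f := fun i j => `|rho r i j|)).
Qed.

(** Here the Hessian enters through its Hilbert-Schmidt norm. A weighted arithmetic-geometric mean
    inequality plays the role of Cauchy-Schwarz, so that D stays a polynomial in the kernel. *)
Lemma wishart_dist2_tilde_le :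
  (dist2_tilde P PG (fun w => half_vec (wishart r X n d w)) (fun w => half_vec (G w)) <=
   (2 * pi * (n%:R ^+ 2 * Num.sqrt (\sum_(i < n) \sum_(j < n) rho r i j ^+ 2) * kap))%:E)%E.
Proof.
apply: ge_ereal_sup => _ [h [h2 /M2_le1 h1] <-].
have h1' i j y : `|partial2 h i j y| <= 1.
  rewrite -(@ler_pXn2r _ 2)// ?nnegrE// expr1n real_normK ?num_real//.
  apply: le_trans (h1 j y); rewrite (bigD1 i)//= lerDl.
  by apply: sumr_ge0 => k _; exact: sqr_ge0.
set ro := \sum_(i < n) \sum_(j < n) rho r i j ^+ 2.
(* The diagonal entry r(0)^2 = 1 makes division by the weight [l] legitimate. *)
have ro_gt0 : 0 < ro.
  have ro_ge0 (i : 'I_n) : 0 <= \sum_j rho r i j ^+ 2.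
    by apply: sumr_ge0 => j _; exact: sqr_ge0.
  rewrite /ro (bigD1 (Ordinal n0))//= ltr_pwDl ?sumr_ge0//.
  rewrite (bigD1 (Ordinal n0))//= ltr_pwDl ?sumr_ge0//; last by move=> *; exact: sqr_ge0.
  by rewrite /rho subrr r0 expr1n.
(* The weight that balances the two halves: the mean of the squared fluctuations is at most 4 v^2
   n^2 ro = l^2 n^2, so each half contributes at most l n^2 / 2. *)
set l := 2 * v * Num.sqrt ro.
have l0 : 0 < l by apply: mulr_gt0; rewrite ?sqrtr_gt0//; exact: mulr_gt0.
pose D w := l / 2 * n%:R ^+ 2 + (2 * l)^-1 * \sum_p \sum_q (K p q w - C p q) ^+ 2.
have iD : itg P D by rewrite /D; moments.
apply: le_trans (expectation_gap_le Wm Km Vm WK VC h2 h1' iD _) _.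
  move=> y w.
  have amgm (a b : R) : `|a * b| <= l / 2 * b ^+ 2 + (2 * l)^-1 * a ^+ 2.
    rewrite normrM -[b ^+ 2]real_normK ?num_real// -[a ^+ 2]real_normK ?num_real//.
    move: `|a| `|b| => x z; rewrite -subr_ge0.
    have -> : l / 2 * z ^+ 2 + (2 * l)^-1 * x ^+ 2 - x * z = (l * z - x) ^+ 2 / (2 * l).
      by field; rewrite gt_eqF.
    by rewrite divr_ge0 ?sqr_ge0// mulr_ge0// ltW.
  apply: le_trans (_ : \sum_p \sum_q (l / 2 * partial2 h q p y ^+ 2 +
     (2 * l)^-1 * (K p q w - C p q) ^+ 2) <= _).
    rewrite (le_trans (ler_norm_sum _ _ _))// ler_sum// => p _.
    by rewrite (le_trans (ler_norm_sum _ _ _))// ler_sum.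
  rewrite /D; under eq_bigr do rewrite big_split /= -!mulr_sumr.
  rewrite big_split /= -!mulr_sumr lerD2r ler_pM2l ?divr_gt0//.
  (* The squared entries of each column of the Hessian sum to at most 1, and there are n(n+1)/2 <=
     n^2 columns. *)
  apply: le_trans (half_size_le n); rewrite -[X in _ <= X%:R](card_ord m) -sumr_const.
  by apply: ler_sum => p _; exact: h1.
rewrite lee_fin (_ : 2 * pi * _ = pi / 2 * (l * n%:R ^+ 2)); last first.
  by rewrite /l /v; field.
rewrite ler_wpM2l ?divr_ge0 ?pi_ge0// /D meanD ?meanZ ?mean_cst; [|by moments..].
have sum_le : mean P (fun w => \sum_p \sum_q (K p q w - C p q) ^+ 2) <=
    4 * v ^+ 2 * (n%:R ^+ 2 * ro).
  rewrite mean_sum; last by move=> p; moments.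
  apply: le_trans (_ : \sum_p \sum_q
    (rho r (e p).1 (e q).1 ^+ 2 + rho r (e p).1 (e q).2 ^+ 2) * (2 * v ^+ 2) <= _).
    apply: ler_sum => p _; rewrite mean_sum; last by move=> q; moments.
    apply: ler_sum => q _.
    apply: le_trans (_ : mean P (fun w => 2 * rho r (e p).1 (e q).1 ^+ 2 * A (e p).2 (e q).2 w ^+ 2 +
       2 * rho r (e p).1 (e q).2 ^+ 2 * A (e p).2 (e q).1 w ^+ 2) <= _).
      apply: le_mean => [||w]; [by moments|by moments|].
      by rewrite KC; set x := _ * _; set z := _ * _; have := sqr_ge0 (x - z); rewrite /x /z; lra.
    rewrite meanD ?meanZ; [|by moments..].
    have a1 := A2 (e p).2 (e q).2; have a2 := A2 (e p).2 (e q).1.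
    have s1 := sqr_ge0 (rho r (e p).1 (e q).1); have s2 := sqr_ge0 (rho r (e p).1 (e q).2).
    have := ler_wpM2l s1 a1; have := ler_wpM2l s2 a2; lra.
  under eq_bigr do rewrite -mulr_suml.
  rewrite -mulr_suml.
  have v2 : 0 <= 2 * v ^+ 2 by apply: mulr_ge0 => //; exact: sqr_ge0.
  apply: le_trans (ler_wpM2r v2 (sum_upper_pairs_le (f := fun i j => rho r i j ^+ 2)
    (fun _ _ => sqr_ge0 _))) _.
  rewrite -/ro; lra.
have h4 : (2 * l)^-1 * mean P (fun w => \sum_p \sum_q (K p q w - C p q) ^+ 2) <= l / 2 * n%:R ^+ 2.
  apply: (le_trans (ler_wpM2l _ sum_le)); first by rewrite invr_ge0 mulr_ge0// ltW.
  rewrite le_eqVlt; apply/orP; left; apply/eqP.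
  rewrite -[in LHS](sqr_sqrtr (ltW ro_gt0)) /l; field.
  by rewrite !gt_eqF ?sqrtr_gt0// /kap.
by apply: le_trans (lerD (lexx _) h4) _; lra.
Qed.

End wishart_distance.

(** * Growth in n of the sums of r, and half-integer powers *)

Section row_sums.
Context {R : realType}.

(** For fixed i the differences i - j are distinct integers, so every row sum is a partial sum over
    the integers. *)
Lemma summable_row_sum (a : int -> R) : (forall k, 0 <= a k) ->
  summable [set: int] (fun k => (a k)%:E) ->
  exists2 c, 0 <= c & forall n (i : 'I_n), \sum_(j < n) a ((i : nat)%:Z - (j : nat)%:Z) <= c.
Proof.
move=> a0 sa; exists (fine (\esum_(k in [set: int]) `|(a k)%:E|)%E).
  by apply: fine_ge0; apply: esum_ge0.
move=> n i; rewrite -lee_fin fineK -?summableE// -sumEFin.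
pose f (j : 'I_n) : int := (i : nat)%:Z - (j : nat)%:Z.
have us : uniq (map f (enum 'I_n)).
  by rewrite map_inj_uniq ?enum_uniq// => j j' /addrI /oppr_inj [] /val_inj.
apply: esum_ge; exists [set` map f (enum 'I_n)]; first by split; [exact: finite_seq|].
rewrite -fsbig_seq// big_map big_enum /=.
by apply: lee_sum => j _; rewrite lee_fin ler_norm.
Qed.

End row_sums.

Section powers.
Context {R : realType}.

Lemma powR_half_int (x : R) (k : nat) : 0 <= x ->
  x `^ (k%:R + 1 / 2) = x ^+ k * Num.sqrt x.
Proof.
move=> x0; have [->|xn0] := eqVneq x 0.
  by rewrite sqrtr0 mulr0 powR0// gt_eqF// ltr_wpDl// divr_gt0.
by rewrite powRD ?xn0 ?implybT// powR_mulrn// div1r powR12_sqrt.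
Qed.

End powers.

Theorem theorem4p3 (R : realType) (r s : int -> R)
    (hr : correlation_function r) (hs : correlation_function s)
    (hr0 : r 0 = 1) (hs0 : s 0 = 1) (hs2 : ell 2 s)
    (dT : measure_display) (T : measurableType dT) (P : probability T R)
    (X : nat -> nat -> T -> R)
    (hX : centered_gaussian P (fun p : nat * nat => X p.1 p.2))
    (hcov : forall i j i' j' : nat,
       ('E_P[fun w => (X i j w * X i' j' w)%R])%E =
         (r (i%:Z - i'%:Z) * s (j%:Z - j'%:Z))%:E) :
  [/\ (exists C C' : R, forall n d : nat, (1 <= n)%N -> (1 <= d)%N ->
        forall (dG : measure_display) (TG : measurableType dG)
          (PG : probability TG R) (G : TG -> 'M[R]_n),
        gaussian_counterpart P (wishart r X n d) PG G ->
        (dist2 P PG (fun w => half_vec (wishart r X n d w))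
          (fun w => half_vec (G w)) <=
          (C * (n%:R ^+ 4 / Num.sqrt d%:R *
            window_sum (4 / 3) s d `^ (3 / 2)))%:E)%E /\
        (dist2_tilde P PG (fun w => half_vec (wishart r X n d w))
          (fun w => half_vec (G w)) <=
          (C' * (n%:R ^+ 3 / Num.sqrt d%:R *
            window_sum (4 / 3) s d `^ (3 / 2)))%:E)%E),
      (ell 2 r ->
       exists C C' : R, forall n d : nat, (1 <= n)%N -> (1 <= d)%N ->
        forall (dG : measure_display) (TG : measurableType dG)
          (PG : probability TG R) (G : TG -> 'M[R]_n),
        gaussian_counterpart P (wishart r X n d) PG G ->
        (dist2 P PG (fun w => half_vec (wishart r X n d w))
          (fun w => half_vec (G w)) <=
          (C * (n%:R `^ (7 / 2) / Num.sqrt d%:R *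
            window_sum (4 / 3) s d `^ (3 / 2)))%:E)%E /\
        (dist2_tilde P PG (fun w => half_vec (wishart r X n d w))
          (fun w => half_vec (G w)) <=
          (C' * (n%:R `^ (5 / 2) / Num.sqrt d%:R *
            window_sum (4 / 3) s d `^ (3 / 2)))%:E)%E) &
      (ell 1 r ->
       exists C C' : R, forall n d : nat, (1 <= n)%N -> (1 <= d)%N ->
        forall (dG : measure_display) (TG : measurableType dG)
          (PG : probability TG R) (G : TG -> 'M[R]_n),
        gaussian_counterpart P (wishart r X n d) PG G ->
        (dist2 P PG (fun w => half_vec (wishart r X n d w))
          (fun w => half_vec (G w)) <=
          (C * (n%:R ^+ 3 / Num.sqrt d%:R *
            window_sum (4 / 3) s d `^ (3 / 2)))%:E)%E /\
        (dist2_tilde P PG (fun w => half_vec (wishart r X n d w))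
          (fun w => half_vec (G w)) <=
          (C' * (n%:R `^ (5 / 2) / Num.sqrt d%:R *
            window_sum (4 / 3) s d `^ (3 / 2)))%:E)%E)].
Proof.
have r1 := correlation_le1 hr hr0.
pose rho1 n := \sum_(i < n) \sum_(j < n) `|rho r i j|.
pose rho2 n := \sum_(i < n) \sum_(j < n) rho r i j ^+ 2.
have rho1_ge0 n : 0 <= rho1 n by apply: sumr_ge0 => i _; apply: sumr_ge0.
have rho2_ge0 n : 0 <= rho2 n.
  by apply: sumr_ge0 => i _; apply: sumr_ge0 => j _; exact: sqr_ge0.
have rho1_le n : rho1 n <= n%:R ^+ 2.
  apply: (@le_trans _ _ (\sum_(i < n) \sum_(j < n) 1)).
    by apply: ler_sum => i _; apply: ler_sum => j _; exact: r1.
  by rewrite !sumr_const card_ord -mulrnA natrM.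
have rho21 n : rho2 n <= rho1 n.
  apply: ler_sum => i _; apply: ler_sum => j _.
  by rewrite -[_ ^+ 2]real_normK ?num_real// expr2 ler_piMl// r1.
(* Cauchy-Schwarz against the constant 1 on n^2 pairs. *)
have rho12 n : rho1 n <= n%:R * Num.sqrt (rho2 n).
  rewrite -(@ler_pXn2r _ 2)// ?nnegrE ?mulr_ge0 ?sqrtr_ge0//.
  rewrite exprMn sqr_sqrtr// /rho1 /rho2 !pair_big /=.
  have /= := cauchy_schwarz_sum (fun t : 'I_n * 'I_n => `|rho r t.1 t.2|) (fun=> 1).
  under eq_bigr do rewrite mulr1.
  under [X in X * _]eq_bigr do rewrite real_normK ?num_real//.
  move=> /le_trans; apply; rewrite mulrC ler_wpM2r//.
    by apply: sumr_ge0 => t _; exact: sqr_ge0.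
  by rewrite expr1n sumr_const card_prod card_ord natrM expr2.
(* All three regimes reduce to the growth in n of n^2 rho1 and n^2 sqrt(rho2). *)
have bound (a1 a2 : nat -> R) (c1 c2 : R) :
    (forall n, (0 < n)%N -> n%:R ^+ 2 * rho1 n <= c1 * a1 n) ->
    (forall n, (0 < n)%N -> n%:R ^+ 2 * Num.sqrt (rho2 n) <= c2 * a2 n) ->
    exists C C' : R, forall n d : nat, (1 <= n)%N -> (1 <= d)%N ->
        forall (dG : measure_display) (TG : measurableType dG)
          (PG : probability TG R) (G : TG -> 'M[R]_n),
        gaussian_counterpart P (wishart r X n d) PG G ->
        (dist2 P PG (fun w => half_vec (wishart r X n d w))
          (fun w => half_vec (G w)) <=
          (C * (a1 n / Num.sqrt d%:R *
            window_sum (4 / 3) s d `^ (3 / 2)))%:E)%E /\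
        (dist2_tilde P PG (fun w => half_vec (wishart r X n d w))
          (fun w => half_vec (G w)) <=
          (C' * (a2 n / Num.sqrt d%:R *
            window_sum (4 / 3) s d `^ (3 / 2)))%:E)%E.
  move=> h1 h2; exists (2 * pi * c1), (2 * pi * c2) => n d n0 d0 dG TG PG G hG.
  set k := window_sum (4 / 3) s d `^ (3 / 2) / Num.sqrt d%:R.
  have k0 : 0 <= k by rewrite divr_ge0 ?powR_ge0 ?sqrtr_ge0.
  have pi2 : 0 <= 2 * pi :> R by rewrite mulr_ge0 ?pi_ge0.
  have kE (c a : R) : 2 * pi * c * (a / Num.sqrt d%:R * window_sum (4 / 3) s d `^ (3 / 2)) =
      2 * pi * (c * a * k) by rewrite /k; ring.
  rewrite !kE; split.
    apply: le_trans (wishart_dist2_le d0 hr hs hr0 hs0 hX hcov hG) _.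
    by rewrite lee_fin ler_wpM2l// ler_wpM2r// h1.
  apply: le_trans (wishart_dist2_tilde_le n0 d0 hr hs hr0 hs0 hX hcov hG) _.
  by rewrite lee_fin ler_wpM2l// ler_wpM2r// h2.
have h72 : 7 / 2 = 3%:R + 1 / 2 :> R by lra.
have h52 : 5 / 2 = 2%:R + 1 / 2 :> R by lra.
split.
- apply: (bound (fun n => n%:R ^+ 4) (fun n => n%:R ^+ 3) 1 1) => n n0; rewrite mul1r.
    by rewrite (exprD _ 2 2) ler_wpM2l ?sqr_ge0.
  rewrite (exprD _ 2 1) expr1 ler_wpM2l ?sqr_ge0//.
  rewrite -[leRHS]ger0_norm// -sqrtr_sqr ler_wsqrtr//.
  exact: le_trans (rho21 n) (rho1_le n).
(* Row sums of r^2 are bounded by c, so rho2 <= c n, and rho1 <= n sqrt(c n) by [rho12]. *)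
- move=> r2; have [|c c0 cP] := @summable_row_sum R (fun k => `|r k| `^ 2) _ r2.
    by move=> k; exact: powR_ge0.
  have rho2c n : Num.sqrt (rho2 n) <= Num.sqrt c * Num.sqrt n%:R.
    rewrite -sqrtrM// ler_wsqrtr//; apply: (@le_trans _ _ (\sum_(i < n) c)).
      apply: ler_sum => i _; apply: le_trans (cP n i); apply: ler_sum => j _.
      by rewrite powR_mulrn// real_normK ?num_real /rho.
    by rewrite sumr_const card_ord -[c *+ n]mulr_natr.
  apply: (bound (fun n => n%:R `^ (7 / 2)) (fun n => n%:R `^ (5 / 2)) (Num.sqrt c) (Num.sqrt c)) => n n0.
    rewrite h72 powR_half_int// (exprD _ 2 1) expr1.
    rewrite (_ : Num.sqrt c * _ = n%:R ^+ 2 * (n%:R * (Num.sqrt c * Num.sqrt n%:R))); last by ring.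
    rewrite ler_wpM2l ?sqr_ge0//; apply: le_trans (rho12 n) _.
    by rewrite ler_wpM2l.
  rewrite h52 powR_half_int// mulrCA ler_wpM2l ?sqr_ge0//.
(* Now rho1 <= c n, and rho2 <= rho1 because |r| <= 1: the first distance gains a further n^(1/2),
   the second keeps its exponent. *)
- move=> r2; have [|c c0 cP] := @summable_row_sum R (fun k => `|r k| `^ 1) _ r2.
    by move=> k; exact: powR_ge0.
  have rho1c n : rho1 n <= c * n%:R.
    apply: (@le_trans _ _ (\sum_(i < n) c)).
      apply: ler_sum => i _; apply: le_trans (cP n i); apply: ler_sum => j _.
      by rewrite powRr1 /rho.
    by rewrite sumr_const card_ord -[c *+ n]mulr_natr.
  apply: (bound (fun n => n%:R ^+ 3) (fun n => n%:R `^ (5 / 2)) c (Num.sqrt c)) => n n0.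
    by rewrite (exprD _ 2 1) expr1 mulrCA ler_wpM2l ?sqr_ge0.
  rewrite h52 powR_half_int// mulrCA ler_wpM2l ?sqr_ge0// -sqrtrM// ler_wsqrtr//.
  exact: le_trans (rho21 n) (rho1c n).
Qed.
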